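(* Let $(\Omega,\mathcal{F},X,(\mathcal{F}^X_t)_{t\in[0,T]},\mathbb{P})\in\mathcal{M}_\sigma$, where $X$ is a continuous martingale with respect to the filtration $(\mathcal{F}^X_t)_{t\in[0,T]}$ generated by $X$. Let $H\in L^1(\mathbb{P})$ be $\mathcal{F}^X_T$-measurable and $Y(t)=\mathbb{E}[H\mid\mathcal{F}^X_t]$, $t\in[0,T]$. Assume that $Y\in\mathcal{C}^{1,2}_b(X)$, with $Y(t)=F_t(X_t)$ where $F\in\mathbb{C}^{1,2}_b$. Then for every $(\tilde\Omega,\tilde{\mathcal{F}},Z,(\mathcal{F}^Z_t)_{t\in[0,T]},\tilde{\mathbb{P}})\in\mathcal{M}_\sigma$ (where $(\mathcal{F}^Z_t)$ is the filtration generated by $Z$) and every $t\in[0,T]$, $$F_t(Z_t)=F_0(Z_0)+\int_0^t\nabla_xF_s(Z_s)\,dZ(s)\qquad \tilde{\mathbb{P}}\text{-a.s.},$$ where the stochastic integral is understood as a Föllmer integral.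
   Context: Paths. Fix $T>0$ and an open set $U\subset\mathbb{R}$. $D([0,t],U)$ is the space of càdlàg functions $[0,t]\to U$, and $C([a,b],U)$, $C([a,b])$ are the spaces of continuous functions $[a,b]\to U$, $[a,b]\to\mathbb{R}$. For a path $x$, $x(t)$ is its value at $t$ and $x_t=(x(u))_{u\in[0,t]}$ its restriction to $[0,t]$; the same notation is used for processes. $x_{t-}$ is the path on $[0,t]$ with $x_{t-}(u)=x(u)$ for $u<t$ and $x_{t-}(t)=x(t-)=\lim_{s\uparrow t}x(s)$ (with $x_{0-}(0)=x(0)$). Fix $s_0\in U$ and let $C_{s_0}=\{x\in C([0,T],U): x(0)=s_0\}$. Partitions and quadratic variation. A sequence of partitions $\pi_n=\{0=t^n_0<\dots<t^n_{k(n)}=T\}$ of $[0,T]$ with $|\pi_n|=\max_j(t^n_j-t^n_{j-1})\to0$ is fixed throughout. A process $X$ is a quadratic variation process if for all $t\in[0,T]$ the limit $[X](t)=\lim_n\sum_{t^n_j\in\pi_n\cap(0,t]}(X(t^n_j)-X(t^n_{j-1}))^2$ exists a.s. and is continuous in $t$. Model class. $\sigma:\mathbb{R}\to\mathbb{R}$ is continuously differentiable, of at most linear growth, with $\sigma\neq0$ Lebesgue-a.e. Let $f_\sigma$ be the unique solution of $f'(x)=\sigma(f(x))$, $f(0)=s_0$. It is assumed throughout that, for a Brownian motion $W$ on Wiener space, $M(t)=\exp\left(-\frac12\int_0^t\sigma'(f_\sigma(W(r)))dW(r)-\frac18\int_0^t(\sigma'(f_\sigma(W(r))))^2dr\right)$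 is well defined and a martingale. Put $C_{\sigma,s_0}=\{f_\sigma(\theta(\cdot)):\theta\in C([0,T]),\theta(0)=0\}$; its paths, along which functionals on $U$-valued paths are evaluated, are understood to take values in $U$. A discounted market model is a five-tuple $(\Omega,\mathcal{F},S,(\mathcal{F}_t)_{t\in[0,T]},\mathbb{P})$ where $(\Omega,\mathcal{F},(\mathcal{F}_t),\mathbb{P})$ is a filtered probability space satisfying the usual conditions (generated filtrations are understood to be augmented accordingly) and $S$ is an $(\mathcal{F}_t)$-progressively measurable quadratic variation process with continuous paths starting from $s_0$. $\mathcal{M}_\sigma$ is the class of discounted market models such that $d[S](t)=\sigma^2(S(t))dt$ a.s., $\mathbb{P}(S\in C_{\sigma,s_0})=1$, and $S$ has full support in $C_{s_0}$, i.e. $\mathrm{supp}(\mathrm{Law}(S_T))=C_{s_0}$, where $S_T=(S(u))_{u\in[0,T]}$. Non-anticipative functionals. A non-anticipative functional is a family $F=(F_t)_{t\in[0,T]}$ of maps $F_t:D([0,t],U)\to\mathbb{R}$. For $x_t\in D([0,t],U)$ and $h\ge 0$, the horizontal extension $x_{t,h}\in D([0,t+h],U)$ equals $x$ on $[0,t]$ and $x(t)$ on $(t,t+h]$. For $h\in\mathbb{R}$ the vertical perturbation $x_t^h$ equals $x$ on $[0,t)$ and $x_t^h(t)=x(t)+h$. The horizontal derivative is $\mathcal{D}_tF(x)=\lim_{h\downarrow0}\frac{F_{t+h}(x_{t,h})-F_t(x)}{h}$ and the vertical derivative is $\nabla_xF_t(x)=\lim_{h\to0}\frac{F_t(x_t^h)-F_t(x)}{h}$,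 $x\in D([0,t],U)$, when the limits exist; if they exist for all paths they define non-anticipative functionals $\mathcal{D}F=(\mathcal{D}_tF)_{t\in[0,T)}$ and $\nabla_xF$; $\nabla_x^2F=\nabla_x(\nabla_xF)$. $F$ is continuous at fixed times if each $F_t$ is continuous for the supremum norm. For $x\in D([0,t])$, $x'\in D([0,t+h])$, $d_\infty(x,x')=\sup_{u\in[0,t+h]}|x_{t,h}(u)-x'(u)|+h$ (and symmetrically if the first path is defined on the longer interval). $F\in\mathbb{F}^\infty_l$ (left-continuous) if for all $t\in[0,T]$, $\epsilon>0$, $x\in D([0,t],U)$ there is $\eta>0$ such that for all $h\in[0,t]$ and $x'\in D([0,t-h],U)$, $d_\infty(x,x')<\eta$ implies $|F_t(x)-F_{t-h}(x')|<\epsilon$. $F\in\mathbb{B}$ (boundedness-preserving) if for every compact $K\subset U$ there is $C>0$ with $|F_t(x)|\le C$ for all $t\le T$, $x\in D([0,t],K)$. $\mathbb{C}^{1,2}$ is the set of non-anticipative functionals $F$ that are once horizontally and twice vertically differentiable for all $t\in[0,T)$ and $x\in D([0,t],U)$, with $\mathcal{D}F$ continuous at fixed times and $F,\nabla_xF,\nabla_x^2F\in\mathbb{F}^\infty_l$. $\mathbb{C}^{1,2}_b=\{F\in\mathbb{C}^{1,2}: F,\mathcal{D}F,\nabla_xF,\nabla_x^2F\in\mathbb{B}\}$. For a continuous martingale $X$, $\mathcal{C}^{1,2}_b(X)$ is the set of processes $Y$ with $Y(t)=F_t(X_t)$ a.s. for some $F\in\mathbb{C}^{1,2}_b$. Föllmer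 integral. For a continuous $U$-valued path $x$ with finite quadratic variation along $(\pi_n)$, set $x^n(t)=\sum_{j=0}^{k(n)-1}x(t^n_{j+1})1_{[t^n_j,t^n_{j+1})}(t)+x(T)1_{\{T\}}(t)$. The Föllmer integral is $\int_0^t\nabla_xF_u(x_u)dx(u)=\lim_n\sum_{i:\,t^n_{i+1}\in\pi_n\cap(0,t]}\nabla_xF_{t^n_i}(x^n_{t^n_i-})(x(t^n_{i+1})-x(t^n_i))$. For processes it is taken pathwise. *)

(* Defs.v *)
From HB Require Import structures.
From mathcomp Require Import all_boot all_order all_algebra.
From mathcomp Require Import all_classical all_reals all_analysis.

Set Implicit Arguments.
Unset Strict Implicit.
Unset Printing Implicit Defensive.

Import Order.TTheory GRing.Theory Num.Theory.
Import numFieldNormedType.Exports.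

Local Open Scope classical_set_scope.
Local Open Scope ring_scope.

(* A path on [0, t] is encoded by a total function [R -> R] of which only the
   values on [0, t] matter.  A process is a function [X : R -> Omega -> R];
   its path is [X ^~ w], which also stands for the restriction X_t wherever a
   time t is passed along with it. *)

Section Paths.
Context {R : realType}.
Implicit Types (A K U : set R) (t s h T : R) (x y : R -> R).

(* D([0,t], A).  Left limits are required to lie in A, as for càdlàg functions
   with values in the topological space A, so that D([0,t], U) is stable under
   x |-> x_{t-}. *)
Definition cadlag A t x : Prop :=
  [/\ forall u, 0 <= u <= t -> A (x u),
      forall u, 0 <= u < t -> x @ u^'+ --> x u
    & forall u, 0 < u <= t -> exists2 l, A l & x @ u^'- --> l].

(* C([0,t], A) *)
Definition cont_paths A t : set (R -> R) :=
  [set x | {within `[0, t], continuous x} /\ forall u, 0 <= u <= t -> A (x u)].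

(* Path frozen at time t; on [0, t + h] this is the horizontal extension
   x_{t,h}, for every h >= 0. *)
Definition stop t x : R -> R := fun u => x (Num.min u t).

Definition vpert t x h : R -> R := fun u => if u < t then x u else x t + h.

(* x_{t-} *)
Definition left_path t x : R -> R :=
  fun u => if u < t then x u else if 0 < t then lim (x @ t^'-) else x 0.

Definition sup_dist t x y : \bar R :=
  ereal_sup [set (`|x u - y u|)%:E | u in `[0, t]].

(* d_infty between a path x on [0, t] and a path y on [0, s] *)
Definition dinfty t x s y : \bar R :=
  (sup_dist (Num.max t s) (stop t x) (stop s y) + (`|t - s|)%:E)%E.

End Paths.

Section Functionals.
Context {R : realType}.
Implicit Types (U K I : set R) (t s h T : R) (x y : R -> R).
Implicit Types F : R -> (R -> R) -> R.

(* A family of maps F_t : D([0,t], U) -> R, t in [0,T], is encoded by a total F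
   whose value at (t, x) depends only on x restricted to [0, t]. *)
Definition non_anticipative U T F : Prop :=
  forall t x y, 0 <= t <= T -> cadlag U t x -> cadlag U t y ->
    (forall u, 0 <= u <= t -> x u = y u) -> F t x = F t y.

Definition hquot F t x h : R := (F (t + h) (stop t x) - F t x) / h.
Definition hderiv F t x : R := lim (hquot F t x @ 0^'+).

Definition vquot F t x h : R := (F t (vpert t x h) - F t x) / h.
Definition vderiv F t x : R := lim (vquot F t x @ 0^').

Definition hdifferentiable U T F : Prop :=
  forall t x, 0 <= t < T -> cadlag U t x -> cvg (hquot F t x @ 0^'+).

Definition vdifferentiable U T F : Prop :=
  forall t x, 0 <= t < T -> cadlag U t x -> cvg (vquot F t x @ 0^').

(* The next three classes carry the set I of times at which the functional is
   defined: [0,T] for F itself, [0,T) for its derivatives. *)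
Definition continuous_at_fixed_times U I F : Prop :=
  forall t x (e : R), I t -> cadlag U t x -> 0 < e ->
    exists2 eta : R, 0 < eta &
      forall y, cadlag U t y -> (sup_dist t x y < eta%:E)%E ->
        `|F t x - F t y| < e.

Definition left_continuous U I F : Prop :=
  forall t x (e : R), I t -> cadlag U t x -> 0 < e ->
    exists2 eta : R, 0 < eta &
      forall h y, 0 <= h <= t -> cadlag U (t - h) y ->
        (dinfty t x (t - h) y < eta%:E)%E -> `|F t x - F (t - h) y| < e.

Definition boundedness_preserving U I F : Prop :=
  forall K, compact K -> K `<=` U ->
    exists2 C : R, 0 < C &
      forall t x, I t -> cadlag K t x -> `|F t x| <= C.

Definition C12 U T F : Prop :=
  [/\ [/\ non_anticipative U T F, hdifferentiable U T F,
          vdifferentiable U T F & vdifferentiable U T (vderiv F)],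
      continuous_at_fixed_times U `[0, T[ (hderiv F)
    & [/\ left_continuous U `[0, T] F,
          left_continuous U `[0, T[ (vderiv F)
        & left_continuous U `[0, T[ (vderiv (vderiv F))]].

Definition C12b U T F : Prop :=
  C12 U T F /\
  [/\ boundedness_preserving U `[0, T] F,
      boundedness_preserving U `[0, T[ (hderiv F),
      boundedness_preserving U `[0, T[ (vderiv F)
    & boundedness_preserving U `[0, T[ (vderiv (vderiv F))].

End Functionals.

Section Partitions.
Context {R : realType}.

Record partition_seq (T : R) := PartitionSeq {
  psize : nat -> nat;
  ptime : nat -> nat -> R;
  ptime_first : forall n, ptime n 0 = 0;
  ptime_last : forall n, ptime n (psize n) = T;
  ptime_lt : forall n j, (j < psize n)%N -> ptime n j < ptime n j.+1;
  pmesh_cvg0 :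
    (fun n => \big[Num.max/0]_(j < psize n) (ptime n j.+1 - ptime n j))
      @ \oo --> (0 : R) }.

Variables (T : R) (p : partition_seq T).

Definition qv_sum (x : R -> R) (t : R) (n : nat) : R :=
  \sum_(j < psize p n | ptime p n j.+1 <= t)
    (x (ptime p n j.+1) - x (ptime p n j)) ^+ 2.

Definition qv (x : R -> R) (t : R) : R := lim (qv_sum x t @ \oo).

(* x^n *)
Definition step_path (x : R -> R) (n : nat) : R -> R := fun u =>
  \sum_(j < psize p n)
      x (ptime p n j.+1) * \1_`[ptime p n j, ptime p n j.+1[ u
  + x T * \1_[set T] u.

Definition follmer_sum (G : R -> (R -> R) -> R) (x : R -> R) (t : R) (n : nat)
    : R :=
  \sum_(i < psize p n | ptime p n i.+1 <= t)
    G (ptime p n i) (left_path (ptime p n i) (step_path x n))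
    * (x (ptime p n i.+1) - x (ptime p n i)).

Definition follmer_integral (G : R -> (R -> R) -> R) (x : R -> R) (t : R) : R :=
  lim (follmer_sum G x t @ \oo).

End Partitions.

Section Stochastic.
Context {R : realType} {d : measure_display} {Omega : measurableType d}.
Variable P : probability Omega R.
Implicit Types (G : set (set Omega)) (Ft : R -> set (set Omega)).
Implicit Types (X Y M W : R -> Omega -> R) (T t s : R).

Definition measurable_wrt G (H : Omega -> R) : Prop :=
  preimage_set_system setT H measurable `<=` G.

(* H' is a version of E[H | G] *)
Definition is_cond_exp G (H H' : Omega -> R) : Prop :=
  [/\ measurable_wrt G H',
      P.-integrable setT (EFin \o H')
    & forall A, G A -> (\int[P]_(w in A) (H' w)%:E = \int[P]_(w in A) (H w)%:E)%E].

Definition natural_sigma X t : set (set Omega) :=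
  <<s \bigcup_(u in `[0, t]) preimage_set_system setT (X u) measurable >>.

Definition completed_sigma X t : set (set Omega) :=
  <<s natural_sigma X t `|` P.-negligible >>.

(* The filtration generated by X on [0,T], augmented by the null sets and made
   right-continuous: the intersection runs over ]t, T] if t < T and over {T}
   if t = T. *)
Definition generated_filtration X T t : set (set Omega) :=
  \bigcap_(s in `]t, +oo[) completed_sigma X (Num.min s T).

Definition usual_conditions T Ft : Prop :=
  [/\ measure_is_complete P,
      forall t, 0 <= t <= T -> sigma_algebra setT (Ft t) /\ Ft t `<=` measurable,
      forall s t, 0 <= s -> s <= t -> t <= T -> Ft s `<=` Ft t,
      P.-negligible `<=` Ft 0
    & forall t, 0 <= t < T -> \bigcap_(s in `]t, T]) Ft s `<=` Ft t].

Definition progressively_measurable T Ft X : Prop :=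
  forall t, 0 <= t <= T ->
    measurable_fun (`[0, t] `*` setT)
      (fun z : R * g_sigma_algebraType (Ft t) => X z.1 z.2).

Definition martingale T Ft M : Prop :=
  (forall t, 0 <= t <= T ->
     measurable_wrt (Ft t) (M t) /\ P.-integrable setT (EFin \o M t)) /\
  (forall s t, 0 <= s -> s <= t -> t <= T -> is_cond_exp (Ft s) (M t) (M s)).

Definition qv_process T (p : partition_seq T) X : Prop :=
  (forall t, 0 <= t <= T -> {ae P, forall w, cvg (qv_sum p (X ^~ w) t @ \oo)}) /\
  {ae P, forall w, {within `[0, T], continuous (qv p (X ^~ w))}}.

(* supp(Law(X_T)), as a set of paths in C([0,T], U) with the sup norm *)
Definition law_support U T X : set (R -> R) :=
  [set x | cont_paths U T x /\
     forall e : R, 0 < e ->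
       (0 < P [set w | sup_dist T (X ^~ w) x < e%:E])%E].

Definition cvg_prob0 (D : nat -> Omega -> \bar R) : Prop :=
  forall e : R, 0 < e ->
    (fun n => P [set w | (e%:E <= D n w)%E]) @ \oo --> 0%E.

(* Simple predictable integrands
   sum_(j < m) xi_j 1_(tau_j, tau_(j+1)], with xi_j bounded and
   F_(tau_j)-measurable *)
Record simple_process T Ft := SimpleProcess {
  spsize : nat;
  sptime : nat -> R;
  spcoef : nat -> Omega -> R;
  sptime_itv : forall j, (j <= spsize)%N -> 0 <= sptime j <= T;
  sptime_le : forall j, (j < spsize)%N -> sptime j <= sptime j.+1;
  spcoef_bound : forall j, (j < spsize)%N ->
    exists C : R, forall w, `|spcoef j w| <= C;
  spcoef_meas : forall j, (j < spsize)%N ->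
    measurable_wrt (Ft (sptime j)) (spcoef j) }.

Definition sp_val T Ft (phi : simple_process T Ft) : R -> Omega -> R :=
  fun t w => \sum_(j < spsize phi)
    spcoef phi j w * \1_`]sptime phi j, sptime phi j.+1] t.

Definition sp_integral T Ft (phi : simple_process T Ft) W : R -> Omega -> R :=
  fun t w => \sum_(j < spsize phi) spcoef phi j w *
    (W (Num.min (sptime phi j.+1) t) w - W (Num.min (sptime phi j) t) w).

(* J is (a continuous version of) the Itô integral of phi with respect to the
   Brownian motion W, for phi progressively measurable with paths in L^2([0,T]):
   the limit in probability, uniformly in time, of the integrals of simple
   integrands converging to phi in L^2([0,T]) in probability. *)
Definition is_ito_integral T Ft W (phi J : R -> Omega -> R) : Prop :=
  [/\ forall t, 0 <= t <= T -> measurable_wrt (Ft t) (J t),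
      {ae P, forall w, {within `[0, T], continuous (J ^~ w)}}
    & exists phin : nat -> simple_process T Ft,
        cvg_prob0 (fun n w =>
          (\int[lebesgue_measure]_(r in `[0%R, T])
             ((sp_val (phin n) r w - phi r w) ^+ 2)%:E)%E) /\
        cvg_prob0 (fun n w =>
          sup_dist T (sp_integral (phin n) W ^~ w) (J ^~ w))].

Definition brownian_motion T W : Prop :=
  [/\ forall t, 0 <= t <= T -> measurable_fun setT (W t),
      forall w, W 0 w = 0 /\ {within `[0, T], continuous (W ^~ w)},
      forall s t (B : set R), 0 <= s -> s < t -> t <= T -> measurable B ->
        P ((W t \- W s) @^-1` B) = normal_prob 0 (Num.sqrt (t - s)) B
    & forall s t (B : set R) A, 0 <= s -> s < t -> t <= T -> measurable B ->
        natural_sigma W s A ->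
        P (A `&` (W t \- W s) @^-1` B) =
        (P A * P ((W t \- W s)%R @^-1` B))%E].

(* (Omega, P) is, through W, the space of continuous paths on [0,T] started at 0
   with the completion of the Wiener measure, and W is the coordinate process. *)
Definition wiener_space T W : Prop :=
  [/\ brownian_motion T W, measure_is_complete P,
      measurable = completed_sigma W T
    & forall theta : R -> R, {within `[0, T], continuous theta} -> theta 0 = 0 ->
        exists! w : Omega, forall u, 0 <= u <= T -> W u w = theta u].

(* The process M attached to sigma is well defined and a martingale; f stands
   for f_sigma. *)
Definition exp_martingale_assumption T W (sigma f : R -> R) : Prop :=
  exists J : R -> Omega -> R,
    is_ito_integral T (generated_filtration W T) W
      (fun r w => derive1 sigma (f (W r w))) J /\
    martingale T (generated_filtration W T)
      (fun t w => expR (- (2^-1 * J t w)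
         - 8^-1 * \int[lebesgue_measure]_(r in `[0, t])
                    (derive1 sigma (f (W r w))) ^+ 2)).

Definition market_model T (p : partition_seq T) (s0 : R) X Ft : Prop :=
  [/\ usual_conditions T Ft, progressively_measurable T Ft X, qv_process p X
    & forall w, X 0 w = s0 /\ {within `[0, T], continuous (X ^~ w)}].

End Stochastic.

Section ModelClass.
Context {R : realType}.
Implicit Types (U : set R) (T s : R) (sigma f : R -> R).

Definition admissible_vol sigma : Prop :=
  [/\ forall x, derivable sigma x 1,
      continuous (derive1 sigma),
      exists C : R, forall x, `|sigma x| <= C * (1 + `|x|)
    & {ae lebesgue_measure, forall x, sigma x != 0}].

(* f = f_sigma *)
Definition vol_flow sigma (s0 : R) f : Prop :=
  f 0 = s0 /\ forall x : R, is_derive x 1 f (sigma (f x)).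

(* C_{s0} *)
Definition C_start U T (s0 : R) : set (R -> R) :=
  [set x | cont_paths U T x /\ x 0 = s0].

(* C_{sigma,s0}, restricted to U-valued paths *)
Definition C_flow U T f : set (R -> R) :=
  [set x | (forall u, 0 <= u <= T -> U (x u)) /\
     exists theta : R -> R,
       [/\ {within `[0, T], continuous theta}, theta 0 = 0
         & forall u, 0 <= u <= T -> x u = f (theta u)]].

(* M_sigma *)
Definition model_class U T (p : partition_seq T) (s0 : R) sigma f
    (d : measure_display) (Omega : measurableType d) (P : probability Omega R)
    (X : R -> Omega -> R) (Ft : R -> set (set Omega)) : Prop :=
  [/\ market_model P p s0 X Ft,
      {ae P, forall w, forall t, 0 <= t <= T ->
         qv p (X ^~ w) t =
         \int[lebesgue_measure]_(u in `[0, t]) (sigma (X u w)) ^+ 2},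
      {ae P, forall w, C_flow U T f (X ^~ w)}
    & law_support P U T X = C_start U T s0].

End ModelClass.

(* Main.v *)
Require Import Defs.
From HB Require Import structures.
From mathcomp Require Import all_boot all_order all_algebra.
From mathcomp Require Import all_classical all_reals all_analysis.
From mathcomp Require Import measurable_realfun ring lra zify.

(** The formula holds pathwise up to a drift term, which is a continuous functional
    of the path.  The drift vanishes along the paths of the martingale [X], hence
    along every path, since the law of [X] has full support.

    For a continuous path [z] with quadratic variation [sigma (z u) ^+ 2 du] write
    [A_t(z)] for the integral over [[0, t]] of
    [hderiv F u z + 2^-1 * vderiv (vderiv F) u z * sigma (z u) ^+ 2]
    ([ito_drift]).  Along the step approximations of [z] the functional moves by
    jumps of a frozen value, expanded to second order, and by time intervals on
    which the path is constant, where its increment is the integral of the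
    horizontal derivative.  The second-order sums converge although the weights
    converge only from the left ([weighted_qv_cvg]), so the Föllmer sums converge
    and [F t z = F 0 z + follmer_integral + A_t(z)] ([follmer_sum_cvg]).  It remains
    to see that [A_t(z) = 0] for almost every path [z] of [Z].

    Along [X] the same expansion shows that the discrete martingales
    [Y(t_j) - Y(0) - sum_(i < j) xi_i (X(t_(i+1)) - X(t_i))], where [xi_i] is the
    vertical derivative at time [t_i], converge to the drift, which is Lipschitz in
    time while the path stays in a compact segment.  Their limit should be a
    continuous martingale of finite variation, hence constant.  The convergence is
    only almost sure and no integrability beyond that of [X] and [Y] is available,
    so the argument is carried out before the limit.  On a grid of [m] steps the
    increments are at most [c / m]; the discrete martingale is stopped when the
    path leaves the segment, when it becomes large, or when such an increment is
    too large.  With [phi v = sqrt (1 + v ^+ 2)] ([sqabs]), whose second-order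
    remainder is quadratic for small and linear for large increments, the stopped
    value [S] satisfies [E (phi S) <= 1 + m * (c / m) ^+ 2 / 2 + r]
    ([stopped_sqabs_le]), where [r] is the expectation of the overshoot on an event
    of small probability.  This is controlled by uniform integrability of the
    submartingale [`|Y| + C * `|X|] ([stopped_value_ui]).  Letting the partition be
    refined and then [m] tend to infinity gives [S --> 0] in probability, hence
    [A_t(X) = 0] almost surely ([stopped_limit_negligible], [ito_drift_ae0]).

    Finally [A_t] is continuous for the supremum norm among paths with values in a
    common segment ([ito_drift_cvg]).  The paths of [Z] lie in [C_start U T s0],
    which is the support of the law of [X], so each is a uniform limit of paths
    along which [A_t] is zero ([ito_drift_support]). *)

Set Implicit Arguments.
Unset Strict Implicit.
Unset Printing Implicit Defensive.

Import Order.TTheory GRing.Theory Num.Theory.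
Import numFieldNormedType.Exports.
Import HBSimple HBNNSimple.

Local Open Scope classical_set_scope.
Local Open Scope ring_scope.

(** * Right derivatives, Taylor expansion and bounded convergence *)

Section RealAnalysis.
Context {R : realType}.
Implicit Types (a b : R) (x : R -> R).

Lemma cont_itv_eps a b x : {within `[a, b], continuous x} ->
  forall u e, a <= u <= b -> 0 < e ->
  exists2 eta : R, 0 < eta &
    forall v, a <= v <= b -> `|u - v| < eta -> `|x u - x v| < e.
Proof.
move=> /subspace_continuousP cx u e uab e0.
have /cvgrPdist_lt/(_ _ e0) := cx u uab.
rewrite near_withinE => /nbhs_ballP[eta /= eta0 H].
exists eta => // v vab uv; apply: H => //=.
Qed.

Lemma eps_cont_itv a b x :
  (forall u e, a <= u <= b -> 0 < e ->
  exists2 eta : R, 0 < eta &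
    forall v, a <= v <= b -> `|u - v| < eta -> `|x u - x v| < e) ->
  {within `[a, b], continuous x}.
Proof.
move=> H; apply/subspace_continuousP => u uab.
apply/cvgrPdist_lt => e e0; rewrite near_withinE; apply/nbhs_ballP.
have [eta eta0 He] := H u e uab e0.
by exists eta => // v uv vab; apply: He.
Qed.

Lemma unif_cont_itv a b x : {within `[a, b], continuous x} ->
  forall e : R, 0 < e -> exists2 eta : R, 0 < eta &
    forall u v, a <= u <= b -> a <= v <= b -> `|u - v| < eta ->
      `|x u - x v| < e.
Proof.
move=> cx e e0.
have /compact_near_coveringP/near_covering_withinP := @segment_compact R a b.
move=> /(_ R (0^'+) (fun (h u : R) => forall v, a <= v <= b -> `|u - v| < h ->
      `|x u - x v| < e)).
case; last first.
  move=> h /= h0 H.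
  exists (h / 2); first by rewrite divr_gt0.
  move=> u v uab vab uv; apply: (H (h / 2)) => //=.
  - by rewrite sub0r normrN gtr0_norm ?divr_gt0// ltr_pdivrMr// ltr_pMr// ltr1n.
  - by rewrite divr_gt0.
move=> u uab.
have [eta eta0 He] := cont_itv_eps cx uab (divr_gt0 e0 (ltr0Sn _ 1)).
exists (ball u (eta / 2), [set h : R | 0 < h < eta / 2]) => /=.
  split; first exact/nbhsx_ballx/divr_gt0.
  exists (eta / 2) => /=; first exact: divr_gt0.
  by move=> h /=; rewrite sub0r normrN => hh h0; rewrite h0 (le_lt_trans (ler_norm _) hh).
move=> [v h] /= [uv /andP[h0 hh]] vab w wab vw.
have -> : x v - x w = (x u - x w) - (x u - x v) by ring.
rewrite (splitr e); apply: le_lt_trans (ler_normB _ _) _; apply: ltrD.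
- apply: He => //; rewrite (splitr eta).
  have -> : u - w = (u - v) + (v - w) by ring.
  by apply: le_lt_trans (ler_normD _ _) _; apply: ltrD => //; apply: lt_trans hh.
- by apply: He => //; apply: lt_trans uv _; rewrite ltr_pdivrMr// ltr_pMr// ltr1n.
Qed.

(** The set of points up to which the estimate with constant [C + e] holds is
    closed, and a right derivative pushes its supremum further. *)
Lemma right_derivative_lipschitz a b (G D : R -> R) (C : R) :
  {within `[a, b], continuous G} ->
  (forall u, a <= u < b -> (G (u + h) - G u) / h @[h --> 0^'+] --> D u) ->
  (forall u, a <= u < b -> `|D u| <= C) ->
  forall u v, a <= u -> u <= v -> v <= b -> `|G v - G u| <= C * (v - u).
Proof.
move=> cG dG DC u v au uv vb.
have [->|uNv] := eqVneq u v; first by rewrite !subrr normr0 mulr0.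
have {uNv}ltuv : u < v by rewrite lt_neqAle uNv.
have C0 : 0 <= C by apply: le_trans (DC u _) => //; rewrite au /= (lt_le_trans ltuv).
suff He e : 0 < e -> `|G v - G u| <= (C + e) * (v - u).
  apply/ler_addgt0Pr => e e0.
  have := He (e / (v - u)); rewrite divr_gt0 ?subr_gt0// => /(_ isT).
  by rewrite mulrDl divfK// subr_eq0 gt_eqF.
move=> e0.
pose S := [set s | u <= s <= v /\ `|G s - G u| <= (C + e) * (s - u)].
have Su : S u by split; rewrite ?lexx ?uv// !subrr normr0 mulr0.
have hS : has_sup S.
  by split; [exists u|exists v => s [/andP[]]].
set s := sup S.
have us : u <= s by apply: ub_le_sup => //; case: hS.
have sv : s <= v by apply: ge_sup; [exists u|move=> r [/andP[]]].
have Ss : `|G s - G u| <= (C + e) * (s - u).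
  apply/ler_addgt0Pr => e' e'0.
  have sab : a <= s <= b by rewrite (le_trans au us) (le_trans sv vb).
  have [eta eta0 He] := cont_itv_eps cG sab e'0.
  have [r Sr sr] := sup_adherent eta0 hS.
  have [/andP[ur rv] Hr] := Sr.
  have rs : r <= s by apply: ub_le_sup => //; case: hS.
  have -> : G s - G u = (G s - G r) + (G r - G u) by ring.
  rewrite addrC; apply: le_trans (ler_normD _ _) _; apply: lerD; last first.
    apply/ltW/He; first by rewrite (le_trans au ur) (le_trans rv vb).
    by rewrite ger0_norm ?subr_ge0// ltrBlDr addrC -ltrBlDr.
  apply: le_trans Hr _; rewrite ler_wpM2l ?lerD2r// addr_ge0// ltW//.
move: sv; rewrite le_eqVlt => /predU1P[<-//|sv].
have sab : a <= s < b by rewrite (le_trans au us) (lt_le_trans sv vb).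
have /cvgrPdist_lt/(_ _ e0) := dG s sab.
move=> [h0 /= h0_gt0 Hh].
pose h := Num.min (h0 / 2) (v - s).
have h_gt0 : 0 < h by rewrite lt_min divr_gt0//= subr_gt0.
have hh0 : h < h0.
  by rewrite gt_min ltr_pdivrMr// ltr_pMr// ltr1n.
have hv : s + h <= v by rewrite -lerBrDl ge_min lexx orbT.
have := Hh h; rewrite /ball_/= sub0r normrN gtr0_norm// => /(_ hh0 h_gt0) H.
have Ssh : S (s + h).
  split; first by rewrite hv andbT (le_trans us)// lerDl ltW.
  have -> : G (s + h) - G u = (G (s + h) - G s) + (G s - G u) by ring.
  have -> : (C + e) * (s + h - u) = (C + e) * h + (C + e) * (s - u) by ring.
  apply: le_trans (ler_normD _ _) _; apply: lerD => //.
  rewrite -ler_pdivrMr// -[X in _ / X]gtr0_norm// -normf_div.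
  have -> : (G (s + h) - G s) / h = D s - (D s - (G (s + h) - G s) / h) by ring.
  apply: le_trans (ler_normB _ _) _; apply: lerD; [exact: DC|exact: ltW].
have : s + h <= s by apply: ub_le_sup => //; case: hS.
by rewrite gerDl leNgt h_gt0.
Qed.

Lemma cvg_seq_eps (u : nat -> R) (l : R) :
  u @ \oo --> l <-> forall e, 0 < e -> exists N, forall n, (N <= n)%N -> `|l - u n| < e.
Proof.
split=> [/cvgrPdist_lt H e /H [N _ HN]|H].
  by exists N => n Nn; apply: HN.
by apply/cvgrPdist_lt => e /H [N HN]; exists N => // n Nn; apply: HN.
Qed.

Lemma is_derive1P (f : R -> R) (x l : R) :
  is_derive x 1 f l <-> (f (x + h) - f x) / h @[h --> 0^'] --> l.
Proof.
have E : (fun h => h^-1 *: (f (h *: 1 + x) - f x)) = (fun h => (f (x + h) - f x) / h).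
  by apply/funext => h; rewrite [_ *: 1]mulr1 [X in f X]addrC [_ *: _]mulrC.
split=> [[df <-]|H].
  by move: df; rewrite /derivable /derive E.
have df : derivable f x 1 by rewrite /derivable E; apply/cvg_ex; exists l.
by apply: DeriveDef => //; rewrite /derive E; apply: cvg_lim.
Qed.

End RealAnalysis.

Section BoundedConvergence.
Context d (T : measurableType d) (R : realType).
Variable mu : {measure set T -> \bar R}.

Lemma bounded_integrable (D : set T) (f : T -> R) (C : R) :
  measurable D -> (mu D < +oo)%E -> measurable_fun D f ->
  (forall x, D x -> `|f x| <= C) -> mu.-integrable D (EFin \o f).
Proof.
move=> mD muD mf fC; apply: measurable_bounded_integrable => //.
by exists C; split; [exact: num_real|move=> c Cc x /fC H; exact: le_trans H (ltW Cc)].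
Qed.

Lemma integrable_add (D : set T) (f g : T -> R) : measurable D ->
  mu.-integrable D (EFin \o f) -> mu.-integrable D (EFin \o g) ->
  mu.-integrable D (EFin \o (fun x => f x + g x)).
Proof. by move=> mD If Ig; exact: (integrableD mD If Ig). Qed.

Lemma integrable_sub (D : set T) (f g : T -> R) : measurable D ->
  mu.-integrable D (EFin \o f) -> mu.-integrable D (EFin \o g) ->
  mu.-integrable D (EFin \o (fun x => f x - g x)).
Proof. by move=> mD If Ig; exact: (integrableB mD If Ig). Qed.

Lemma integrable_scale (D : set T) (c : R) (f : T -> R) : measurable D ->
  mu.-integrable D (EFin \o f) ->
  mu.-integrable D (EFin \o (fun x => c * f x)).
Proof. by move=> mD If; exact: (integrableZl mD c If). Qed.

Lemma bounded_convergence (D : set T) (f_ : nat -> T -> R) (f : T -> R) (C : R) :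
  measurable D -> (mu D < +oo)%E -> (forall n, measurable_fun D (f_ n)) ->
  (forall n x, D x -> `|f_ n x| <= C) ->
  (forall x, D x -> f_ ^~ x @ \oo --> f x) ->
  [/\ measurable_fun D f, (forall x, D x -> `|f x| <= C) &
    (fun n => \int[mu]_(x in D) f_ n x) @ \oo --> \int[mu]_(x in D) f x].
Proof.
move=> mD muD mf_ fC ff.
have mf : measurable_fun D f by apply: (measurable_fun_cvg mf_).
have fC' x : D x -> `|f x| <= C.
  move=> Dx; have /cvg_norm/(cvgr_to_le (F := \oo)) := ff x Dx; apply.
  by near=> n; exact: fC.
split => //.
have Cint : mu.-integrable D (EFin \o cst C).
  apply: (@bounded_integrable _ _ `|C|) => // x Dx; exact: lexx.
have [||||| iF _ H] := @dominated_convergence _ T R mu D mD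
   (fun n => EFin \o f_ n) (EFin \o f) (EFin \o cst C).
- by move=> n; apply/measurable_EFinP.
- by apply/measurable_EFinP.
- by apply: aeW => x Dx; apply: cvg_EFin; [exact: nearW|exact: ff].
- by [].
- by apply: aeW => x n Dx /=; rewrite lee_fin fC.
have := @fine_cvg R _ \oo _ (fun n => \int[mu]_(x in D) (f_ n x)%:E)%E (\int[mu]_(x in D) f x).
apply; rewrite /Rintegral fineK//.
exact: integrable_fin_num.
Unshelve. all: by end_near. Qed.

End BoundedConvergence.

Section RightFTC.
Context {R : realType}.
Notation mu := (@lebesgue_measure R).
Implicit Types (a b : R).

Lemma lebesgue_itvcc_lty a b : (mu `[a, b] < +oo)%E.
Proof. by rewrite lebesgue_measure_itv; case: ifP => //= _; rewrite -EFinB ltry. Qed.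

Lemma lebesgue_itvco_lty a b : (mu `[a, b[ < +oo)%E.
Proof. by rewrite lebesgue_measure_itv; case: ifP => //= _; rewrite -EFinB ltry. Qed.

Lemma lebesgue_itvoo_lty a b : (mu `]a, b[ < +oo)%E.
Proof. by rewrite lebesgue_measure_itv; case: ifP => //= _; rewrite -EFinB ltry. Qed.

Lemma cont_integrable_cc a b (f : R -> R) : {within `[a, b], continuous f} ->
  mu.-integrable `[a, b] (EFin \o f).
Proof. by move=> cf; apply: continuous_compact_integrable => //; exact: segment_compact. Qed.

Lemma cont_integrable_co a b (f : R -> R) : {within `[a, b], continuous f} ->
  mu.-integrable `[a, b[ (EFin \o f).
Proof.
move=> /cont_integrable_cc; apply: integrableS => //; exact: subset_itv_co_cc.
Qed.

Lemma cvg_invS : (n.+1%:R^-1 : R) @[n --> \oo] --> (0 : R).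
Proof. exact: cvg_harmonic. Qed.

(** The forward difference quotients are bounded by the Lipschitz constant, so
    their integrals converge to the integral of the right derivative, while these
    integrals are difference quotients of a primitive of [G]. *)
Lemma right_derivative_FTC a b (G D : R -> R) (C : R) : a <= b ->
  {within `[a, b], continuous G} ->
  (forall u, a <= u < b -> (G (u + h) - G u) / h @[h --> 0^'+] --> D u) ->
  (forall u, a <= u < b -> `|D u| <= C) ->
  measurable_fun `[a, b[ D /\ \int[mu]_(u in `[a, b[) D u = G b - G a.
Proof.
rewrite le_eqVlt => /predU1P[<-|ab] cG dG DC.
  by rewrite set_itvco0 Rintegral_set0 subrr; split => //; exact: measurable_fun_set0.
(* [G] is extended by constants, so that its difference quotients with a fixed
   step make sense up to [b]. *)
pose cl u := Num.max a (Num.min b u).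
have clab u : a <= cl u <= b.
  rewrite /cl le_max lexx/= ge_max ltW//= ge_min lexx//.
have clE u : a <= u <= b -> cl u = u.
  by move=> /andP[au ub]; rewrite /cl (min_idPr ub) (max_idPr au).
have clB u v : u <= v -> 0 <= cl v - cl u <= v - u.
  by rewrite /cl /Order.max /Order.min; case: (ltrP b u) => ?; case: (ltrP b v) => ?; do 2 case: ltrP => ?; lra.
have cl1 u v : `|cl u - cl v| <= `|u - v|.
  wlog uv : u v / u <= v.
    move=> W; have [|/ltW] := leP u v; first exact: W.
    by move=> /W; rewrite distrC [X in _ <= X]distrC.
  have /andP[h1 h2] := clB _ _ uv.
  by rewrite distrC (ger0_norm h1) distrC (le_trans h2)// ler_norm.
pose g u := G (cl u).
have gc : continuous g.
  move=> u; apply/cvgrPdist_lt => e e0.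
  have [eta eta0 H] := cont_itv_eps cG (clab u) e0.
  apply/nbhs_ballP; exists eta => // v uv; apply: H => //.
  exact: le_lt_trans (cl1 _ _) uv.
have lipg u v : `|g v - g u| <= C * `|v - u|.
  wlog uv : u v / u <= v.
    move=> W; have [|/ltW] := leP u v; first exact: W.
    by move=> /W; rewrite distrC [X in _ * X]distrC.
  apply: le_trans (_ : C * `|cl v - cl u| <= _).
    have /andP[cuv h] := clB _ _ uv; rewrite subr_ge0 in cuv.
    rewrite [X in _ * X]ger0_norm ?subr_ge0//.
    have /andP[h1 h2] := clab u; have /andP[h3 h4] := clab v.
    exact: (right_derivative_lipschitz cG dG DC).
  rewrite ler_wpM2l//.
  by apply: le_trans (DC a _) => //; rewrite lexx.
(* The margin at [a - 1] makes the primitive differentiable at [a]. *)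
pose P x := \int[mu]_(t in `[a - 1, x]) g t.
have gint u v : mu.-integrable `[u, v] (EFin \o g).
  apply: continuous_compact_integrable; first exact: segment_compact.
  exact: continuous_subspaceT.
have dP x : a - 1 < x -> is_derive x 1 P (g x).
  move=> ax.
  have [||||] := @continuous_FTC1_closed R g (a - 1) x (x + 1).
  - by rewrite ltrDl.
  - exact: gint.
  - exact: ax.
  - exact: gc.
  - by move=> dPx <-; rewrite derive1E; exact/derivableP.
have cP x : a - 1 < x -> {for x, continuous P}.
  by move=> /dP H; apply/differentiable_continuous/derivable1_diffP; case: H.
pose q n u := (g (u + n.+1%:R^-1) - g u) / n.+1%:R^-1.
have qE n : \int[mu]_(u in `[a, b[) q n u =
   (P (b + n.+1%:R^-1) - P b) / n.+1%:R^-1 - (P (a + n.+1%:R^-1) - P a) / n.+1%:R^-1.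
  set h := n.+1%:R^-1.
  have h0 : 0 < h by rewrite invr_gt0.
  rewrite -mulrBl /q -/h Rintegral_itv_bndo_bndc; last first.
    apply: cont_integrable_co.
    apply: continuous_subspaceT => u; apply: cvgMl; apply: cvgB; last exact: gc.
    by apply: continuous_comp; [apply: cvgD; [exact: cvg_id|exact: cvg_cst]|exact: gc].
  have dQ u : a - 1 < u -> is_derive u 1 (fun u => P (u + h) - P u) (g (u + h) - g u).
    move=> au; apply: is_deriveB; last exact: dP.
    have H1 : is_derive (u + h) 1 P (g (u + h)) by apply: dP; lra.
    have H2 : is_derive u 1 (fun u => u + h) 1.
      by rewrite -[X in is_derive _ _ _ X]addr0; apply: is_deriveD.
    by have := @is_derive1_comp R P (fun u => u + h) u _ _ H1 H2; rewrite mulr1.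
  rewrite RintegralZr//; last first.
    apply: cont_integrable_cc.
    apply: continuous_subspaceT => u; apply: cvgB; last exact: gc.
    by apply: continuous_comp; [apply: cvgD; [exact: cvg_id|exact: cvg_cst]|exact: gc].
  congr (_ / _).
  rewrite /Rintegral (@continuous_FTC2 R _ (fun u => P (u + h) - P u))//=.
  - apply: (@continuous_subspaceT _ _ _ (fun u : R => g (u + h) - g u)) => u.
    apply: cvgB; last exact: gc.
    by apply: continuous_comp; [apply: cvgD; [exact: cvg_id|exact: cvg_cst]|exact: gc].
  - have cQ u : a - 1 < u -> {for u, continuous (fun u => P (u + h) - P u)}.
      by move=> /dQ H; apply/differentiable_continuous/derivable1_diffP; case: H.
    split.
    + by move=> u /[!in_itv]/= /andP[au ub]; have au1 : a - 1 < u; [lra|case: (dQ u au1)].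
    + by apply: cvg_at_right_filter; apply: cQ; lra.
    + by apply: cvg_at_left_filter; apply: cQ; lra.
  - move=> u /[!in_itv]/= /andP[au ub]; rewrite derive1E; have au1 : a - 1 < u by lra.
    by have H := dQ u au1; rewrite derive_val.
have qD (u : R) : a <= u < b -> q ^~ u @ \oo --> D u.
  move=> uab; have /andP[au ub] := uab.
  apply/cvg_seq_eps => e e0.
  have /cvgrPdist_lt/(_ _ e0)[d /= d0 Hd] := dG u uab.
  have m0 : 0 < Num.min d (b - u) by rewrite lt_min d0 subr_gt0.
  have [N HN] := (cvg_seq_eps _ _).1 cvg_invS _ m0.
  exists N => n /HN; rewrite sub0r normrN gtr0_norm ?invr_gt0// lt_min => /andP[nd nb].
  have h0 : 0 < n.+1%:R^-1 :> R by rewrite invr_gt0.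
  have := Hd n.+1%:R^-1; rewrite /= sub0r normrN gtr0_norm// => /(_ nd h0).
  have -> : q n u = (G (u + n.+1%:R^-1) - G u) / n.+1%:R^-1.
    rewrite /q /g (clE u) ?au ?ltW// (clE (u + _))//.
    by move: nb h0; move: (n.+1%:R^-1) => z *; lra.
  by [].
have [||||| mD _ H] := @bounded_convergence _ _ R mu `[a, b[ q D C.
- by [].
- exact: lebesgue_itvco_lty.
- move=> n; apply: measurable_funTS; apply: continuous_measurable_fun => u.
  apply: cvgMl; apply: cvgB; last exact: gc.
  by apply: continuous_comp; [apply: cvgD; [exact: cvg_id|exact: cvg_cst]|exact: gc].
- move=> n u _; rewrite /q normf_div ler_pdivrMr ?normr_gt0 ?invr_eq0//.
  by apply: le_trans (lipg _ _) _; rewrite addrAC subrr add0r.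
- by move=> u /=; rewrite in_itv/=; exact: qD.
split=> //.
have -> : G b - G a = g b - g a by rewrite /g !clE// ?lexx ltW.
have PhE x : a - 1 < x -> (P (x + n.+1%:R^-1) - P x) / n.+1%:R^-1 @[n --> \oo] --> g x.
  move=> ax; have Hx := dP x ax.
  have H' := (is_derive1P _ _ _).1 Hx.
  apply/cvg_seq_eps => e e0.
  have /cvgrPdist_lt/(_ _ e0)[d /= d0 Hd] := H'.
  have [N HN] := (cvg_seq_eps _ _).1 cvg_invS _ d0.
  exists N => n /HN Hn.
  by have := Hd n.+1%:R^-1 Hn; rewrite invr_eq0 pnatr_eq0 => /(_ isT).
rewrite -(cvg_lim _ H)//; apply: cvg_lim => //; under eq_fun do rewrite qE.
by apply: cvgB; apply: PhE; lra.
Qed.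

End RightFTC.

Section Taylor.
Context {R : realType}.

(** The points may come in either order.  Rolle applied to the defect function
    [s |-> g d - g s - g1 s (d - s) - M (d - s)^2], with [M] chosen to make it
    vanish at [c]. *)
Lemma taylor2 (g g1 g2 : R -> R) (c d : R) :
  (forall y, Num.min c d <= y <= Num.max c d ->
     is_derive y 1 g (g1 y) /\ is_derive y 1 g1 (g2 y)) ->
  exists2 th, Num.min c d <= th <= Num.max c d &
    g d - g c = g1 c * (d - c) + 2^-1 * g2 th * (d - c) ^+ 2.
Proof.
move=> H.
have [<-|cd] := eqVneq c d.
  by exists c; rewrite ?ge_min ?le_max ?lexx// !subrr expr0n/= !mulr0 addr0.
pose M := (g d - g c - g1 c * (d - c)) / (d - c) ^+ 2.
have dc0 : d - c != 0 by rewrite subr_eq0 eq_sym.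
pose k s := g d - g s - g1 s * (d - s) - M * (d - s) ^+ 2.
have kd : k d = 0 by rewrite /k !subrr expr0n/= !mulr0 !subr0.
have kc : k c = 0 by rewrite /k /M divfK ?expf_neq0// subrr.
have dk y : Num.min c d <= y <= Num.max c d ->
    is_derive y 1 k ((M *+ 2 - g2 y) * (d - y)).
  move=> /H[h1 h2].
  have h3 : is_derive y 1 (fun s => d - s) (- 1).
    by rewrite -[X in is_derive _ _ _ X]add0r; apply: is_deriveB.
  have h4 : is_derive y 1 (fun s => g1 s * (d - s)) (g1 y * (- 1) + (d - y) * g2 y).
    exact: (is_deriveM h2 h3).
  have h5 : is_derive y 1 (fun s => (d - s) ^+ 2) ((d - y) * (- 1) + (d - y) * (- 1)).
    exact: (is_deriveM h3 h3).
  have h6 : is_derive y 1 (fun s => M * (d - s) ^+ 2) (M * ((d - y) * (- 1) + (d - y) * (- 1))).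
    exact: (is_deriveZ _ h5).
  have h7 : is_derive y 1 (fun s => g d - g s) (0 - g1 y).
    exact: (is_deriveB (is_derive_cst _ _ _) h1).
  have h8 := is_deriveB (is_deriveB h7 h4) h6.
  by apply: (is_derive_eq h8); ring.
have mM : Num.min c d < Num.max c d.
  by rewrite /Order.min /Order.max; case: (ltgtP c d) cd => // ->; rewrite eqxx.
have dk' y : y \in `]Num.min c d, Num.max c d[ -> is_derive y 1 k ((M *+ 2 - g2 y) * (d - y)).
  by rewrite in_itv/= => /andP[/ltW y1 /ltW y2]; apply: dk; rewrite y1.
have [|||th thI dth] := @Rolle R k (Num.min c d) (Num.max c d) mM.
- by move=> y /dk' [].
- apply: derivable_within_continuous => y; rewrite in_itv/= => /dk; case=> //.
- by rewrite /Num.min /Num.max; case: ifP; rewrite ?kc ?kd.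
have := dk' th thI; move=> h; have := @derive_val _ _ _ _ _ _ _ h.
rewrite (@derive_val _ _ _ _ _ _ _ dth) => /esym/eqP.
rewrite mulf_eq0 => /orP[|]; last first.
  move: thI; rewrite in_itv/= subr_eq0 => /andP[t1 t2] /eqP E.
  by move: t1 t2; rewrite -E /Order.min /Order.max; case: (ltrP c d); rewrite ltxx.
rewrite subr_eq0 => /eqP E.
exists th; first by move: thI; rewrite in_itv/= => /andP[/ltW -> /ltW ->].
have -> : 2^-1 * g2 th = M by rewrite -E -(mulr_natl M) mulrA mulVf ?pnatr_eq0// mul1r.
rewrite /M divfK ?expf_neq0//.
by ring.
Qed.

End Taylor.

(** * Partitions and weighted quadratic variation *)

Section PartitionTheory.
Context {R : realType} (T : R) (p : partition_seq T).
Implicit Types (n i j : nat) (t u s : R).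

Lemma ptime_mono n i j : (i <= j)%N -> (j <= psize p n)%N ->
  ptime p n i <= ptime p n j.
Proof.
elim: j => [|j IH]; first by rewrite leqn0 => /eqP ->.
rewrite leq_eqVlt => /predU1P[->//|]; rewrite ltnS => ij jn.
by apply: le_trans (IH ij (ltnW jn)) _; apply/ltW/ptime_lt.
Qed.

Lemma ptime_smono n i j : (i < j)%N -> (j <= psize p n)%N ->
  ptime p n i < ptime p n j.
Proof.
move=> ij jn; apply: lt_le_trans (ptime_mono ij jn).
by apply: ptime_lt; apply: leq_trans jn.
Qed.

Lemma ptime_itv n i : (i <= psize p n)%N -> 0 <= ptime p n i <= T.
Proof.
move=> ni; apply/andP; split.
  by rewrite -(ptime_first p n) ptime_mono.
by rewrite -[X in _ <= X](ptime_last p n) ptime_mono.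
Qed.

Lemma ptime_ltE n i j : (i <= psize p n)%N -> (j <= psize p n)%N ->
  (ptime p n i < ptime p n j) = (i < j)%N.
Proof.
move=> ni nj; have [ij|ji] := ltnP i j; first by rewrite ptime_smono.
by apply/negbTE; rewrite -leNgt ptime_mono.
Qed.

Lemma ptime_block n u : 0 <= u -> u < T ->
  exists2 j, (j < psize p n)%N & ptime p n j <= u < ptime p n j.+1.
Proof.
move=> u0 uT; have := uT; rewrite -[X in _ < X](ptime_last p n).
elim: {1 3}(psize p n) (leqnn (psize p n)) => [|k IH] kn.
  by rewrite ptime_first ltNge u0.
have [uk _|ku uk1] := ltP u (ptime p n k); first exact: IH (ltnW kn) uk.
by exists k => //; rewrite ku.
Qed.

Lemma ptime_lblock n u : 0 < u -> u <= T ->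
  exists2 j, (j < psize p n)%N & ptime p n j < u <= ptime p n j.+1.
Proof.
move=> u0 uT; have := uT; rewrite -[X in _ <= X](ptime_last p n).
elim: {1 3}(psize p n) (leqnn (psize p n)) => [|k IH] kn.
  by rewrite ptime_first leNgt u0.
have [uk _|ku uk1] := leP u (ptime p n k); first exact: IH (ltnW kn) uk.
by exists k => //; rewrite ku.
Qed.

Lemma mesh_small e : 0 < e -> exists N, forall n, (N <= n)%N ->
  forall j, (j < psize p n)%N -> ptime p n j.+1 - ptime p n j < e.
Proof.
move=> e0; have [N HN] := (cvg_seq_eps _ _).1 (pmesh_cvg0 p) _ e0.
exists N => n /HN; rewrite sub0r normrN => H j jn.
apply: le_lt_trans H; apply: le_trans (ler_norm _).
exact: (le_bigmax _ (fun j : 'I_(psize p n) => ptime p n j.+1 - ptime p n j) (Ordinal jn)).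
Qed.

(** Index of the last partition point not after [t]; the failure value of [find]
    is the right one, since then no partition point lies after [t]. *)
Definition lidx n t : nat := find (fun i => t < ptime p n i.+1) (iota 0 (psize p n)).

Lemma lidx_le n t : (lidx n t <= psize p n)%N.
Proof. by rewrite -[X in (_ <= X)%N](size_iota 0) find_size. Qed.

Lemma lidxP n t i : (i < psize p n)%N -> (ptime p n i.+1 <= t) = (i < lidx n t)%N.
Proof.
move=> ni; have [il|li] := ltnP i (lidx n t).
  by have := before_find 0%N il; rewrite nth_iota// add0n leNgt => ->.
have ln : (lidx n t < psize p n)%N by apply: leq_ltn_trans ni.
have : has (fun i => t < ptime p n i.+1) (iota 0 (psize p n)).
  by rewrite has_find size_iota.
move=> /(nth_find 0%N); rewrite -/(lidx n t) nth_iota// add0n => tl.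
apply/negbTE; rewrite -ltNge; apply: lt_le_trans tl _.
exact: ptime_mono.
Qed.

Lemma ptime_lidx n t : 0 <= t -> ptime p n (lidx n t) <= t.
Proof.
move=> t0; case E : (lidx n t) => [|k]; first by rewrite ptime_first.
have kn : (k < psize p n)%N by rewrite -E lidx_le.
by rewrite lidxP// E.
Qed.

Lemma lidx_lt n t : 0 <= t -> t < T -> (lidx n t < psize p n)%N.
Proof.
move=> t0 tT; rewrite ltn_neqAle lidx_le andbT; apply/eqP => E.
case: (posnP (psize p n)) => [n0|n0].
  have := ptime_last p n; rewrite n0 ptime_first => E0.
  by move: tT; rewrite -E0 ltNge t0.
have := @lidxP n t (psize p n).-1; rewrite prednK// E => /(_ (leqnn _)).
by rewrite ptime_last leNgt tT leqnn.
Qed.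

Lemma lidx_near n t e : 0 <= t <= T -> 0 < e ->
  (forall j, (j < psize p n)%N -> ptime p n j.+1 - ptime p n j < e) ->
  t - ptime p n (lidx n t) < e.
Proof.
move=> /andP[t0 tT] e0 He; have [ln|nl] := ltnP (lidx n t) (psize p n).
  have := lidxP t ln; rewrite ltnn => /negbT; rewrite -ltNge => h.
  by apply: lt_trans (He _ ln); rewrite ltrD2r.
have -> : lidx n t = psize p n by apply/eqP; rewrite eqn_leq lidx_le.
by rewrite ptime_last; apply: le_lt_trans e0; rewrite subr_le0.
Qed.

Lemma lidx_mono n s t : s <= t -> (lidx n s <= lidx n t)%N.
Proof.
move=> st; rewrite leqNgt; apply/negP => h.
have ln : (lidx n t < psize p n)%N by apply: leq_trans h (lidx_le _ _).
have := lidxP s ln; rewrite h => H; have := lidxP t ln; rewrite ltnn.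
by rewrite (le_trans H st).
Qed.

Lemma sum_lidx n t (E : nat -> R) :
  \sum_(i < psize p n | ptime p n i.+1 <= t) E i = \sum_(0 <= i < lidx n t) E i.
Proof.
rewrite big_mkord (big_ord_widen_cond (psize p n) predT E (lidx_le n t)).
by apply: eq_bigl => i; rewrite lidxP.
Qed.

End PartitionTheory.

Section StepIntegral.
Context {R : realType}.
Notation mu := (@lebesgue_measure R).

Lemma Rintegral_scaled_indic (A D : set R) (c : R) :
  measurable A -> measurable D -> (mu D < +oo)%E -> A `<=` D ->
  mu.-integrable D (EFin \o (fun u => c * \1_A u)) /\
  \int[mu]_(u in D) (c * \1_A u) = c * fine (mu A).
Proof.
move=> mA mD Dfin AD.
have iA : mu.-integrable D (EFin \o (\1_A : R -> R)).
  apply: (@bounded_integrable _ _ _ _ _ _ 1) => // x _.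
  by rewrite indicE; case: (_ \in _); rewrite ?normr0 ?normr1.
split; first exact: integrable_scale.
by rewrite RintegralZl// /Rintegral integral_indic// setIidl.
Qed.

(** The blocks are counted from [k0] on because the first block of the grid will
    be left out. *)
Lemma Rintegral_step (h : R) (D : set R) (c : nat -> R) (k0 m : nat) :
  0 <= h -> measurable D -> (mu D < +oo)%E ->
  `]k0%:R * h, (k0 + m)%:R * h] `<=` D ->
  mu.-integrable D (EFin \o (fun u => \sum_(0 <= k < m)
     c k * \1_`](k0 + k)%:R * h, (k0 + k).+1%:R * h] u)) /\
  \int[mu]_(u in D) (\sum_(0 <= k < m)
     c k * \1_`](k0 + k)%:R * h, (k0 + k).+1%:R * h] u)
  = \sum_(0 <= k < m) c k * h.
Proof.
move=> h0 mD Dfin; elim: m => [|m IH] HD.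
  under [X in EFin \o X]eq_fun do rewrite big_nil.
  rewrite big_nil; under eq_Rintegral do rewrite big_nil.
  split; last by rewrite Rintegral_cst// mul0r.
  by apply: (@bounded_integrable _ _ _ _ _ _ 0) => // x _; rewrite normr0.
have [|i1 E1] := IH.
  apply: subset_trans HD; apply: subset_itvl; rewrite bnd_simp.
  by rewrite ler_wpM2r// ler_nat leq_add2l.
have [||||i2 E2] := @Rintegral_scaled_indic `](k0 + m)%:R * h, (k0 + m).+1%:R * h] D (c m) => //.
  rewrite -addnS; apply: subset_trans HD; apply: subset_itvr; rewrite bnd_simp.
  by rewrite ler_wpM2r// ler_nat leq_addr.
under [X in EFin \o X]eq_fun do rewrite big_nat_recr//=.
rewrite big_nat_recr//=; under eq_Rintegral do rewrite big_nat_recr//=.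
split; first exact: integrable_add.
rewrite RintegralD// E1 E2; congr (_ + _ * _).
rewrite lebesgue_measure_itv/= lte_fin; case: ltP => [_|hh].
  by rewrite -EFinB/= -mulrBl -[in X in X - _]addn1 natrD addrAC subrr add0r mul1r.
rewrite /=; apply/eqP; rewrite eq_le h0/=.
by move: hh; rewrite -[in X in X <= _]addn1 natrD mulrDl mul1r gerDl.
Qed.

Lemma Rintegral_block_cst (g : R -> R) (a b l e : R) : a <= b ->
  {within `[a, b], continuous g} ->
  (forall u, a <= u <= b -> `|g u - l| <= e) ->
  `|\int[mu]_(u in `]a, b]) g u - l * (b - a)| <= e * (b - a).
Proof.
move=> ab cg H.
have mD : (mu `]a, b] < +oo)%E.
  by rewrite lebesgue_measure_itv; case: ifP => //= _; rewrite -EFinB ltry.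
have ig : mu.-integrable `]a, b] (EFin \o g).
  by apply: integrableS (cont_integrable_cc cg) => //; exact: subset_itv_oc_cc.
have ic c : mu.-integrable `]a, b] (EFin \o (fun=> c)).
  by apply: (@bounded_integrable _ _ _ _ _ _ `|c|).
have mE : fine (mu `]a, b]) = b - a.
  rewrite lebesgue_measure_itv/= lte_fin; case: ltP => [_//|ba].
  by rewrite /=; apply/esym/eqP; rewrite subr_eq0 eq_le ba ab.
rewrite -mE -!Rintegral_cst// -RintegralB//.
apply: le_trans (le_normr_Rintegral _ _) _ => //.
  exact: integrable_sub.
apply: le_Rintegral => //.
  by apply: integrable_norm => //; exact: integrable_sub.
by move=> u /=; rewrite in_itv/= => /andP[/ltW au ub]; apply: H; rewrite au.
Qed.

Lemma Rintegral_norm_le (D : set R) (f : R -> R) (M : R) : measurable D ->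
  (mu D < +oo)%E -> mu.-integrable D (EFin \o f) ->
  (forall u, D u -> `|f u| <= M) -> `|\int[mu]_(u in D) f u| <= M * fine (mu D).
Proof.
move=> mD Dfin If fM; apply: le_trans (le_normr_Rintegral _ _) _ => //.
rewrite -Rintegral_cst//; apply: le_Rintegral => //.
  exact: integrable_norm.
exact: (@bounded_integrable _ _ _ _ _ _ `|M|).
Qed.

Lemma Rintegral_co_lipschitz (f : R -> R) (a b s s' M : R) :
  mu.-integrable `[a, b[ (EFin \o f) -> (forall u, a <= u < b -> `|f u| <= M) ->
  a <= s -> s <= s' -> s' <= b ->
  `|\int[mu]_(u in `[a, s'[) f u - \int[mu]_(u in `[a, s[) f u| <= M * (s' - s).
Proof.
move=> If fM as_ ss' s'b.
have cup : `[a, s'[%classic = `[a, s[ `|` `[s, s'[.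
  by apply: itv_bndbnd_setU; rewrite bnd_simp.
have sub : `[a, s'[ `<=` `[a, b[ by apply: subset_itvl; rewrite bnd_simp.
rewrite cup Rintegral_setU//; first last.
- apply/disj_setPS => u [] /=; rewrite !in_itv/= => /andP[_ h1] /andP[h2 _].
  by have := le_lt_trans h2 h1; rewrite ltxx.
- by rewrite -cup; exact: integrableS If.
rewrite addrAC subrr add0r.
have sub' : `[s, s'[ `<=` `[a, b[ by apply: subset_itv; rewrite bnd_simp.
have := @Rintegral_norm_le `[s, s'[ f M.
have -> : fine (mu `[s, s'[) = s' - s.
  rewrite lebesgue_measure_itv/= lte_fin; case: ltP => [_//|h].
  by rewrite /=; apply/esym/eqP; rewrite subr_eq0 eq_le h ss'.
apply => //; first exact: lebesgue_itvco_lty.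
- exact: integrableS If.
- by move=> u /sub'; rewrite /= in_itv/=; exact: fM.
Qed.

End StepIntegral.

Section BlockApproximation.
Context {R : realType} (T : R) (p : partition_seq T).
Notation mu := (@lebesgue_measure R).
Variables (t : R) (phi : nat -> nat -> R) (Phi : R -> R) (C : R).
Hypotheses (t_gt0 : 0 < t) (t_le : t <= T).
Hypothesis phi_bound : forall n i, (i < psize p n)%N -> `|phi n i| <= C.
Hypothesis phi_cvg : forall u e : R, 0 < u < t -> 0 < e ->
  exists2 d : R, 0 < d & exists N, forall n i, (N <= n)%N -> (i < psize p n)%N ->
    u - d <= ptime p n i <= u -> `|Phi u - phi n i| < e.

Local Notation hh m := (t / m.+1%:R).

Lemma block_small (d : R) : 0 < d -> exists N, forall m, (N <= m)%N -> hh m < d.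
Proof.
move=> d0; have [|N HN] := (cvg_seq_eps _ _).1 (@cvg_invS R) (d / t).
  by rewrite divr_gt0.
exists N => m /HN; rewrite sub0r normrN gtr0_norm ?invr_gt0// => H.
by rewrite mulrC -ltr_pdivlMr.
Qed.

Let h_gt0 m : 0 < hh m.
Proof. by rewrite divr_gt0. Qed.

Let hE m : m.+1%:R * hh m = t.
Proof. by rewrite mulrC divfK. Qed.

(** Values taken by the weights on the partition points of block [k] of the
    grid of step [t / m.+1], block [k - 1] included to allow for the partition
    interval that straddles the two blocks. *)
Definition block_values m k : set R :=
  [set y | exists n i, [/\ (m <= n)%N, (i < psize p n)%N,
    (k%:R - 1) * hh m <= ptime p n i <= k.+1%:R * hh m & y = phi n i]].

Definition block_sup m k : R := sup (block_values m k).

Lemma block_values_bound m k y : block_values m k y -> `|y| <= C.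
Proof. by case=> n [i [_ ni _ ->]]; exact: phi_bound. Qed.

Lemma block_values_has_ubound m k : has_ubound (block_values m k).
Proof. by exists C => y /block_values_bound; rewrite ler_norml => /andP[]. Qed.

Lemma block_sup_ge m k n i : (m <= n)%N -> (i < psize p n)%N ->
  (k%:R - 1) * hh m <= ptime p n i <= k.+1%:R * hh m ->
  phi n i <= block_sup m k.
Proof.
move=> mn ni ik; apply: ub_le_sup; first exact: block_values_has_ubound.
by exists n, i.
Qed.

Lemma block_values_neq0 m k : k.+1%:R * hh m < T -> block_values m k !=set0.
Proof.
move=> kT; have [N HN] := mesh_small p (h_gt0 m).
pose n := maxn m N; pose i := lidx p n (k.+1%:R * hh m).
have k0 : 0 <= k.+1%:R * hh m by rewrite mulr_ge0// ltW.
exists (phi n i); exists n, i; split => //.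
- by rewrite leq_maxl.
- exact: lidx_lt.
- apply/andP; split; last exact: ptime_lidx.
  have := @lidx_near R T p n (k.+1%:R * hh m) (hh m).
  rewrite k0 ltW// => /(_ isT (h_gt0 m)) H.
  have {}H := H (HN n (leq_maxr _ _)).
  move: H; rewrite -/i -[in k.+1%:R]addn1 natrD !mulrDl mul1r.
  by have := h_gt0 m; move: (hh m) => h ? ?; lra.
Qed.

Lemma block_sup_bound m k : 0 <= C -> `|block_sup m k| <= C.
Proof.
move=> C0; have [E|/set0P[y ky]] := eqVneq (block_values m k) set0.
  by rewrite /block_sup E sup0 normr0.
rewrite ler_norml; apply/andP; split.
  apply: (le_trans (_ : _ <= y)).
    by have := block_values_bound ky; rewrite ler_norml => /andP[].
  by apply: ub_le_sup => //; exact: block_values_has_ubound.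
by apply: ge_sup; [exists y|move=> z /block_values_bound; rewrite ler_norml => /andP[]].
Qed.

(** Step function carrying on each block the supremum of the previous block;
    the shift is what makes it converge using left limits only. *)
Definition block_step (g : R -> R) m u : R :=
  \sum_(0 <= k < m) (block_sup m k * g (k.+1%:R * hh m)) *
     \1_`](1 + k)%:R * hh m, (1 + k).+1%:R * hh m] u.

Let block_index m u : hh m < u -> u < t ->
  exists2 k, (k < m)%N & (1 + k)%:R * hh m < u <= (1 + k).+1%:R * hh m.
Proof.
move=> hu ut; have : u <= (1 + m)%:R * hh m by rewrite add1n hE ltW.
elim: {1 3}m => [|l IH]; first by rewrite addn0 mul1r leNgt hu.
have [ul _|lu ul] := leP u ((1 + l)%:R * hh m).
  by have [k kl H] := IH ul; exists k => //; exact: leqW.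
by exists l => //; rewrite lu -addnS.
Qed.

Let block_stepE g m u k : (k < m)%N ->
  (1 + k)%:R * hh m < u <= (1 + k).+1%:R * hh m ->
  block_step g m u = block_sup m k * g (k.+1%:R * hh m).
Proof.
move=> km /andP[ku uk]; rewrite /block_step big_mkord (bigD1 (Ordinal km))//=.
rewrite big1 ?addr0.
  by rewrite indicE mem_set ?mulr1//= in_itv/= ku.
move=> l lk; rewrite indicE memNset ?mulr0//= in_itv/= => /andP[lu ul].
move/eqP: lk; apply; apply/val_inj => /=; apply/eqP; rewrite eqn_leq.
have := lt_le_trans lu uk; rewrite ltr_pM2r// ltr_nat.
have := lt_le_trans ku ul; rewrite ltr_pM2r// ltr_nat.
by lia.
Qed.

Let block_step0 g m u : u <= hh m -> block_step g m u = 0.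
Proof.
move=> uh; rewrite /block_step big_mkord big1// => l _.
rewrite indicE memNset ?mulr0//= in_itv/= => /andP[lu _].
have := lt_le_trans lu uh; rewrite ltNge => /negP; apply.
by rewrite ler_peMl//; [exact: ltW|rewrite ler1n].
Qed.

(** The block carrying the value used at [u] ends just before [u], within three
    steps of the grid, so the weights taken into account there converge to
    [Phi u] by left-convergence alone; dominated convergence does the rest. *)
Lemma block_step_cvg g : 0 <= C -> {within `[0, t], continuous g} ->
  [/\ measurable_fun `]0, t[ (fun u => Phi u * g u),
      exists D : R, forall u : R, 0 < u < t -> `|Phi u * g u| <= D &
  (fun m => \sum_(0 <= k < m) block_sup m k * g (k.+1%:R * hh m) * hh m)
    @ \oo --> \int[mu]_(u in `]0, t[) (Phi u * g u)].
Proof.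
move=> C0 cg.
have [G G0 HG] : exists2 G : R, 0 <= G & forall u : R, 0 <= u <= t -> `|g u| <= G.
  have [a ? Ha] := EVT_max (ltW t_gt0) cg.
  have [b ? Hb] := EVT_min (ltW t_gt0) cg.
  exists (`|g a| + `|g b|) => [|u ut]; first exact: addr_ge0.
  rewrite ler_norml; apply/andP; split.
    by apply: le_trans (Hb u ut); rewrite lerNl (le_trans (ler_norm _))// normrN lerDr.
  by apply: le_trans (Ha u ut) _; rewrite (le_trans (ler_norm _))// lerDl.
have gE m k : (k <= m)%N -> `|g (k.+1%:R * hh m)| <= G.
  move=> km; apply: HG; apply/andP; split; first by rewrite mulr_ge0// ltW.
  by rewrite -[X in _ <= X](hE m) ler_pM2r// ler_nat.
have Jint m : mu.-integrable `]0, t] (EFin \o block_step g m) /\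
    \int[mu]_(u in `]0, t]) block_step g m u =
    \sum_(0 <= k < m) block_sup m k * g (k.+1%:R * hh m) * hh m.
  apply: Rintegral_step => //; first exact: ltW.
    by rewrite lebesgue_measure_itv; case: ifP => //= _; rewrite -EFinB ltry.
  rewrite add1n hE mul1r; apply: subset_itvr; rewrite bnd_simp; exact: ltW.
have [||||| mPhi bPhi H] := @bounded_convergence _ _ R mu `]0, t[
    (block_step g) (fun u => Phi u * g u) (C * G).
- by [].
- exact: lebesgue_itvoo_lty.
- move=> m; have [i1 _] := Jint m; apply: (@measurable_funS _ _ _ _ `]0, t]) => //.
    exact: subset_itv_oo_oc.
  by apply/measurable_EFinP; exact: measurable_int i1.
- move=> m u; rewrite /= in_itv/= => /andP[u0 ut].
  have [uh|hu] := leP u (hh m); first by rewrite block_step0// normr0 mulr_ge0.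
  have [k km Hk] := block_index hu ut.
  by rewrite (block_stepE _ km Hk) normrM ler_pM// ?block_sup_bound// gE// ltnW.
- move=> u; rewrite /= in_itv/= => /andP[u0 ut]; apply/cvg_seq_eps => e e0.
  have u0t : 0 < u < t by rewrite u0.
  pose e1 : R := e / ((C + 1) *+ 2); pose e2 : R := e / ((G + 1) *+ 2).
  have C1 : 0 < C + 1 by rewrite ltr_wpDl.
  have G1 : 0 < G + 1 by rewrite ltr_wpDl.
  have e1_gt0 : 0 < e1 by rewrite divr_gt0// mulrn_wgt0.
  have e2_gt0 : 0 < e2 by rewrite divr_gt0// mulrn_wgt0.
  have [d d0 [N HN]] := phi_cvg u0t e2_gt0.
  have [eta eta0 Heta] := cont_itv_eps cg (introT andP (conj (ltW u0) (ltW ut))) e1_gt0.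
  have mn0 : 0 < Num.min (Num.min d eta) u by rewrite !lt_min d0 eta0.
  have [M HM] := block_small (divr_gt0 mn0 (ltr0Sn R 2)).
  exists (maxn N M) => m; rewrite geq_max => /andP[Nm /HM].
  rewrite ltr_pdivlMr// !lt_min => /andP[/andP[hd heta] hu3].
  have h0 := h_gt0 m.
  have hu : hh m < u by move: (hh m) h0 hu3 => h *; lra.
  have [k km Hk] := block_index hu ut; rewrite (block_stepE _ km Hk).
  have [su us] : k.+1%:R * hh m < u /\ u <= k.+1%:R * hh m + hh m.
    move: Hk => /andP[]; rewrite add1n -[in X in _ -> _ <= X -> _](addn1 k.+1).
    by rewrite natrD mulrDl mul1r.
  have s0 : 0 <= k.+1%:R * hh m by rewrite mulr_ge0// ltW.
  have sm1 : (k%:R - 1) * hh m = k.+1%:R * hh m - hh m - hh m.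
    by rewrite -[k.+1]addn1 natrD; ring.
  have gclose : `|g u - g (k.+1%:R * hh m)| < e1.
    apply: Heta; first by rewrite s0 ltW// (lt_trans su).
    rewrite gtr0_norm ?subr_gt0//.
    by move: (hh m) h0 us heta => h *; lra.
  have yclose y : block_values m k y -> `|Phi u - y| < e2.
    case=> n [i [mn ni /andP[ik1 ik2] ->]]; apply: HN => //.
      exact: leq_trans mn.
    apply/andP; split; last by apply: ltW; apply: le_lt_trans su.
    by apply: le_trans ik1; rewrite sm1; move: (hh m) h0 us hd => h *; lra.
  have sclose : `|Phi u - block_sup m k| <= e2.
    have [|y ky] := @block_values_neq0 m k.
      by apply: lt_le_trans t_le; apply: lt_trans ut.
    rewrite ler_distl; apply/andP; split.
      rewrite lerBlDr; apply: ge_sup; first by exists y.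
      by move=> z /yclose; rewrite ltr_distl => /andP[/ltW]; rewrite lerBlDr.
    apply: le_trans (_ : y + e2 <= _).
      by have := yclose _ ky; rewrite ltr_distl => /andP[_ /ltW].
    by rewrite lerD2r; apply: ub_le_sup => //; exact: block_values_has_ubound.
  have -> : Phi u * g u - block_sup m k * g (k.+1%:R * hh m) =
     (Phi u - block_sup m k) * g u + block_sup m k * (g u - g (k.+1%:R * hh m)) by ring.
  apply: le_lt_trans (ler_normD _ _) _; rewrite !normrM.
  have E : e = e2 * (G + 1) + (C + 1) * e1.
    by rewrite /e1 /e2; field; rewrite !gt_eqF.
  rewrite E; apply: ler_ltD.
    rewrite ler_pM//; apply: le_trans (HG u _) _; last by rewrite lerDl.
    by rewrite !ltW.
  apply: le_lt_trans (_ : C * e1 < _); last by rewrite ltr_pM2r// ltrDl.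
  by rewrite ler_pM// ?block_sup_bound// ltW.
split=> //; first by exists (C * G) => u ?; apply: bPhi; rewrite /= in_itv.
apply: cvg_trans H; apply: near_eq_cvg; near=> m.
rewrite -(Jint m).2 Rintegral_itv_bndo_bndc//.
apply: integrableS (Jint m).1 => //; exact: subset_itv_oo_oc.
Unshelve. all: by end_near. Qed.

End BlockApproximation.

Section WeightedQuadraticVariation.
Context {R : realType} (T : R) (p : partition_seq T).
Notation mu := (@lebesgue_measure R).
Variables (t : R) (x g : R -> R).
Hypotheses (t_gt0 : 0 < t) (t_le : t <= T).
Hypothesis g_cont : {within `[0, t], continuous g}.
Hypothesis qv_cvg : forall q : rat, 0 <= q <= 1 ->
  qv_sum p x (ratr q * t) @ \oo --> \int[mu]_(u in `[0, ratr q * t]) g u.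

Let qv_block (m k : nat) : (k < m)%N ->
  (fun n => \sum_(lidx p n (k%:R * (t / m%:R)) <= i < lidx p n (k.+1%:R * (t / m%:R)))
     (x (ptime p n i.+1) - x (ptime p n i)) ^+ 2) @ \oo -->
  \int[mu]_(u in `]k%:R * (t / m%:R), k.+1%:R * (t / m%:R)]) g u.
Proof.
move=> km; have m0 : (0 < m)%N by apply: leq_ltn_trans km.
have mR0 : 0 < m%:R :> R by rewrite ltr0n.
have H l : (l <= m)%N ->
    qv_sum p x (l%:R * (t / m%:R)) @ \oo --> \int[mu]_(u in `[0, l%:R * (t / m%:R)]) g u.
  move=> lm; have E : l%:R * (t / m%:R) = ratr (l%:R / m%:R) * t :> R.
    by rewrite fmorph_div/= !ratr_nat; field; rewrite gt_eqF.
  rewrite E; apply: qv_cvg; rewrite divr_ge0//= ler_pdivrMr ?ltr0n// mul1r ler_nat//.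
have h0 : 0 <= t / m%:R by apply: divr_ge0; exact: ltW.
have kk : k%:R * (t / m%:R) <= k.+1%:R * (t / m%:R).
  by rewrite ler_wpM2r// ler_nat.
rewrite -(@Rintegral_itvB _ g (BLeft 0) (BRight (k.+1%:R * (t / m%:R))) (k%:R * (t / m%:R))).
- apply: cvg_trans (cvgB (H _ km) (H _ (ltnW km))); apply: near_eq_cvg; near=> n.
  rewrite /qv_sum !fctE !(sum_lidx p n _ (fun i => (x (ptime p n i.+1) - x (ptime p n i)) ^+ 2)).
  by rewrite (big_cat_nat (leq0n _) (lidx_mono p n kk))//= addrC addKr.
- apply: cont_integrable_cc; apply: continuous_subspaceW g_cont.
  apply: subset_itvl; rewrite bnd_simp.
  by rewrite mulrA ler_pdivrMr// mulrC ler_pM2l// ler_nat.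
- by rewrite bnd_simp mulr_ge0.
- by rewrite bnd_simp.
Unshelve. all: by end_near. Qed.

Variable C : R.
Hypothesis C_ge0 : 0 <= C.

Let cvg_sum_nat (m : nat) (u : nat -> nat -> R) (l : nat -> R) :
  (forall k, (k < m)%N -> u ^~ k @ \oo --> l k) ->
  (fun n => \sum_(0 <= k < m) u n k) @ \oo --> \sum_(0 <= k < m) l k.
Proof.
elim: m => [|m IH] H.
  by rewrite big_nil; under eq_fun do rewrite big_nil; exact: cvg_cst.
rewrite big_nat_recr//=; under eq_fun do rewrite big_nat_recr//=.
apply: cvgD; last exact: H.
by apply: IH => k km; apply: H; exact: leqW.
Qed.

(** Bounding the weights on each block by their supremum leaves the plain
    quadratic variation of the block; replacing the integral of [g] over a block
    by the value of [g] at its end gives the sums of [block_step_cvg]. *)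
Let weighted_qv_upper (phi : nat -> nat -> R) (Phi : R -> R) :
  (forall n i, (i < psize p n)%N -> `|phi n i| <= C) ->
  (forall u e : R, 0 < u < t -> 0 < e ->
    exists2 d : R, 0 < d & exists N, forall n i, (N <= n)%N -> (i < psize p n)%N ->
    u - d <= ptime p n i <= u -> `|Phi u - phi n i| < e) ->
  forall e : R, 0 < e -> exists N, forall n, (N <= n)%N ->
   \sum_(0 <= i < lidx p n t) phi n i * (x (ptime p n i.+1) - x (ptime p n i)) ^+ 2 <=
   \int[mu]_(u in `]0, t[) (Phi u * g u) + e.
Proof.
move=> phiC phi_cvg e e0.
have [_ _ J_cvg] := block_step_cvg t_gt0 t_le phiC phi_cvg C_ge0 g_cont.
set S := block_sup p t phi in J_cvg *.
set I := \int[mu]_(u in _) _ in J_cvg *.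
have e40 : 0 < e / 4 by rewrite divr_gt0.
have [M1 HM1] := (cvg_seq_eps _ _).1 J_cvg _ e40.
(* One quarter of [e] each goes to the convergence of the step integrals, to
   the convergence of the quadratic variation, to the oscillation of [g] on a
   block, and to the last block, which has no block after it to carry its
   supremum. *)
pose om := e / (4 * (C * t + 1)).
have Ct : 0 < C * t + 1 by rewrite ltr_wpDl// mulr_ge0// ltW.
have om0 : 0 < om by rewrite divr_gt0// mulr_gt0.
have [eta eta0 Heta] := unif_cont_itv g_cont om0.
have [M2 HM2] := block_small t_gt0 eta0.
pose G := C * `|g t| + 1.
have G0 : 0 < G by rewrite ltr_wpDl// mulr_ge0.
have [M3 HM3] := block_small t_gt0 (divr_gt0 e40 G0).
pose m := maxn M1 (maxn M2 M3).
have {HM1} := HM1 m (leq_maxl _ _).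
have {HM2} := HM2 m (leq_trans (leq_maxl _ _) (leq_maxr _ _)).
have {HM3} := HM3 m (leq_trans (leq_maxr _ _) (leq_maxr _ _)).
set h := t / m.+1%:R => HM3 HM2 HM1.
have h0 : 0 < h by rewrite divr_gt0.
have mh : m.+1%:R * h = t by rewrite mulrC divfK.
pose Q n k := \sum_(lidx p n (k%:R * h) <= i < lidx p n (k.+1%:R * h))
     (x (ptime p n i.+1) - x (ptime p n i)) ^+ 2.
have Scvg : (fun n => \sum_(0 <= k < m.+1) S m k * Q n k) @ \oo -->
   \sum_(0 <= k < m.+1) S m k * \int[mu]_(u in `]k%:R * h, k.+1%:R * h]) g u.
  apply: (@cvg_sum_nat m.+1 (fun n k => S m k * Q n k)) => k km.
  by apply: cvgMr; exact: qv_block.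
have [N1 HN1] := (cvg_seq_eps _ _).1 Scvg _ e40.
have [N2 HN2] := mesh_small p h0.
exists (maxn m (maxn N1 N2)) => n Nn.
have mn : (m <= n)%N by apply: leq_trans Nn; exact: leq_maxl.
have [N1n N2n] : (N1 <= n)%N /\ (N2 <= n)%N.
  by apply/andP; rewrite -geq_max; apply: leq_trans Nn; exact: leq_maxr.
have up l : (l <= m.+1)%N ->
    \sum_(0 <= i < lidx p n (l%:R * h)) phi n i * (x (ptime p n i.+1) - x (ptime p n i)) ^+ 2
    <= \sum_(0 <= k < l) S m k * Q n k.
  elim: l => [|l IH] lm.
    rewrite mul0r big_nil; case E : (lidx p n 0) => [|j]; first by rewrite big_nil.
    have jn : (0 < psize p n)%N by apply: leq_trans (lidx_le p n 0); rewrite E.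
    have := lidxP 0 jn; rewrite E ltnS leq0n => H0.
    by have := ptime_lt jn; rewrite ptime_first ltNge H0.
  have ll : l%:R * h <= l.+1%:R * h by rewrite ler_pM2r// ler_nat.
  rewrite (big_cat_nat (leq0n _) (lidx_mono p n ll))//= big_nat_recr//=.
  apply: lerD; first exact: IH (ltnW lm).
  rewrite mulr_sumr; apply: ler_sum_nat => i /andP[li il].
  rewrite ler_wpM2r ?sqr_ge0//.
  have ni : (i < psize p n)%N by apply: leq_trans il (lidx_le _ _ _).
  apply: (block_sup_ge phiC) => //.
  have h1 : ptime p n i.+1 <= l.+1%:R * h by rewrite lidxP.
  have h2 : l%:R * h < ptime p n i.+1 by rewrite ltNge lidxP// -leqNgt.
  have h3 := HN2 n N2n i ni; have h4 := ptime_lt ni.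
  rewrite -/h mulrBl mul1r; move: h0 h1 h2 h3 h4; move: (l%:R * h) (l.+1%:R * h) (h) => *.
  by apply/andP; split; lra.
have {up} := up m.+1 (leqnn _); rewrite mh => up.
apply: le_trans up _.
have := HN1 n N1n; rewrite ltr_distl => /andP[+ _]; rewrite ltrBlDr => /ltW H1.
apply: le_trans H1 _.
have blk k : (k < m.+1)%N ->
    S m k * (\int[mu]_(u in `]k%:R * h, k.+1%:R * h]) g u) <=
    S m k * g (k.+1%:R * h) * h + C * (om * h).
  move=> km.
  have k0 : 0 <= k%:R * h by rewrite mulr_ge0// ltW.
  have kS : k.+1%:R * h = k%:R * h + h by rewrite -[k.+1]addn1 natrD mulrDl mul1r.
  have kt : k.+1%:R * h <= t by rewrite -mh ler_pM2r// ler_nat.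
  have kk : k%:R * h <= k.+1%:R * h by rewrite kS lerDl ltW.
  have := @Rintegral_block_cst R g (k%:R * h) (k.+1%:R * h) (g (k.+1%:R * h)) om kk.
  have c1 : {within `[k%:R * h, k.+1%:R * h], continuous g}.
    by apply: continuous_subspaceW g_cont; apply: subset_itv; rewrite bnd_simp.
  have c2 u : k%:R * h <= u <= k.+1%:R * h -> `|g u - g (k.+1%:R * h)| <= om.
    move=> /andP[u1 u2]; apply/ltW/Heta.
    + by rewrite (le_trans k0 u1) (le_trans u2 kt).
    + by rewrite kt (le_trans k0 kk).
    + rewrite distrC ger0_norm ?subr_ge0//; apply: le_lt_trans HM2.
      by rewrite lerBlDr addrC kS lerD2r.
  move=> /(_ c1 c2).
  have -> : k.+1%:R * h - k%:R * h = h by rewrite kS addrAC subrr add0r.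
  set II := Rintegral _ _ _ => HI.
  rewrite -mulrA -lerBlDl -mulrBr; apply: le_trans (ler_norm _) _.
  by rewrite normrM ler_pM// (block_sup_bound t phiC).
apply: le_trans (_ : _ <= \sum_(0 <= k < m.+1) (S m k * g (k.+1%:R * h) * h + C * (om * h)) + e / 4) _.
  by rewrite lerD2r; apply: ler_sum_nat => k /andP[_]; exact: blk.
rewrite big_split/= big_nat_recr//= mh sumr_const_nat subn0.
have E1 : C * (om * h) *+ m.+1 <= e / 4.
  have -> : C * (om * h) *+ m.+1 = (C * t) * om by rewrite -mulr_natl -mh; ring.
  rewrite /om mulrA ler_pdivrMr ?mulr_gt0// mulrC.
  have -> : e / 4 * (4 * (C * t + 1)) = e * (C * t + 1) by field.
  by rewrite ler_pM2l// lerDl.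
have E2 : S m m * g t * h <= e / 4.
  apply: le_trans (ler_norm _) _; rewrite [`|_ * h|]normrM (gtr0_norm h0) [X in X * _]normrM.
  apply: le_trans (_ : G * h <= _).
    rewrite ler_pM2r// /G; apply: le_trans (_ : C * `|g t| <= _); last by rewrite lerDl.
    by rewrite ler_pM// (block_sup_bound t phiC).
  by rewrite mulrC -ler_pdivlMr// ltW.
move: HM1; rewrite ltr_distl => /andP[+ _].
move: E1 E2; set s1 := C * _ *+ _; set s2 := S m m * _ * _; set s3 := \sum_(_ <= _ < _) _.
by move=> *; lra.
Qed.

(** The weights need only converge from the left, which is all that
    left-continuous functionals provide.  The lower bound is the upper bound for
    the opposite weights. *)
Lemma weighted_qv_cvg (phi : nat -> nat -> R) (Phi : R -> R) :
  (forall n i, (i < psize p n)%N -> `|phi n i| <= C) ->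
  (forall u e : R, 0 < u < t -> 0 < e ->
    exists2 d : R, 0 < d & exists N, forall n i, (N <= n)%N -> (i < psize p n)%N ->
    u - d <= ptime p n i <= u -> `|Phi u - phi n i| < e) ->
  (fun n => \sum_(0 <= i < lidx p n t)
     phi n i * (x (ptime p n i.+1) - x (ptime p n i)) ^+ 2) @ \oo -->
  \int[mu]_(u in `]0, t[) (Phi u * g u).
Proof.
move=> phiC phi_cvg; apply/cvg_seq_eps => e e0.
have e20 : 0 < e / 2 by rewrite divr_gt0.
have [N1 HN1] := weighted_qv_upper phiC phi_cvg e20.
have [||N2 HN2] := @weighted_qv_upper (fun n i => - phi n i) (fun u => - Phi u) _ _ _ e20.
- by move=> n i ni; rewrite normrN; exact: phiC.
- move=> u e1 ut e10; have [d d0 [N HN]] := phi_cvg u e1 ut e10.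
  by exists d => //; exists N => n i Nn ni di; rewrite -opprD normrN; exact: HN.
exists (maxn N1 N2) => n; rewrite geq_max => /andP[/HN1 h1 /HN2].
under eq_bigr do rewrite mulNr.
rewrite sumrN; under eq_Rintegral do rewrite mulNr -mulN1r.
have [mPg [D HD] _] := block_step_cvg t_gt0 t_le phiC phi_cvg C_ge0 g_cont.
rewrite RintegralZl//; last first.
  apply: (@bounded_integrable _ _ _ _ _ _ D) => //; first exact: lebesgue_itvoo_lty.
rewrite mulN1r ltr_distl.
set I := \int[mu]_(u in _) _ in h1 *; set S := \sum_(_ <= _ < _) _ in h1 *.
by move=> h2; apply/andP; split; lra.
Qed.

End WeightedQuadraticVariation.

(** * Pathwise change of variable formula *)

Section PathBasics.
Context {R : realType}.
Implicit Types (x y : R -> R) (s t u e l : R).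

Lemma cvg_right_cst x u l d : 0 < d -> (forall r, u < r < u + d -> x r = l) ->
  x @ u^'+ --> l.
Proof.
move=> d0 H; apply: cvg_near_cst; rewrite near_withinE /=.
exists d => // r /= ur ltur; apply/H; rewrite ltur/=.
by move: ur; rewrite ltr_distl => /andP[]; rewrite ltrBlDr.
Qed.

Lemma cvg_left_cst x u l d : 0 < d -> (forall r, u - d < r < u -> x r = l) ->
  x @ u^'- --> l.
Proof.
move=> d0 H; apply: cvg_near_cst; rewrite near_withinE /=.
exists d => // r /= ur ltur; apply/H; rewrite ltur/= andbT.
by move: ur; rewrite ltr_distl => /andP[_]; rewrite ltrBlDr.
Qed.

Lemma sup_dist_le t x y e : (forall u, 0 <= u <= t -> `|x u - y u| <= e) ->
  (sup_dist t x y <= e%:E)%E.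
Proof.
move=> H; apply: ge_ereal_sup => _ [u /= ut <-].
by rewrite lee_fin; apply: H; move: ut; rewrite in_itv.
Qed.

Lemma sup_dist_lt t x y e : (sup_dist t x y < e%:E)%E ->
  forall u, 0 <= u <= t -> `|x u - y u| < e.
Proof.
move=> H u ut; rewrite -lte_fin; apply: le_lt_trans H.
by apply: ereal_sup_ubound; exists u => //=; rewrite in_itv.
Qed.

Lemma dinfty_lt t s x y a e : s <= t ->
  (forall u, 0 <= u <= t -> `|x u - y (Num.min u s)| <= a) ->
  a + (t - s) < e -> (dinfty t x s y < e%:E)%E.
Proof.
move=> st H ae; rewrite /dinfty (max_idPl st).
apply: (@le_lt_trans _ _ (a%:E + `|t - s|%:E)%E).
  apply: leeD => //; apply: sup_dist_le => u ut; rewrite /stop.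
  by rewrite (min_idPl _) ?H//; case/andP: ut.
by rewrite ger0_norm ?subr_ge0// -EFinD lte_fin.
Qed.

Lemma cadlag_sub (A B : set R) t x : A `<=` B -> cadlag A t x -> cadlag B t x.
Proof.
move=> AB [h1 h2 h3]; split => //; first by move=> u ut; apply/AB/h1.
by move=> u ut; have [l /AB] := h3 u ut; exists l.
Qed.

Lemma cont_cadlag (A : set R) (T t : R) x : {within `[0, T], continuous x} ->
  (forall u, 0 <= u <= T -> A (x u)) -> t <= T -> cadlag A t x.
Proof.
move=> cx xA tT; split.
- by move=> u /andP[u0 ut]; apply: xA; rewrite u0 (le_trans ut).
- move=> u /andP[u0 ut]; apply/cvgrPdist_lt => e e0.
  have uT : 0 <= u <= T by rewrite u0 (le_trans (ltW ut)).
  have [eta eta0 H] := cont_itv_eps cx uT e0.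
  rewrite near_withinE /=; exists (Num.min eta (T - u)) => /=.
    by rewrite lt_min eta0 subr_gt0 (lt_le_trans ut).
  move=> r /=; rewrite lt_min => /andP[ur urT] ltur; apply: H => //.
  rewrite (le_trans u0 (ltW ltur))/=; move: urT; rewrite distrC gtr0_norm ?subr_gt0//.
  by rewrite ltrD2r => /ltW.
- move=> u /andP[u0 ut]; have uT : 0 <= u <= T by rewrite ltW//= (le_trans ut).
  exists (x u); first exact: xA.
  apply/cvgrPdist_lt => e e0; have [eta eta0 H] := cont_itv_eps cx uT e0.
  rewrite near_withinE /=; exists (Num.min eta u) => /=.
    by rewrite lt_min eta0.
  move=> r /=; rewrite lt_min => /andP[ur urT] ltur; apply: H => //.
  move: urT; rewrite gtr0_norm ?subr_gt0// ltrBlDr ltrDl => r0.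
  by rewrite ltW//= (le_trans (ltW ltur))//; case/andP: uT.
Qed.

Lemma lim_near_eq (f g : R -> R) (G : set_system R) {FG : Filter G} :
  (\forall h \near G, f h = g h) -> lim (f @ G) = lim (g @ G).
Proof.
move=> H; congr (get _); apply/funext => l; apply/propext; split; apply: cvg_trans.
  by apply: near_eq_cvg; apply: filterS H.
by apply: near_eq_cvg; apply: filterS H.
Qed.

End PathBasics.

Section FrozenStepPath.
Context {R : realType} (T : R) (p : partition_seq T).
Implicit Types (x : R -> R) (n i j : nat) (s t u c : R).

Lemma step_pathE x n j u : (j < psize p n)%N ->
  ptime p n j <= u < ptime p n j.+1 -> step_path p x n u = x (ptime p n j.+1).
Proof.
move=> jn /andP[ju uj]; rewrite /step_path (bigD1 (Ordinal jn))//= big1 ?addr0.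
  rewrite indicE mem_set ?mulr1/= ?in_itv/= ?ju//.
  rewrite indicE memNset ?mulr0 ?addr0//= => uT.
  by have /andP[_ h] := ptime_itv jn; have := lt_le_trans uj h; rewrite uT ltxx.
move=> i ij; rewrite indicE memNset ?mulr0//= in_itv/= => /andP[iu ui].
move/eqP: ij; apply; apply/val_inj => /=; apply/eqP; rewrite eqn_leq.
have := le_lt_trans iu uj; rewrite ptime_ltE//; last exact: ltnW.
have := le_lt_trans ju ui; rewrite ptime_ltE//; last exact: ltnW.
by lia.
Qed.

(** The step approximation of [x] up to time [s], then frozen at the value [c].
    Vertical perturbations at [s] only change [c], and horizontal extensions
    past [s] do not change the path at all, so that along these paths the
    functional is a function of the two real variables [c] and time. *)
Definition kpath x n s c : R -> R := fun u => if u < s then step_path p x n u else c.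

Lemma cadlag_kpath (A : set R) x n s c t : 0 <= s <= T -> t <= T -> A c ->
  (forall j, (j < psize p n)%N -> ptime p n j < s -> A (x (ptime p n j.+1))) ->
  cadlag A t (kpath x n s c).
Proof.
move=> /andP[s0 sT] tT Ac Ax; split.
- move=> u /andP[u0 ut]; rewrite /kpath; case: ifPn => // us.
  have [j jn /andP[ju uj]] := ptime_block p n u0 (lt_le_trans us sT).
  rewrite (step_pathE _ jn) ?ju//; apply: Ax => //; exact: le_lt_trans us.
- move=> u /andP[u0 ut]; have [us|su] := ltP u s.
    have [j jn /andP[ju uj]] := ptime_block p n u0 (lt_le_trans us sT).
    apply: (@cvg_right_cst _ _ _ _ (Num.min (ptime p n j.+1 - u) (s - u))).
      by rewrite lt_min !subr_gt0 uj.
    move=> r /andP[ur]; rewrite -ltrBlDl lt_min !ltrD2r => /andP[r1 r2].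
    rewrite /kpath r2 us !(step_pathE _ jn)// ?ju// r1 andbT.
    exact: le_trans (ltW ur).
  apply: (@cvg_right_cst _ _ _ _ 1) => // r /andP[ur _].
  by rewrite /kpath !ltNge su (le_trans su (ltW ur)).
- move=> u /andP[u0 ut]; have [us|su] := leP u s.
    have [j jn /andP[ju uj]] := ptime_lblock p n u0 (le_trans ut tT).
    exists (x (ptime p n j.+1)); first by apply: Ax => //; exact: lt_le_trans us.
    apply: (@cvg_left_cst _ _ _ _ (u - ptime p n j)); first by rewrite subr_gt0.
    move=> r /andP[+ ru]; rewrite opprB addrCA subrr addr0 => jr.
    rewrite /kpath (lt_le_trans ru us) (step_pathE _ jn)// (ltW jr)/=.
    exact: lt_le_trans uj.
  exists c => //; apply: (@cvg_left_cst _ _ _ _ (u - s)); first by rewrite subr_gt0.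
  move=> r /andP[+ _]; rewrite opprB addrCA subrr addr0 => sr.
  by rewrite /kpath ltNge ltW.
Qed.

Lemma vpert_kpath x n s c h : vpert s (kpath x n s c) h = kpath x n s (c + h).
Proof. by apply/funext => u; rewrite /vpert /kpath ltxx; case: (u < s). Qed.

Lemma stop_kpath x n s c u : s <= u -> stop u (kpath x n s c) = kpath x n s c.
Proof.
move=> su; apply/funext => r; rewrite /stop /kpath.
have [//|ur] := leP r u.
by rewrite !ltNge su (le_trans su (ltW ur)).
Qed.

(** The paths at which the integrand is evaluated in the Föllmer sums, except
    for the first of them, are frozen step paths. *)
Lemma left_path_step x n i : (i < psize p n)%N ->
  left_path (ptime p n i.+1) (step_path p x n) =
  kpath x n (ptime p n i.+1) (x (ptime p n i.+1)).
Proof.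
move=> ni; apply/funext => u; rewrite /left_path /kpath; case: ifP => // _.
have -> : 0 < ptime p n i.+1 by rewrite -(ptime_first p n) ptime_smono.
apply: cvg_lim => //; apply: (@cvg_left_cst _ _ _ _ (ptime p n i.+1 - ptime p n i)).
  by rewrite subr_gt0 ptime_lt.
move=> r /andP[+ ru]; rewrite opprB addrCA subrr addr0 => /ltW ir.
by rewrite (step_pathE _ ni)// ir.
Qed.

(** Between two partition points the path frozen at the value of the next point
    is the full step path, which does not depend on the interval. *)
Lemma kpath_agree_horizon x n i c u : (i < psize p n)%N -> u < ptime p n i.+1 ->
  forall r, 0 <= r <= u ->
    kpath x n (ptime p n i) (x (ptime p n i.+1)) r = kpath x n T c r.
Proof.
move=> ni ui r /andP[r0 ru]; have iT : ptime p n i.+1 <= T by case/andP: (ptime_itv ni).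
have rT : r < T by apply: lt_le_trans iT; exact: le_lt_trans ui.
rewrite /kpath rT; case: ltP => // ir.
by rewrite (step_pathE _ ni)// ir (le_lt_trans ru).
Qed.

Lemma kpath_agree_next x n i : (i < psize p n)%N -> forall r,
  kpath x n (ptime p n i) (x (ptime p n i.+1)) r =
  kpath x n (ptime p n i.+1) (x (ptime p n i.+1)) r.
Proof.
move=> ni r; rewrite /kpath; have [ri|ir] := ltP r (ptime p n i).
  by rewrite (lt_trans ri)// ptime_lt.
by case: ltP => // ri; rewrite (step_pathE _ ni)// ir.
Qed.

(** The frozen value [c] may be any value no farther from [x] at the partition
    point than the next value, such as the intermediate point of a Taylor
    expansion; at the last index there is no next point. *)
Lemma kpath_close x e : {within `[0, T], continuous x} -> 0 < e ->
  exists2 eta : R, 0 < eta & exists N, forall n i u c, (N <= n)%N ->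
    (i <= psize p n)%N -> ptime p n i <= u <= T -> u - ptime p n i < eta ->
    `|x (ptime p n i) - c| <= `|x (ptime p n i) - x (ptime p n i.+1)| ->
    (i = psize p n -> c = x (ptime p n i)) ->
    forall r, 0 <= r <= u -> `|x r - kpath x n (ptime p n i) c r| <= e.
Proof.
move=> cx e0; have e20 : 0 < e / 2 by rewrite divr_gt0.
have [eta eta0 H] := unif_cont_itv cx e20.
have [N HN] := mesh_small p eta0.
exists eta => //; exists N => n i u c Nn ni /andP[iu uT] ueta Hc Hc' r /andP[r0 ru].
have rT : r <= T by exact: le_trans uT.
have e2e : e / 2 <= e by move: (e) e0 => z z0; lra.
have iT := ptime_itv ni.
rewrite /kpath; case: ltP => [ri|ir].
  have [j jn /andP[jr rj]] := ptime_block p n r0 (lt_le_trans ri (le_trans iu uT)).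
  rewrite (step_pathE _ jn) ?jr//; apply: le_trans e2e; apply/ltW/H.
  - by rewrite r0.
  - exact: ptime_itv.
  - rewrite distrC gtr0_norm ?subr_gt0//; apply: le_lt_trans (HN n Nn j jn).
    by rewrite lerB.
have -> : x r - c = (x r - x (ptime p n i)) + (x (ptime p n i) - c) by ring.
rewrite (splitr e); apply: le_trans (ler_normD _ _) _; apply: lerD.
  apply/ltW/H => //; first by rewrite r0.
  by rewrite ger0_norm ?subr_ge0//; apply: le_lt_trans ueta; rewrite lerB.
have [ein|nei] := eqVneq i (psize p n); first by rewrite Hc'// subrr normr0 ltW.
have lin : (i < psize p n)%N by rewrite ltn_neqAle nei.
apply: le_trans Hc _; apply/ltW/H => //; first exact: ptime_itv.
by rewrite distrC gtr0_norm ?subr_gt0 ?ptime_lt//; exact: HN.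
Qed.

End FrozenStepPath.

Section FunctionalCalculus.
Context {R : realType} (T : R) (U : set R).
Hypothesis U_open : open U.
Implicit Types (G : R -> (R -> R) -> R).

Definition non_anticipative_before G := forall t x y, 0 <= t < T ->
  cadlag U t x -> cadlag U t y -> (forall u, 0 <= u <= t -> x u = y u) ->
  G t x = G t y.

Lemma open_shift (a : R) : U a -> exists2 d : R, 0 < d & forall h, `|h| < d -> U (a + h).
Proof.
move=> Ua; have /nbhs_ballP[d /= d0 H] := open_nbhs_nbhs (conj U_open Ua).
by exists d => // h hd; apply: H; rewrite /ball /= opprD addrA subrr sub0r normrN.
Qed.

Lemma cadlag_vpert t x h : cadlag U t x -> U (x t + h) -> cadlag U t (vpert t x h).
Proof.
move=> [h1 h2 h3] Uh; split.
- move=> u ut; rewrite /vpert; case: ltP => // _; exact: h1.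
- move=> u /andP[u0 ut]; rewrite /vpert ut.
  have := h2 u; rewrite u0 ut => /(_ isT); apply: cvg_trans; apply: near_eq_cvg.
  rewrite near_withinE /=; exists (t - u); first by rewrite /= subr_gt0.
  move=> r /= ur ltur; case: ifPn => // /negP; elim.
  by move: ur; rewrite distrC gtr0_norm ?subr_gt0// ltrD2r.
- move=> u /andP[u0 ut]; have [|l Ul xl] := h3 u; first by rewrite u0.
  exists l => //; move: xl; apply: cvg_trans; apply: near_eq_cvg.
  rewrite near_withinE /=; exists 1 => //= r ur ru.
  by rewrite /vpert (lt_le_trans ru ut).
Qed.

Lemma cadlag_stop t s x : 0 <= t -> cadlag U t x -> t <= s -> cadlag U s (stop t x).
Proof.
move=> t0 [h1 h2 h3] ts; rewrite /stop; split.
- move=> u /andP[u0 us]; apply: h1; rewrite le_min u0 t0 ge_min lexx orbT//.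
- move=> u /andP[u0 us]; have [ut|tu] := ltP u t.
    have := h2 u; rewrite u0 ut => /(_ isT); apply: cvg_trans; apply: near_eq_cvg.
    rewrite near_withinE /=; exists (t - u); first by rewrite /= subr_gt0.
    move=> r /= ur ltur; congr x; apply/esym/min_idPl.
    by move: ur; rewrite distrC gtr0_norm ?subr_gt0// ltrD2r => /ltW.
  apply: (@cvg_right_cst _ _ _ _ 1) => // r /andP[ur _].
  by congr x; rewrite (min_idPr _)// (le_trans tu (ltW ur)).
- move=> u /andP[u0 us]; have [ut|tu] := leP u t.
    have [|l Ul xl] := h3 u; first by rewrite u0.
    exists l => //; move: xl; apply: cvg_trans; apply: near_eq_cvg.
    rewrite near_withinE /=; exists 1 => //= r ur ru.
    by congr x; apply/esym/min_idPl; rewrite (le_trans (ltW ru)).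
  exists (x t); first by apply: h1; rewrite t0 lexx.
  apply: (@cvg_left_cst _ _ _ _ (u - t)); first by rewrite subr_gt0.
  move=> r /andP[+ _]; rewrite opprB addrCA subrr addr0 => /ltW sr.
  by congr x; apply/min_idPr.
Qed.

Lemma non_anticipative_vderiv G :
  non_anticipative_before G -> non_anticipative_before (vderiv G).
Proof.
move=> H t x y tT cx cy xy; rewrite /vderiv; apply: lim_near_eq.
have tt : 0 <= t <= t by rewrite lexx; case/andP: tT => ->.
have Uxt : U (x t) by case: cx => + _ _; exact.
have [d d0 Hd] := open_shift Uxt.
rewrite near_withinE /=; exists d => // h /=; rewrite sub0r normrN => hd _.
rewrite /vquot (H t x y)//; congr ((_ - _) / _); apply: H => //.
- by apply: cadlag_vpert => //; exact: Hd.
- by apply: cadlag_vpert => //; rewrite -xy//; exact: Hd.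
- by move=> u ut; rewrite /vpert; case: ltP => _; rewrite xy.
Qed.

Lemma non_anticipative_hderiv G :
  non_anticipative U T G -> non_anticipative_before (hderiv G).
Proof.
move=> H t x y /andP[t0 tT] cx cy xy; rewrite /hderiv; apply: lim_near_eq.
rewrite near_withinE /=; exists (T - t); first by rewrite /= subr_gt0.
move=> h /=; rewrite sub0r normrN => hd h0; rewrite gtr0_norm// in hd.
rewrite /hquot; congr ((_ - _) / _); apply: H => //; last by rewrite t0 ltW.
- by rewrite addr_ge0 ?(ltW h0)//= addrC -lerBrDr ltW.
- by apply: cadlag_stop => //; rewrite lerDl ltW.
- by apply: cadlag_stop => //; rewrite lerDl ltW.
- by move=> u /andP[u0 ut]; rewrite /stop; apply: xy; rewrite le_min u0 t0 ge_min lexx orbT.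
Qed.

End FunctionalCalculus.

Definition bounded_derivatives {R : realType} (T : R) (F : R -> (R -> R) -> R)
    (al be C : R) : Prop :=
  [/\ forall s y, 0 <= s <= T -> cadlag `[al, be] s y -> `|F s y| <= C,
      forall s y, 0 <= s < T -> cadlag `[al, be] s y -> `|hderiv F s y| <= C,
      forall s y, 0 <= s < T -> cadlag `[al, be] s y -> `|vderiv F s y| <= C &
      forall s y, 0 <= s < T -> cadlag `[al, be] s y -> `|vderiv (vderiv F) s y| <= C].

Section SegmentPaths.
Context {R : realType} (T : R) (U : set R) (F : R -> (R -> R) -> R).
Notation mu := (@lebesgue_measure R).
Hypotheses (U_open : open U) (F_C12b : C12b U T F).
Variables (al be : R).
Hypothesis KU : `[al, be] `<=` U.

Lemma C12b_bound : exists2 C : R, 0 < C & bounded_derivatives T F al be C.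
Proof.
have [_ [b1 b2 b3 b4]] := F_C12b.
have cK : compact `[al, be]%classic by exact: segment_compact.
have [C1 C10 H1] := b1 _ cK KU; have [C2 C20 H2] := b2 _ cK KU.
have [C3 C30 H3] := b3 _ cK KU; have [C4 C40 H4] := b4 _ cK KU.
exists (C1 + C2 + C3 + C4); first by rewrite !addr_gt0.
split=> t y ty cy.
- by apply: le_trans (H1 t y _ cy) _; rewrite /= ?in_itv//; lra.
- by apply: le_trans (H2 t y _ cy) _; rewrite /= ?in_itv//; lra.
- by apply: le_trans (H3 t y _ cy) _; rewrite /= ?in_itv//; lra.
- by apply: le_trans (H4 t y _ cy) _; rewrite /= ?in_itv//; lra.
Qed.

Variables (p : partition_seq T) (x : R -> R).
Hypothesis x_K : forall u, 0 <= u <= T -> al <= x u <= be.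

Lemma cadlagK_kpath n i t c : (i <= psize p n)%N -> t <= T -> al <= c <= be ->
  cadlag `[al, be] t (kpath p x n (ptime p n i) c).
Proof.
move=> ni tT cab; apply: cadlag_kpath => //; first exact: ptime_itv.
by move=> j jn _; rewrite /= in_itv/=; apply/x_K/ptime_itv.
Qed.

Lemma cadlagK_kpathT n t : t <= T -> 0 <= T ->
  cadlag `[al, be] t (kpath p x n T (x T)).
Proof.
move=> tT T0; apply: cadlag_kpath; rewrite ?T0 ?lexx//= ?in_itv/= ?x_K ?T0 ?lexx//.
by move=> j jn _; rewrite /= in_itv/=; apply/x_K/ptime_itv.
Qed.

Let x_K' n i : (i <= psize p n)%N -> al <= x (ptime p n i) <= be.
Proof. by move=> ni; apply/x_K/ptime_itv. Qed.

(** Along a frozen step path, the functional depends on the frozen value only,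
    and its vertical derivative is the derivative in that value. *)
Lemma is_derive_kpath (G : R -> (R -> R) -> R) n i c :
  vdifferentiable U T G -> (i < psize p n)%N -> al <= c <= be ->
  is_derive c 1 (fun b => G (ptime p n i) (kpath p x n (ptime p n i) b))
    (vderiv G (ptime p n i) (kpath p x n (ptime p n i) c)).
Proof.
move=> dG ni cab; apply/is_derive1P.
have iT : 0 <= ptime p n i < T.
  have /andP[-> _] := ptime_itv (ltnW ni).
  by have /andP[_] := ptime_itv ni; apply: lt_le_trans; exact: ptime_lt.
have cU : cadlag U (ptime p n i) (kpath p x n (ptime p n i) c).
  by apply: cadlag_sub KU _; apply: cadlagK_kpath; rewrite ?(ltnW ni)//; case/andP: iT => _ /ltW.
have := dG _ _ iT cU; rewrite /vderiv.
set f := vquot _ _ _; have -> // : f = (fun h =>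
  (G (ptime p n i) (kpath p x n (ptime p n i) (c + h)) -
   G (ptime p n i) (kpath p x n (ptime p n i) c)) / h).
by apply/funext => h; rewrite /f /vquot vpert_kpath.
Qed.

(** Constancy of the path on a partition interval turns the increment of the
    functional there into an integral of the horizontal derivative. *)
Lemma horizontal_increment n i : (i < psize p n)%N ->
  measurable_fun `[ptime p n i, ptime p n i.+1[
    (fun u => hderiv F u (kpath p x n T (x T))) /\
  \int[mu]_(u in `[ptime p n i, ptime p n i.+1[)
    hderiv F u (kpath p x n T (x T)) =
  F (ptime p n i.+1) (kpath p x n (ptime p n i.+1) (x (ptime p n i.+1))) -
  F (ptime p n i) (kpath p x n (ptime p n i) (x (ptime p n i.+1))).
Proof.
move=> ni; set a := ptime p n i; set b := ptime p n i.+1.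
have ab : a < b by apply: ptime_lt.
have /andP[a0 aT] : 0 <= a <= T by apply: ptime_itv; exact: ltnW.
have /andP[b0 bT] : 0 <= b <= T by apply: ptime_itv.
pose k := kpath p x n a (x b).
have T0 : 0 <= T by exact: le_trans bT.
have ck t : t <= T -> cadlag `[al, be] t k.
  by move=> tT; apply: cadlagK_kpath; rewrite ?x_K'// ltnW.
have ckU t : t <= T -> cadlag U t k by move=> /ck; exact: cadlag_sub.
have [C C0 [_ HC _ _]] := C12b_bound.
have [[[nF hF _ _] _ [lF _ _]] _] := F_C12b.
pose G u := F u k.
have dG u : a <= u < b -> (G (u + h) - G u) / h @[h --> 0^'+] --> hderiv F u k.
  move=> /andP[au ub]; have uT : 0 <= u < T by rewrite (le_trans a0 au) (lt_le_trans ub).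
  have := hF u k uT (ckU _ (ltW (lt_le_trans ub bT))); rewrite /hderiv.
  set f := hquot _ _ _; have -> // : f = (fun h => (G (u + h) - G u) / h).
  by apply/funext => h; rewrite /f /hquot /k stop_kpath.
have bD u : a <= u < b -> `|hderiv F u k| <= C.
  move=> /andP[au ub]; have uT : 0 <= u < T by rewrite (le_trans a0 au) (lt_le_trans ub).
  by apply: HC => //; apply: ck; case/andP: uT => _ /ltW.
have cG : {within `[a, b], continuous G}.
  apply: eps_cont_itv => u e /andP[au ub] e0.
  have uT : 0 <= u <= T by rewrite (le_trans a0 au) (le_trans ub).
  have uI : `[0, T]%classic u by rewrite /= in_itv.
  have uT' : u <= T by case/andP: uT.
  have [eta eta0 Heta] := lF u k e uI (ckU _ uT') e0.
  have left v : a <= v -> v <= u -> u - v < eta -> `|G u - G v| < e.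
    move=> av vu uv; have := Heta (u - v) k; rewrite subKr; apply.
    - by rewrite subr_ge0 vu gerBl (le_trans a0).
    - by apply: ckU; apply: le_trans vu _; case/andP: uT.
    - apply: (@dinfty_lt _ _ _ _ _ 0) => //; last by rewrite add0r.
      move=> r /andP[r0 ru]; have -> : k (Num.min r v) = k r.
        by rewrite -[LHS]/(stop v k r) /k stop_kpath.
      by rewrite subrr normr0.
  have [ub'|bu] := ltP u b; last first.
    exists eta => // v /andP[av vb] uv; apply: left => //.
      exact: le_trans bu.
    by apply: le_lt_trans uv; exact: ler_norm.
  have uab : a <= u < b by rewrite au.
  have /cvgrPdist_lt/(_ _ ltr01)[d /= d0 Hd] := dG u uab.
  have D0 : 0 < `|hderiv F u k| + 1 by rewrite ltr_wpDl.
  exists (Num.min eta (Num.min d (e / (`|hderiv F u k| + 1)))).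
    by rewrite !lt_min eta0 d0 divr_gt0.
  move=> v /andP[av vb]; rewrite !lt_min => /and3P[u1 u2 u3].
  have [vu|uv] := leP v u.
    by apply: left => //; apply: le_lt_trans u1; exact: ler_norm.
  rewrite distrC gtr0_norm ?subr_gt0// in u2 u3.
  have h0 : 0 < v - u by rewrite subr_gt0.
  have := Hd (v - u); rewrite /= sub0r normrN gtr0_norm// => /(_ u2 h0).
  rewrite addrCA subrr addr0 => H.
  have {}H : `|(G v - G u) / (v - u)| < `|hderiv F u k| + 1.
    rewrite -[X in `|X|](subKr (hderiv F u k)); apply: le_lt_trans (ler_normB _ _) _.
    by rewrite ltrD2l.
  rewrite distrC; move: H; rewrite normf_div (gtr0_norm h0) ltr_pdivrMr// => H.
  by apply: lt_trans H _; rewrite mulrC -ltr_pdivlMr.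
have [mD ID] := right_derivative_FTC (ltW ab) cG dG bD.
have E u : u \in `[a, b[%classic -> hderiv F u k = hderiv F u (kpath p x n T (x T)).
  rewrite inE /= in_itv/= => /andP[au ub].
  have uT : 0 <= u < T by rewrite (le_trans a0 au) (lt_le_trans ub).
  have /andP[_ /ltW uT'] := uT.
  apply: (non_anticipative_hderiv nF) => //.
  - exact: ckU.
  - by apply: cadlag_sub KU _; exact: cadlagK_kpathT.
  - exact: kpath_agree_horizon.
split; first by apply: eq_measurable_fun mD => u /E.
have -> : \int[mu]_(u in `[a, b[) hderiv F u (kpath p x n T (x T)) =
    \int[mu]_(u in `[a, b[) hderiv F u k by apply: eq_Rintegral => u /E ->.
rewrite ID /G; congr (_ - _).
apply: nF => //.
- by rewrite b0.
- exact: ckU.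
- by apply: cadlag_sub KU _; apply: cadlagK_kpath => //; exact: x_K'.
- by move=> r _; exact: kpath_agree_next.
Qed.

Local Notation xi n i := (vderiv F (ptime p n i) (kpath p x n (ptime p n i) (x (ptime p n i)))).
Local Notation dx n i := (x (ptime p n i.+1) - x (ptime p n i)).

Lemma vertical_increment n i : (i < psize p n)%N ->
  exists2 th, Num.min (x (ptime p n i)) (x (ptime p n i.+1)) <= th <=
              Num.max (x (ptime p n i)) (x (ptime p n i.+1)) &
  F (ptime p n i) (kpath p x n (ptime p n i) (x (ptime p n i.+1))) -
  F (ptime p n i) (kpath p x n (ptime p n i) (x (ptime p n i))) =
  xi n i * dx n i +
  2^-1 * vderiv (vderiv F) (ptime p n i) (kpath p x n (ptime p n i) th) * dx n i ^+ 2.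
Proof.
move=> ni; have [[[_ _ dF ddF] _ _] _] := F_C12b.
have /andP[a1 b1] := x_K' (ltnW ni); have /andP[a2 b2] := x_K' ni.
apply: (@taylor2 R (fun b => F (ptime p n i) (kpath p x n (ptime p n i) b))
  (fun b => vderiv F (ptime p n i) (kpath p x n (ptime p n i) b))
  (fun b => vderiv (vderiv F) (ptime p n i) (kpath p x n (ptime p n i) b))) => y.
rewrite ge_min le_max => /andP[y1 y2].
have yK : al <= y <= be.
  apply/andP; split.
    by case/orP: y1; apply: le_trans.
  by case/orP: y2 => h; apply: le_trans h _.
by split; exact: is_derive_kpath.
Qed.

(** Telescoping over the partition: on each interval the frozen value first jumps
    to that of the next point, which is expanded to second order, and then time
    runs to the next point, which is integrated. *)
Lemma functional_expansion : exists th : nat -> nat -> R,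
  (forall n i, (i < psize p n)%N -> al <= th n i <= be /\
     `|x (ptime p n i) - th n i| <= `|x (ptime p n i) - x (ptime p n i.+1)|) /\
  forall n N, (N <= psize p n)%N ->
  measurable_fun `[0, ptime p n N[ (fun u => hderiv F u (kpath p x n T (x T))) /\
  F (ptime p n N) (kpath p x n (ptime p n N) (x (ptime p n N))) =
  F 0 x + \int[mu]_(u in `[0, ptime p n N[) hderiv F u (kpath p x n T (x T)) +
  \sum_(0 <= i < N) xi n i * dx n i +
  \sum_(0 <= i < N)
    2^-1 * vderiv (vderiv F) (ptime p n i) (kpath p x n (ptime p n i) (th n i)) * dx n i ^+ 2.
Proof.
have T0 : 0 <= T by have /andP[_] := ptime_itv (leq0n (psize p 0)); rewrite ptime_first.
have [C C0 [_ HC _ _]] := C12b_bound.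
have /choice[th Hth] : forall ni : nat * nat, exists th, (ni.2 < psize p ni.1)%N ->
  (Num.min (x (ptime p ni.1 ni.2)) (x (ptime p ni.1 ni.2.+1)) <= th <=
              Num.max (x (ptime p ni.1 ni.2)) (x (ptime p ni.1 ni.2.+1))) /\
  F (ptime p ni.1 ni.2) (kpath p x ni.1 (ptime p ni.1 ni.2) (x (ptime p ni.1 ni.2.+1))) -
  F (ptime p ni.1 ni.2) (kpath p x ni.1 (ptime p ni.1 ni.2) (x (ptime p ni.1 ni.2))) =
  xi ni.1 ni.2 * dx ni.1 ni.2 +
  2^-1 * vderiv (vderiv F) (ptime p ni.1 ni.2) (kpath p x ni.1 (ptime p ni.1 ni.2) th) * dx ni.1 ni.2 ^+ 2.
  move=> [n i] /=; have [ni|_] := ltnP i (psize p n); last by exists 0.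
  by have [th h1 h2] := vertical_increment ni; exists th.
exists (fun n i => th (n, i)); split.
  move=> n i ni; have [/andP[+ +] _] := Hth (n, i) ni => /=.
  have /andP[a1 b1] := x_K' (ltnW ni); have /andP[a2 b2] := x_K' ni.
  rewrite ge_min le_max; move: a1 b1 a2 b2.
  move: (x (ptime p n i)) (x (ptime p n i.+1)) (th (n, i)) => c e z ac cb ae eb.
  have [ce|/ltW ec] := leP c e => /orP h1 /orP h2.
    have cz : c <= z by case: h1 => // /(le_trans ce).
    have ze : z <= e by case: h2 => // h; exact: le_trans ce.
    rewrite distrC (distrC c e) !ger0_norm ?subr_ge0// lerD2r; split => //.
    by rewrite (le_trans ac cz) (le_trans ze eb).
  have ez : e <= z by case: h1 => // /(le_trans ec).
  have zc : z <= c by case: h2 => // h; exact: le_trans ec.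
  rewrite !ger0_norm ?subr_ge0// lerD2l lerN2; split => //.
  by rewrite (le_trans ae ez) (le_trans zc cb).
move=> n; elim=> [|N IH] Nn.
  rewrite ptime_first set_itvco0 Rintegral_set0 !big_nil !addr0; split; first exact: measurable_fun_set0.
  have [[[nF _ _ _] _ _] _] := F_C12b; apply: nF; rewrite ?lexx//.
  - apply: cadlag_sub KU _; rewrite -[X in kpath _ _ _ X](ptime_first p n).
    by apply: cadlagK_kpath => //; apply: x_K; rewrite lexx.
  - split=> [u u0||]; last 2 first.
    + by move=> u /andP[h1 h2]; have := le_lt_trans h1 h2; rewrite ltxx.
    + by move=> u /andP[h1 h2]; have := lt_le_trans h1 h2; rewrite ltxx.
    apply: KU; rewrite /= in_itv/=; apply: x_K; case/andP: u0 => -> /le_trans; exact.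
  - by move=> u /le_anti <-; rewrite /kpath ltxx.
have {IH}[m1 E1] := IH (ltnW Nn).
have [m2 E2] := horizontal_increment Nn.
have [/= _ E3] := Hth (n, N) Nn.
have tt := ptime_lt Nn.
have /andP[t0 _] := ptime_itv (ltnW Nn).
have /andP[_ tT] := ptime_itv Nn.
have cup : `[0, ptime p n N.+1[%classic = `[0, ptime p n N[ `|` `[ptime p n N, ptime p n N.+1[.
  by apply: itv_bndbnd_setU; rewrite bnd_simp// ltW.
have mD : measurable_fun `[0, ptime p n N.+1[ (fun u => hderiv F u (kpath p x n T (x T))).
  by rewrite cup; apply/measurable_funU.
split=> //.
have bD : forall u, `[0, ptime p n N.+1[%classic u -> `|hderiv F u (kpath p x n T (x T))| <= C.
  move=> u; rewrite /= in_itv/= => /andP[u0 ut]; apply: HC; first by rewrite u0 (lt_le_trans ut).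
  by apply: cadlagK_kpathT => //; apply: ltW; apply: lt_le_trans tT.
rewrite cup Rintegral_setU//.
- move: E1 E2 E3; rewrite !big_nat_recr//= => E1 -> E3.
  set a := F _ (kpath _ _ _ _ (x (ptime p n N))) in E1 E3.
  set b := F _ _ in E3 *; set c := F _ _ in E3 *.
  set v := vderiv (vderiv F) _ _ in E3 *; set w := xi n N in E3 *.
  set s1 := \sum_(0 <= i < N) _ in E1 *; set s2 := \sum_(0 <= i < N) _ in E1 *.
  set I := Rintegral _ _ _ in E1 *; move: a b c v w s1 s2 I E1 E3.
  by move=> a b c v w s1 s2 I; lra.
- rewrite -cup; apply: (@bounded_integrable _ _ _ _ _ _ C) => //; exact: lebesgue_itvco_lty.
- apply/disj_setPS => u [] /=; rewrite !in_itv/= => /andP[_ h1] /andP[h2 _].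
  by have := le_lt_trans h2 h1; rewrite ltxx.
Qed.

Hypotheses (x_cont : {within `[0, T], continuous x}) (T_gt0 : 0 < T).
Variables (t : R) (sigma : R -> R).
Hypotheses (t_gt0 : 0 < t) (t_le : t <= T).
Hypothesis sigma_cont : continuous sigma.

(** The finite-variation part of the change of variable formula along a path with
    quadratic variation [d[y](u) = sigma (y u) ^+ 2 du]. *)
Definition ito_drift (y : R -> R) (s : R) : R :=
  \int[mu]_(u in `[0, s[) hderiv F u y +
  2^-1 * \int[mu]_(u in `]0, s[) (vderiv (vderiv F) u y * sigma (y u) ^+ 2).

Lemma cadlagK_x s : s <= T -> cadlag `[al, be] s x.
Proof. by apply: cont_cadlag x_cont _ => u ut; rewrite /= in_itv/=; exact: x_K. Qed.

Lemma kpathT_cvg u : 0 <= u < T ->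
  (fun n => hderiv F u (kpath p x n T (x T))) @ \oo --> hderiv F u x.
Proof.
move=> /andP[u0 uT]; apply/cvg_seq_eps => e e0.
have [[_ cH _] _] := F_C12b.
have uI : `[0, T[%classic u by rewrite /= in_itv/= u0.
have cx : cadlag U u x by apply: cadlag_sub KU _; apply: cadlagK_x; exact: ltW.
have [eta eta0 Heta] := cH u x e uI cx e0.
have [eta' eta'0 [N HN]] := kpath_close p x_cont (divr_gt0 eta0 (ltr0Sn R 1)).
have [N' HN'] := mesh_small p eta'0.
exists (maxn N N') => n; rewrite geq_max => /andP[Nn Nn'].
apply: Heta.
  by apply: cadlag_sub KU _; apply: cadlagK_kpathT => //; exact: ltW.
apply: (@le_lt_trans _ _ (eta / 2)%:E).
  apply: sup_dist_le => r /andP[r0 ru].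
  have [i ni /andP[iu ui]] := ptime_block p n u0 uT.
  rewrite -(kpath_agree_horizon x (x T) ni ui) ?r0//.
  apply: (HN n i u) => //.
  - exact: ltnW.
  - by rewrite iu ltW.
  - by apply: lt_trans (HN' n Nn' i ni); rewrite ltrD2r.
  - by move=> ein; move: ni; rewrite ein ltnn.
  - by rewrite r0.
by rewrite lte_fin ltr_pdivrMr// ltr_pMr// ltr1n.
Qed.

Lemma left_continuous_kpath G (I : set R) u e : left_continuous U I G -> I u ->
  0 <= u <= T -> 0 < e -> exists2 eta : R, 0 < eta & exists N, forall n i c, (N <= n)%N ->
    (i <= psize p n)%N -> u - eta <= ptime p n i <= u -> al <= c <= be ->
    `|x (ptime p n i) - c| <= `|x (ptime p n i) - x (ptime p n i.+1)| ->
    (i = psize p n -> c = x (ptime p n i)) ->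
    `|G u x - G (ptime p n i) (kpath p x n (ptime p n i) c)| < e.
Proof.
move=> lG Iu /andP[u0 uT] e0.
have cx : cadlag U u x by apply: cadlag_sub KU _; exact: cadlagK_x.
have [d d0 Hd] := lG u x e Iu cx e0.
have d40 : 0 < d / 4 by rewrite divr_gt0.
have [eta eta0 [N HN]] := kpath_close p x_cont d40.
exists (Num.min (eta / 2) (d / 4)); first by rewrite lt_min d40 andbT divr_gt0.
exists N => n i c Nn ni; rewrite lerBlDl -lerBlDr => /andP[ui iu] cab Hc Hc'.
move: ui; rewrite le_min => /andP[ui1 ui2].
have -> : ptime p n i = u - (u - ptime p n i) by rewrite subKr.
have /andP[i0 iT] := ptime_itv ni.
apply: Hd; rewrite ?subKr.
- by rewrite subr_ge0 iu gerBl.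
- by apply: cadlag_sub KU _; exact: cadlagK_kpath.
- apply: (@dinfty_lt _ _ _ _ _ (d / 4)) => //; last by move: (d) d0 ui2 => z *; lra.
  move=> r ru; rewrite -[kpath _ _ _ _ _ _]/(stop (ptime p n i) _ r) stop_kpath//.
  apply: (HN n i u) => //; first by rewrite iu.
  by apply: le_lt_trans ui1 _; rewrite ltr_pdivrMr// ltr_pMr// ltr1n.
Qed.

Variable C : R.
Hypothesis F_bound : bounded_derivatives T F al be C.

Let C_ge0 : 0 <= C.
Proof.
have [H _ _ _] := F_bound; apply: le_trans (H 0 x _ _) => //.
  by rewrite lexx ltW.
by apply: cadlagK_x; exact: ltW.
Qed.

Let sig_cont : {within `[0, t], continuous (fun u => sigma (x u) ^+ 2)}.
Proof.
apply: (@within_continuous_comp _ _ _ _ x (fun a => sigma a ^+ 2)).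
  by move=> a _; apply: cvgM; exact: sigma_cont.
by apply: continuous_subspaceW x_cont; apply: subset_itvl; rewrite bnd_simp.
Qed.

Let ptime_ltT n i : (i < psize p n)%N -> 0 <= ptime p n i < T.
Proof.
move=> ni; have /andP[-> _] := ptime_itv (ltnW ni).
by have /andP[_] := ptime_itv ni; apply: lt_le_trans; exact: ptime_lt.
Qed.

Let mesh_lidx e : 0 < e -> exists N, forall n, (N <= n)%N -> t - e <= ptime p n (lidx p n t) <= t.
Proof.
move=> e0; have [N HN] := mesh_small p e0; exists N => n Nn.
rewrite ptime_lidx ?(ltW t_gt0)// andbT lerBlDl -lerBlDr; apply/ltW.
by apply: lidx_near => //; [rewrite ltW|exact: HN].
Qed.

Let terminal_cvg : (fun n => F (ptime p n (lidx p n t))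
   (kpath p x n (ptime p n (lidx p n t)) (x (ptime p n (lidx p n t))))) @ \oo --> F t x.
Proof.
have [[_ _ [lF _ _]] _] := F_C12b.
apply/cvg_seq_eps => e e0.
have tT : 0 <= t <= T by rewrite ltW.
have tI : `[0, T]%classic t by rewrite /= in_itv.
have [eta eta0 [N HN]] := left_continuous_kpath lF tI tT e0.
have [N' HN'] := mesh_lidx eta0.
exists (maxn N N') => n; rewrite geq_max => /andP[Nn Nn'].
apply: HN => //; [exact: lidx_le|exact: HN'|apply/x_K'/lidx_le|].
by rewrite subrr normr0.
Qed.

Let horizontal_cvg :
  [/\ measurable_fun `[0, t[ (fun u => hderiv F u x),
   forall u, 0 <= u < t -> `|hderiv F u x| <= C &
   (fun n => \int[mu]_(u in `[0, ptime p n (lidx p n t)[) hderiv F u (kpath p x n T (x T)))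
     @ \oo --> \int[mu]_(u in `[0, t[) hderiv F u x].
Proof.
have [th [_ Hexp]] := functional_expansion.
have [_ HC _ _] := F_bound.
pose tn n := ptime p n (lidx p n t).
have tnt n : tn n <= t by apply: ptime_lidx; exact: ltW.
have uT u : 0 <= u < t -> 0 <= u < T.
  by move=> /andP[-> ut]; exact: lt_le_trans t_le.
have bC u : 0 <= u < t -> `|hderiv F u x| <= C.
  move=> ut; apply: HC; first exact: uT.
  by apply: cadlagK_x; have /andP[_ /ltW] := uT _ ut.
pose Dn n := (fun u => hderiv F u (kpath p x n T (x T))) \_ `[0, tn n[.
have bD n u : `[0, t[%classic u -> `|Dn n u| <= C.
  rewrite /= in_itv/= => ut; rewrite /Dn /restrict/=; case: ifPn => _; last by rewrite normr0.
  apply: HC; first exact: uT.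
  by apply: cadlagK_kpathT; rewrite ltW//; have /andP[_] := uT _ ut.
have [|||||mH _ H] := @bounded_convergence _ _ R mu `[0, t[ Dn (fun u => hderiv F u x) C.
- by [].
- exact: lebesgue_itvco_lty.
- move=> n; apply/measurable_restrict => //.
  apply: measurable_funS (Hexp n (lidx p n t) (lidx_le p n t)).1 => //.
- exact: bD.
- move=> u; rewrite /= in_itv/= => /andP[u0 ut].
  apply: cvg_trans (kpathT_cvg (uT _ (introT andP (conj u0 ut)))).
  have [N HN] : exists N, forall n, (N <= n)%N -> u < tn n.
    have tu : 0 < (t - u) / 2 by rewrite divr_gt0// subr_gt0.
    have [N HN] := mesh_lidx tu; exists N => n /HN /andP[+ _].
    by apply: lt_le_trans; move: ut; move: (t) (u) => a b ab; lra.
  apply: near_eq_cvg; exists N => // n /= /HN un.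
  by rewrite /Dn /restrict mem_set//= in_itv/= u0.
split => //; apply: cvg_trans H; apply: near_eq_cvg; near=> n.
rewrite /Dn -Rintegral_mkcondr; congr (Rintegral _ _ _).
by apply/setIidr; apply: subset_itvl; rewrite bnd_simp.
Unshelve. all: by end_near. Qed.

Let phi_bound (th : nat -> nat -> R) :
  (forall n i, (i < psize p n)%N -> al <= th n i <= be) ->
  forall n i, (i < psize p n)%N ->
  `|vderiv (vderiv F) (ptime p n i) (kpath p x n (ptime p n i) (th n i))| <= C.
Proof.
move=> Hth n i ni; have [_ _ _ HC] := F_bound.
have iT := ptime_ltT ni; apply: HC => //.
by apply: cadlagK_kpath; [exact: ltnW|rewrite ltW//; case/andP: iT|exact: Hth].
Qed.

(** The weights of the second-order terms satisfy the left-convergence required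
    by [weighted_qv_cvg]. *)
Let phi_cvg (th : nat -> nat -> R) :
  (forall n i, (i < psize p n)%N -> al <= th n i <= be /\
     `|x (ptime p n i) - th n i| <= `|x (ptime p n i) - x (ptime p n i.+1)|) ->
  forall u e : R, 0 < u < t -> 0 < e ->
    exists2 d : R, 0 < d & exists N, forall n i, (N <= n)%N -> (i < psize p n)%N ->
    u - d <= ptime p n i <= u -> `|vderiv (vderiv F) u x -
      vderiv (vderiv F) (ptime p n i) (kpath p x n (ptime p n i) (th n i))| < e.
Proof.
move=> Hth u e /andP[u0 ut] e0; have [[_ _ [_ _ lF]] _] := F_C12b.
have uI : `[0, T[%classic u by rewrite /= in_itv/= ltW//= (lt_le_trans ut).
have uT : 0 <= u <= T by rewrite ltW//= (le_trans (ltW ut)).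
have [eta eta0 [N HN]] := left_continuous_kpath lF uI uT e0.
exists eta => //; exists N => n i Nn ni ui; have [h1 h2] := Hth n i ni.
apply: HN => //; first exact: ltnW.
by move=> ein; move: ni; rewrite ein ltnn.
Qed.

Let drift_second : measurable_fun `]0, t[
   (fun u => vderiv (vderiv F) u x * sigma (x u) ^+ 2).
Proof.
have [th [Hth _]] := functional_expansion.
by have [] := block_step_cvg t_gt0 t_le (phi_bound (fun n i ni => (Hth n i ni).1))
  (phi_cvg Hth) C_ge0 sig_cont.
Qed.

Lemma drift_integrands_measurable : measurable_fun `[0, t[ (fun u => hderiv F u x) /\
  measurable_fun `]0, t[ (fun u => vderiv (vderiv F) u x * sigma (x u) ^+ 2).
Proof. by have [mH _ _] := horizontal_cvg; split; [|exact: drift_second]. Qed.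

(** The Lipschitz constant depends on the path only through a segment that
    contains its values. *)
Lemma ito_drift_lipschitz G s s' : (forall u, 0 <= u <= t -> sigma (x u) ^+ 2 <= G) ->
  0 <= s -> s <= s' -> s' <= t ->
  `|ito_drift x s' - ito_drift x s| <= (C + C * G) * (s' - s).
Proof.
move=> HG s0 ss' s't; have [mH bH _] := horizontal_cvg.
have iH : mu.-integrable `[0, t[ (EFin \o (fun u => hderiv F u x)).
  apply: (@bounded_integrable _ _ _ _ _ _ C) => //; first exact: lebesgue_itvco_lty.
have G0 : 0 <= G by apply: le_trans (sqr_ge0 _) (HG 0 _); rewrite lexx ltW.
have bS u : 0 <= u < t -> `|vderiv (vderiv F) u x * sigma (x u) ^+ 2| <= C * G.
  move=> /andP[u0 ut]; rewrite normrM ler_pM//; last first.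
    by rewrite ger0_norm ?sqr_ge0//; apply: HG; rewrite u0 ltW.
  have [_ _ _ HC] := F_bound; apply: HC; first by rewrite u0 (lt_le_trans ut).
  by apply: cadlagK_x; rewrite (le_trans (ltW ut)).
have iS : mu.-integrable `[0, t[ (EFin \o (fun u => vderiv (vderiv F) u x * sigma (x u) ^+ 2)).
  apply: (@bounded_integrable _ _ _ _ _ _ (C * G)) => //; first exact: lebesgue_itvco_lty.
  exact/measurable_fun_itv_obnd_cbndP.
have oc r : 0 <= r -> r <= t ->
    \int[mu]_(u in `]0, r[) (vderiv (vderiv F) u x * sigma (x u) ^+ 2) =
    \int[mu]_(u in `[0, r[) (vderiv (vderiv F) u x * sigma (x u) ^+ 2).
  move=> r0 rt; apply: Rintegral_itv_obnd_cbnd; apply: integrableS iS => //.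
  by apply: subset_itv; rewrite bnd_simp.
have L1 := Rintegral_co_lipschitz iH bH s0 ss' s't.
have L2 := Rintegral_co_lipschitz iS bS s0 ss' s't.
rewrite /ito_drift !oc//; [|exact: le_trans s't|exact: le_trans ss'].
move: L1 L2; set I1 := Rintegral _ _ _; set I2 := Rintegral _ _ _.
set I3 := Rintegral _ _ _; set I4 := Rintegral _ _ _ => L1 L2.
have -> : I1 + 2^-1 * I3 - (I2 + 2^-1 * I4) = (I1 - I2) + 2^-1 * (I3 - I4) by ring.
apply: le_trans (ler_normD _ _) _; rewrite mulrDl; apply: lerD => //.
rewrite normrM ger0_norm ?invr_ge0//; apply: le_trans L2.
by rewrite ler_piMl// invf_le1 ?ler1n.
Qed.

Hypothesis qv_cvg : forall q : rat, 0 <= q <= 1 ->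
  qv_sum p x (ratr q * t) @ \oo -->
  \int[mu]_(u in `[0, ratr q * t]) (sigma (x u) ^+ 2).

(** Unlike the Föllmer sums, these sums evaluate the integrand at index 0 on a
    path that starts at [x 0]; no value of [x] after the current time enters, so
    they are martingale transforms when [x] is the path of a martingale. *)
Lemma nonanticipating_sum_cvg :
  (fun n => \sum_(0 <= i < lidx p n t) xi n i * dx n i) @ \oo -->
  F t x - F 0 x - ito_drift x t.
Proof.
have [th [Hth Hexp]] := functional_expansion.
have [_ _ H1] := horizontal_cvg.
have H2 := weighted_qv_cvg t_gt0 t_le sig_cont qv_cvg C_ge0
  (phi_bound (fun n i ni => (Hth n i ni).1)) (phi_cvg Hth).
have H3 : (fun n => 2^-1 * (\sum_(0 <= i < lidx p n t)
    vderiv (vderiv F) (ptime p n i) (kpath p x n (ptime p n i) (th n i)) * dx n i ^+ 2))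
    @ \oo --> 2^-1 * \int[mu]_(u in `]0, t[) (vderiv (vderiv F) u x * sigma (x u) ^+ 2).
  by apply: cvgMr.
rewrite (_ : (fun n => _) = (fun n => F (ptime p n (lidx p n t))
   (kpath p x n (ptime p n (lidx p n t)) (x (ptime p n (lidx p n t)))) - F 0 x -
   (\int[mu]_(u in `[0, ptime p n (lidx p n t)[) hderiv F u (kpath p x n T (x T)) +
   2^-1 * (\sum_(0 <= i < lidx p n t)
    vderiv (vderiv F) (ptime p n i) (kpath p x n (ptime p n i) (th n i)) * dx n i ^+ 2)))).
  apply: cvgB; last exact: cvgD.
  by apply: cvgB => //; exact: cvg_cst.
apply/funext => n; have [_ E] := Hexp n (lidx p n t) (lidx_le p n t).
have E2 : \sum_(0 <= i < lidx p n t) 2^-1 *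
    vderiv (vderiv F) (ptime p n i) (kpath p x n (ptime p n i) (th n i)) * dx n i ^+ 2 =
  2^-1 * (\sum_(0 <= i < lidx p n t)
    vderiv (vderiv F) (ptime p n i) (kpath p x n (ptime p n i) (th n i)) * dx n i ^+ 2).
  by rewrite mulr_sumr; apply: eq_bigr => i _; rewrite -[LHS]mulrA.
rewrite E E2; set s1 := \sum_(_ <= _ < _) _; set s2 := \sum_(_ <= _ < _) _.
by ring.
Qed.

(** Only the first summand differs from that of the previous sums: there the
    derivative is evaluated on a path that starts at the value of the second
    partition point.  It vanishes in the limit because the derivative is bounded
    and the path continuous. *)
Lemma follmer_sum_cvg :
  follmer_sum p (vderiv F) x t @ \oo --> F t x - F 0 x - ito_drift x t.
Proof.
have HS := nonanticipating_sum_cvg.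
have H0 : (fun n => dx n 0) @ \oo --> (0 : R).
  apply/cvg_seq_eps => e e0; have [eta eta0 H] := unif_cont_itv x_cont e0.
  have [N HN] := mesh_small p eta0; exists N => n Nn.
  have n0 : (0 < psize p n)%N.
    rewrite lt0n; apply/eqP => n0; have := ptime_last p n.
    by rewrite n0 ptime_first => T0; move: T_gt0; rewrite -T0 ltxx.
  rewrite sub0r normrN; apply: H; try exact: ptime_itv.
  by rewrite gtr0_norm ?subr_gt0 ?ptime_lt//; exact: HN.
apply/cvg_seq_eps => e e0.
have e20 : 0 < e / 2 by rewrite divr_gt0.
have C2 : 0 < C *+ 2 + 1 by rewrite ltr_wpDl// mulrn_wge0.
have [N1 HN1] := (cvg_seq_eps _ _).1 HS _ e20.
have [N2 HN2] := (cvg_seq_eps _ _).1 H0 _ (divr_gt0 e20 C2).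
exists (maxn N1 N2) => n; rewrite geq_max => /andP[/HN1 h1 /HN2].
rewrite sub0r normrN ltr_pdivlMr// => h2.
set l := _ - ito_drift x t in h1 *; set S := \sum_(_ <= _ < _) _ in h1.
have -> : l - follmer_sum p (vderiv F) x t n = (l - S) - (follmer_sum p (vderiv F) x t n - S) by ring.
rewrite (splitr e); apply: le_lt_trans (ler_normB _ _) _; apply: ltr_leD => //.
rewrite /follmer_sum (sum_lidx p n t (fun i => vderiv F (ptime p n i)
  (left_path (ptime p n i) (step_path p x n)) * dx n i)).
rewrite /S -sumrB; case E : (lidx p n t) => [|k].
  by rewrite big_nil normr0 ltW.
have n0 : (0 < psize p n)%N by apply: leq_trans (lidx_le p n t); rewrite E.
rewrite big_ltn// big_nat_cond big1 ?addr0; last first.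
  move=> [|i] // /andP[/andP[_ ik] _]; rewrite left_path_step ?subrr//.
  by apply: leq_trans (lidx_le p n t); rewrite E (leq_trans _ ik)//.
rewrite -mulrBl normrM mulrC; apply/ltW; apply: le_lt_trans h2.
rewrite ler_wpM2l//.
have [_ _ HC _] := F_bound.
have H1 : `|vderiv F (ptime p n 0) (left_path (ptime p n 0) (step_path p x n))| <= C.
  apply: HC; first exact: ptime_ltT.
  rewrite ptime_first; split.
  - move=> u /le_anti <-; rewrite /left_path ltxx /= in_itv/= (step_pathE _ n0).
      exact: x_K'.
    by rewrite ptime_first lexx/= -{1}(ptime_first p n) ptime_lt.
  - by move=> u /andP[h h']; have := le_lt_trans h h'; rewrite ltxx.
  - by move=> u /andP[h h']; have := lt_le_trans h h'; rewrite ltxx.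
have H2 : `|xi n 0| <= C.
  apply: HC; first exact: ptime_ltT.
  apply: cadlagK_kpath => //; first by have /andP[_] := ptime_itv (leq0n (psize p n)).
  exact: x_K'.
apply: le_trans (ler_normB _ _) _.
by apply: le_trans (lerD H1 H2) _; rewrite mulr2n lerDl.
Qed.

(** Each term of the expansion is bounded, the second-order one by the
    quadratic variation sum, which eventually exceeds its limit by at most 1. *)
Lemma compensated_functional_bound G :
  (forall u, 0 <= u <= t -> sigma (x u) ^+ 2 <= G) ->
  exists N, forall n j, (N <= n)%N -> (j <= lidx p n t)%N ->
  `|F (ptime p n j) x - F 0 x - \sum_(0 <= i < j) xi n i * dx n i| <=
  C *+ 2 + C * T + C * (G * T + 1).
Proof.
move=> HG; have [th [Hth Hexp]] := functional_expansion.
have q1 : 0 <= (1 : rat) <= 1 by rewrite ler01 lexx.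
have Hq := qv_cvg q1; rewrite rmorph1 mul1r in Hq.
have [N HN] := (cvg_seq_eps _ _).1 Hq _ ltr01.
exists N => n j /HN Hn jl.
have jn : (j <= psize p n)%N by apply: leq_trans jl (lidx_le _ _ _).
have tj := ptime_itv jn; have /andP[tj0 tjT] := tj.
have [HF HD _ _] := F_bound.
have G0 : 0 <= G by apply: le_trans (sqr_ge0 _) (HG 0 _); rewrite lexx ltW.
have qvb : \sum_(0 <= i < j) dx n i ^+ 2 <= G * T + 1.
  apply: le_trans (_ : qv_sum p x t n <= _).
    rewrite /qv_sum (sum_lidx p n t (fun i => dx n i ^+ 2)).
    by rewrite (big_cat_nat (leq0n _) jl)//= lerDl sumr_ge0// => i _; exact: sqr_ge0.
  move: Hn; rewrite ltr_distl => /andP[+ _]; rewrite ltrBlDr => /ltW Hn.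
  apply: le_trans Hn _; rewrite lerD2r; apply: le_trans (ler_norm _) _.
  apply: le_trans (@Rintegral_norm_le R `[0, t] _ G _ _ _ _) _ => //.
  - exact: lebesgue_itvcc_lty.
  - by apply: cont_integrable_cc.
  - by move=> u; rewrite /= in_itv/= => ut; rewrite ger0_norm ?sqr_ge0// HG.
  - rewrite lebesgue_measure_itv/= lte_fin t_gt0/= subr0.
    by rewrite ler_wpM2l.
have [mD E] := Hexp n j jn.
have Db : `|\int[mu]_(u in `[0, ptime p n j[) hderiv F u (kpath p x n T (x T))| <= C * T.
  have bD : forall u, `[0, ptime p n j[%classic u -> `|hderiv F u (kpath p x n T (x T))| <= C.
    move=> u; rewrite /= in_itv/= => /andP[u0 ut]; apply: HD; first by rewrite u0 (lt_le_trans ut).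
    by apply: cadlagK_kpathT; rewrite ltW// (lt_le_trans ut).
  apply: le_trans (@Rintegral_norm_le R `[0, ptime p n j[ _ C _ _ _ bD) _ => //.
  - exact: lebesgue_itvco_lty.
  - by apply: (@bounded_integrable _ _ _ _ _ _ C) => //; exact: lebesgue_itvco_lty.
  - rewrite ler_wpM2l// lebesgue_measure_itv/= lte_fin; case: ltP => _ /=; rewrite ?subr0//.
    exact: ltW.
have Sb : `|\sum_(0 <= i < j) 2^-1 *
   vderiv (vderiv F) (ptime p n i) (kpath p x n (ptime p n i) (th n i)) * dx n i ^+ 2|
   <= C * (G * T + 1).
  apply: le_trans (ler_norm_sum _ _ _) _.
  apply: le_trans (_ : \sum_(0 <= i < j) C * dx n i ^+ 2 <= _); last first.
    by rewrite -mulr_sumr ler_wpM2l.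
  apply: ler_sum_nat => i /andP[_ ij].
  rewrite normrM [X in _ * X <= _]ger0_norm ?sqr_ge0// ler_wpM2r ?sqr_ge0//.
  have b := phi_bound (fun n i ni => (Hth n i ni).1) (leq_trans ij jn).
  rewrite normrM ger0_norm ?invr_ge0//; apply: le_trans b.
  by rewrite ler_piMl// invf_le1 ?ler1n.
have b1 : `|F (ptime p n j) x| <= C by apply: HF => //; exact: cadlagK_x.
have b2 : `|F (ptime p n j) (kpath p x n (ptime p n j) (x (ptime p n j)))| <= C.
  by apply: HF => //; apply: cadlagK_kpath => //; exact: x_K'.
move: E b2 Db Sb; set a := F _ (kpath _ _ _ _ _); set I := Rintegral _ _ _.
set s1 := \sum_(_ <= _ < _) _; set s2 := \sum_(_ <= _ < _) _ => E b2 Db Sb.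
have -> : F (ptime p n j) x - F 0 x - s1 = F (ptime p n j) x - a + I + s2.
  by rewrite E; ring.
apply: le_trans (ler_normD _ _) _; apply: lerD => //.
apply: le_trans (ler_normD _ _) _; apply: lerD => //.
by apply: le_trans (ler_normB _ _) _; rewrite mulr2n; apply: lerD.
Qed.

End SegmentPaths.

(** * Sub-sigma-algebras and expectations *)

Section SubSigmaAlgebra.
Context {R : realType} {d : measure_display} {Omega : measurableType d}.
Implicit Types (G : set (set Omega)) (h k : Omega -> R).

Lemma measurable_wrtP G h : sigma_algebra setT G ->
  measurable_wrt G h <-> measurable_fun setT (h : g_sigma_algebraType G -> R).
Proof.
move=> sG; split.
  move=> H _ B mB; rewrite setTI; rewrite /measurable/=.
  by apply: sub_sigma_algebra; apply: H; exists B => //; rewrite setTI.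
move=> H _ [B mB <-]; have := H measurableT B mB.
by rewrite /measurable/= sigma_algebra_id.
Qed.

Lemma sigma_measurable G (A : set Omega) : sigma_algebra setT G ->
  G A <-> measurable (A : set (g_sigma_algebraType G)).
Proof. by move=> sG; rewrite /measurable/= sigma_algebra_id. Qed.

Lemma measurable_wrt_sub G G' h : G `<=` G' -> measurable_wrt G h -> measurable_wrt G' h.
Proof. by move=> GG' H A /H /GG'. Qed.

Lemma measurable_wrt_measurable_fun G h : G `<=` measurable ->
  measurable_wrt G h -> measurable_fun setT h.
Proof. by move=> Gm H _ B mB; apply/Gm/H; exists B. Qed.

Variable G : set (set Omega).
Hypothesis sG : sigma_algebra setT G.

Lemma measurable_wrt_cst (c : R) : measurable_wrt G (fun=> c).
Proof. by apply/measurable_wrtP. Qed.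

Lemma measurable_wrtD h k : measurable_wrt G h -> measurable_wrt G k ->
  measurable_wrt G (fun w => h w + k w).
Proof.
move=> /(measurable_wrtP h sG) mh /(measurable_wrtP k sG) mk.
by apply/measurable_wrtP => //; exact: measurable_funD.
Qed.

Lemma measurable_wrtB h k : measurable_wrt G h -> measurable_wrt G k ->
  measurable_wrt G (fun w => h w - k w).
Proof.
move=> /(measurable_wrtP h sG) mh /(measurable_wrtP k sG) mk.
by apply/measurable_wrtP => //; exact: measurable_funB.
Qed.

Lemma measurable_wrtM h k : measurable_wrt G h -> measurable_wrt G k ->
  measurable_wrt G (fun w => h w * k w).
Proof.
move=> /(measurable_wrtP h sG) mh /(measurable_wrtP k sG) mk.
by apply/measurable_wrtP => //; exact: measurable_funM.
Qed.

Lemma measurable_wrt_indic A : G A -> measurable_wrt G (\1_A : Omega -> R).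
Proof. by move=> GA; apply/measurable_wrtP => //; apply: measurable_indic; exact/(sigma_measurable _ sG). Qed.

Lemma measurable_wrt_comp (g : R -> R) h : continuous g -> measurable_wrt G h ->
  measurable_wrt G (fun w => g (h w)).
Proof.
move=> cg /(measurable_wrtP h sG) mh; apply/measurable_wrtP => //.
by apply: measurableT_comp => //; exact: continuous_measurable_fun.
Qed.

Lemma measurable_wrt_sum n (h : nat -> Omega -> R) :
  (forall i, (i < n)%N -> measurable_wrt G (h i)) ->
  measurable_wrt G (fun w => \sum_(0 <= i < n) h i w).
Proof.
elim: n => [|n IH] H.
  by under [X in measurable_wrt _ X]eq_fun do rewrite big_nil; exact: measurable_wrt_cst.
under [X in measurable_wrt _ X]eq_fun do rewrite big_nat_recr//=.
by apply: measurable_wrtD; [apply: IH => i ni; apply: H; exact: leqW|exact: H].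
Qed.

Lemma measurable_wrt_le h (c : R) : measurable_wrt G h -> G [set w | h w <= c].
Proof.
move=> mh; apply: mh; exists `]-oo, c]%classic => //.
by rewrite setTI; apply/seteqP; split => w; rewrite /= in_itv.
Qed.

Lemma measurable_wrt_gt h (c : R) : measurable_wrt G h -> G [set w | c < h w].
Proof.
move=> mh; apply: mh; exists `]c, +oo[%classic => //.
by rewrite setTI; apply/seteqP; split => w; rewrite /= in_itv/= andbT.
Qed.

Lemma measurable_wrt_itv h (a b : R) : measurable_wrt G h -> G [set w | a <= h w <= b].
Proof. by move=> mh; apply: mh; exists `[a, b]%classic => //; rewrite setTI. Qed.

Lemma sigma_setT : G setT.
Proof. by case: sG => G0 GC _; rewrite -(setD0 setT); exact: GC. Qed.

Lemma sigma_bigcap (J : countType) (A : J -> set Omega) :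
  (forall i, G (A i)) -> G (\bigcap_i A i).
Proof.
move=> H; pose B n := if unpickle n is Some i then A i else setT.
have -> : \bigcap_i A i = \bigcap_n B n.
  apply/seteqP; split => w AB n _; last by have := AB (pickle n) I; rewrite /B pickleK.
  by rewrite /B; case: unpickle => // i; exact: AB.
apply/(sigma_measurable _ sG); apply: bigcap_measurableType => n _.
by apply/(sigma_measurable _ sG); rewrite /B; case: unpickle => //; exact: sigma_setT.
Qed.

Lemma sigma_setI A B : G A -> G B -> G (A `&` B).
Proof.
by move=> /(sigma_measurable _ sG) mA /(sigma_measurable _ sG) mB;
   apply/(sigma_measurable _ sG); exact: measurableI.
Qed.

Lemma sigma_setD A B : G A -> G B -> G (A `\` B).
Proof.
by move=> /(sigma_measurable _ sG) mA /(sigma_measurable _ sG) mB;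
   apply/(sigma_measurable _ sG); exact: measurableD.
Qed.

End SubSigmaAlgebra.

Lemma nonneg_simple_approx (R : realType) (d : measure_display) (T : measurableType d)
    (y : T -> R) : measurable_fun setT y -> (forall w, 0 <= y w) ->
  exists (N : nat -> nat) (c : nat -> nat -> R) (A : nat -> nat -> set T),
  [/\ forall n i, measurable (A n i),
      forall w, (fun n => \sum_(0 <= i < N n) c n i * \1_(A n i) w) @ \oo --> y w &
      forall n w, `|\sum_(0 <= i < N n) c n i * \1_(A n i) w| <= y w].
Proof.
move=> my y0.
have mye : measurable_fun setT (EFin \o y) by apply/measurable_EFinP.
pose s n : {nnsfun T >-> R} := nnsfun_approx measurableT mye n.
pose v n : seq R := finmap.enum_fset (fset_set (range (s n))).
exists (fun n => size (v n)), (fun n i => (v n)`_i), (fun n i => s n @^-1` [set (v n)`_i]).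
have sE n w : \sum_(0 <= i < size (v n)) (v n)`_i * \1_(s n @^-1` [set (v n)`_i]) w = s n w.
  by rewrite [RHS]fimfunEord big_mkord.
have sy w : (fun n => s n w) @ \oo --> y w.
  have h0 z : setT z -> (0 <= (EFin \o y) z)%E by move=> _; rewrite lee_fin.
  have := cvg_nnsfun_approx measurableT mye h0 (x := w) I.
  by move=> /fine_cvgP[_].
split.
- by move=> n i; exact: measurable_sfunP.
- by move=> w; under eq_fun do rewrite sE; exact: sy.
- move=> n w; rewrite sE ger0_norm//.
  have nd : nondecreasing_seq (fun n => s n w).
    by move=> i j ij; have /(_ _ _ ij)/lefP := nd_nnsfun_approx measurableT mye; exact.
  by rewrite -(cvg_lim _ (sy w))//; apply: nondecreasing_cvgn_le => //; apply/cvg_ex; exists (y w).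
Qed.

Section Expectation.
Context {R : realType} {d : measure_display} {Omega : measurableType d}.
Variable P : probability Omega R.
Implicit Types (G : set (set Omega)) (f g h : Omega -> R) (A B : set Omega).

Local Notation Int f := (P.-integrable setT (EFin \o f)).

Lemma P_lty : (P setT < +oo)%E.
Proof. by rewrite probability_setT ltry. Qed.

Lemma Int_bounded f (C : R) : measurable_fun setT f -> (forall w, `|f w| <= C) -> Int f.
Proof. by move=> mf fC; apply: (@bounded_integrable _ _ _ _ _ _ C) => //; exact: P_lty. Qed.

Lemma Int_cst (c : R) : Int (fun=> c).
Proof. by apply: (@Int_bounded _ `|c|). Qed.

Lemma Int_measurable f : Int f -> measurable_fun setT f.
Proof. by move=> /measurable_int/measurable_EFinP. Qed.

Lemma Int_mul f g (C : R) : Int f -> measurable_fun setT g -> (forall w, `|g w| <= C) ->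
  Int (fun w => g w * f w).
Proof.
move=> If mg gC; apply: (@le_integrable _ _ _ P setT _ _ (EFin \o (fun w => C * f w))) => //.
- apply/measurable_EFinP; apply: measurable_funM => //; exact: Int_measurable.
- move=> w _; rewrite /= lee_fin !normrM ler_wpM2r// (le_trans (gC w))// ler_norm//.
- exact: integrable_scale.
Qed.

Lemma Int_indic f A : Int f -> measurable A -> Int (fun w => \1_A w * f w).
Proof.
move=> If mA; apply: (@Int_mul _ _ 1) => // w.
by rewrite indicE; case: (_ \in _); rewrite ?normr0 ?normr1.
Qed.

Lemma Int_sum n (h : nat -> Omega -> R) : (forall i, (i < n)%N -> Int (h i)) ->
  Int (fun w => \sum_(0 <= i < n) h i w).
Proof.
elim: n => [|n IH] H.
  by under [X in EFin \o X]eq_fun do rewrite big_nil; exact: Int_cst.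
under [X in EFin \o X]eq_fun do rewrite big_nat_recr//=.
by apply: integrable_add => //; [apply: IH => i ni; apply: H; exact: leqW|exact: H].
Qed.

Lemma Ex_sum n (h : nat -> Omega -> R) : (forall i, (i < n)%N -> Int (h i)) ->
  \int[P]_w (\sum_(0 <= i < n) h i w) = \sum_(0 <= i < n) \int[P]_w h i w.
Proof.
elim: n => [|n IH] H.
  by under eq_Rintegral do rewrite big_nil; rewrite Rintegral_cst// mul0r big_nil.
under eq_Rintegral do rewrite big_nat_recr//=.
rewrite RintegralD// ?big_nat_recr//=.
- by rewrite IH// => i ni; apply: H; exact: leqW.
- by apply: Int_sum => i ni; apply: H; exact: leqW.
- exact: H.
Qed.

Lemma Ex_le f g : Int f -> Int g -> (forall w, f w <= g w) -> \int[P]_w f w <= \int[P]_w g w.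
Proof. by move=> If Ig fg; apply: le_Rintegral. Qed.

Lemma Ex_cst (c : R) : \int[P]_w c = c.
Proof.
rewrite Rintegral_cst//; transitivity (c * fine 1%E); last by rewrite mulr1.
by congr (_ * fine _); exact: probability_setT.
Qed.

Lemma Ex_indic A : measurable A -> \int[P]_w (\1_A w : R) = fine (P A).
Proof. by move=> mA; rewrite /Rintegral integral_indic// setIT. Qed.

Lemma Ex_restrict A f : \int[P]_(w in A) f w = \int[P]_w (\1_A w * f w).
Proof.
rewrite Rintegral_mkcond; congr Rintegral; apply/funext => w.
by rewrite /restrict indicE; case: ifP; rewrite ?mul1r ?mul0r.
Qed.

Lemma Ex_dominated (f_ : nat -> Omega -> R) f g :
  (forall n, measurable_fun setT (f_ n)) -> Int g ->
  (forall n w, `|f_ n w| <= g w) -> (forall w, f_ ^~ w @ \oo --> f w) ->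
  Int f /\ (fun n => \int[P]_w f_ n w) @ \oo --> \int[P]_w f w.
Proof.
move=> mf_ Ig fg ff.
have mf : measurable_fun setT f by apply: (measurable_fun_cvg mf_) => w _; exact: ff.
have [||||| iF _ H] := @dominated_convergence _ Omega R P setT measurableT
   (fun n => EFin \o f_ n) (EFin \o f) (EFin \o g).
- by move=> n; apply/measurable_EFinP.
- by apply/measurable_EFinP.
- by apply: aeW => x _; apply: cvg_EFin; [exact: nearW|exact: ff].
- by [].
- by apply: aeW => x n _ /=; rewrite lee_fin fg.
split => //.
have := @fine_cvg R _ \oo _ (fun n => \int[P]_x (f_ n x)%:E)%E (\int[P]_x f x).
apply; rewrite /Rintegral fineK//.
exact: integrable_fin_num.
Qed.

(** Approximation of [z] by simple functions, by dominated convergence. *)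
Lemma Ex_orthogonal G (D z : Omega -> R) (C : R) : sigma_algebra setT G -> G `<=` measurable ->
  Int D -> (forall A, G A -> \int[P]_w (\1_A w * D w) = 0) ->
  measurable_wrt G z -> (forall w, `|z w| <= C) -> \int[P]_w (z w * D w) = 0.
Proof.
move=> sG Gm ID D0 mz zC.
have [w0 _] : exists w0 : Omega, True by exists point.
have C0 : 0 <= C by apply: le_trans (zC w0).
have ED : \int[P]_w D w = 0.
  rewrite -(D0 setT (sigma_setT sG)); apply: eq_Rintegral => w _.
  by rewrite indicE in_setT mul1r.
(* Shifting by [C] reduces to nonnegative variables. *)
pose y w := z w + C.
have my : measurable_wrt G y by apply: measurable_wrtD => //; exact: measurable_wrt_cst.
have y0 w : 0 <= y w <= C + C.
  by have := zC w; rewrite ler_norml => /andP[h1 h2]; apply/andP; split; rewrite /y; lra.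
have mz' := measurable_wrt_measurable_fun Gm mz.
have my' := measurable_wrt_measurable_fun Gm my.
have IyD : Int (fun w => y w * D w).
  by apply: (@Int_mul _ _ (C + C)) => // w; have /andP[h1 h2] := y0 w; rewrite ger0_norm.
suff Ey : \int[P]_w (y w * D w) = 0.
  have -> : \int[P]_w (z w * D w) = \int[P]_w (y w * D w - C * D w).
    by apply: eq_Rintegral => w _; rewrite /y; ring.
  rewrite RintegralB//; last exact: integrable_scale.
  by rewrite Ey RintegralZl// ED mulr0 subrr.
have myG : measurable_fun setT (EFin \o y : g_sigma_algebraType G -> \bar R).
  by apply/measurable_EFinP; exact/measurable_wrtP.
have [N [c [A [mA sy s_le]]]] := nonneg_simple_approx ((measurable_wrtP y sG).1 my)
  (fun w => (andP (y0 w)).1).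
pose s n w : R := \sum_(0 <= i < N n) c n i * \1_(A n i) w.
have GA n i : G (A n i) by apply/(sigma_measurable _ sG).
have sE n : \int[P]_w (s n w * D w) = 0.
  rewrite /s; under eq_Rintegral do rewrite mulr_suml.
  rewrite Ex_sum => [|i _]; last first.
    under [X in EFin \o X]eq_fun do rewrite -mulrA.
    by apply: integrable_scale => //; apply: Int_indic => //; apply/Gm.
  rewrite big1_seq// => i _; under eq_Rintegral do rewrite -mulrA.
  by rewrite RintegralZl ?D0 ?mulr0//; apply: Int_indic => //; apply/Gm.
have [|||w|_ H] := @Ex_dominated (fun n w => s n w * D w) (fun w => y w * D w) (fun w => y w * `|D w|).
- move=> n; apply: measurable_funM; last exact: Int_measurable.
  apply: (measurable_wrt_measurable_fun Gm); apply: measurable_wrt_sum => // i _.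
  by apply: measurable_wrtM => //; [exact: measurable_wrt_cst|exact: measurable_wrt_indic].
- apply: (@Int_mul _ _ (C + C)) => // [|w]; last by have /andP[h1 h2] := y0 w; rewrite ger0_norm.
  exact: integrable_norm.
- by move=> n w; rewrite normrM ler_wpM2r// s_le.
- by apply: cvgMl; exact: sy.
- have : (fun n => \int[P]_w (s n w * D w)) @ \oo --> (0 : R).
    by under eq_fun do rewrite sE; exact: cvg_cst.
  by move/(cvg_lim _) => <-//; apply/esym; apply: cvg_lim.
Qed.

End Expectation.

(** * Stopped discrete martingales *)

Section HuberBound.
Context {R : realType}.
Implicit Types (v u : R).

(** Smooth version of the absolute value: the second-order remainder of its
    expansion is at most quadratic for small increments and linear for large
    ones. *)
Definition sqabs v : R := Num.sqrt (1 + v ^+ 2).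

Lemma sqabs_sqr v : sqabs v ^+ 2 = 1 + v ^+ 2.
Proof. by rewrite sqr_sqrtr// addr_ge0 ?sqr_ge0. Qed.

Lemma sqabs_ge1 v : 1 <= sqabs v.
Proof. by rewrite -[X in X <= _]sqrtr1 ler_wsqrtr// lerDl sqr_ge0. Qed.

Lemma sqabs_gt0 v : 0 < sqabs v.
Proof. exact: lt_le_trans ltr01 (sqabs_ge1 v). Qed.

Lemma sqabs_ge v : `|v| <= sqabs v.
Proof.
by rewrite -ler_sqr ?nnegrE ?normr_ge0 ?(ltW (sqabs_gt0 v))// sqabs_sqr real_normK ?num_real// lerDr.
Qed.

Lemma sqabs_slope v : `|v / sqabs v| <= 1.
Proof.
rewrite normrM [X in _ * X]ger0_norm ?invr_ge0 ?(ltW (sqabs_gt0 v))//.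
by rewrite ler_pdivrMr ?sqabs_gt0// mul1r sqabs_ge.
Qed.

Lemma continuous_sqabs : continuous sqabs.
Proof.
move=> v; apply: continuous_comp; last exact: sqrt_continuous.
apply: cvgD; first exact: cvg_cst.
by apply: cvgM; exact: cvg_id.
Qed.

Lemma continuous_sqabs_slope : continuous (fun v => v / sqabs v).
Proof.
move=> v; apply: cvgM; first exact: cvg_id.
by apply: cvgV; [rewrite gt_eqF ?sqabs_gt0|exact: continuous_sqabs].
Qed.

Lemma sqabs_expand2 v u : sqabs (v + u) <= sqabs v + v / sqabs v * u + u ^+ 2 / 2.
Proof.
have s0 := sqabs_gt0 v; have s1 := sqabs_ge1 v; have sE := sqabs_sqr v.
set s := sqabs v in s0 s1 sE *.
have h1 : sqabs (v + u) <= s + (v * u *+ 2 + u ^+ 2) / (s *+ 2).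
  have pos : 0 <= s + (v * u *+ 2 + u ^+ 2) / (s *+ 2).
    have -> : s + (v * u *+ 2 + u ^+ 2) / (s *+ 2) = (2 + v ^+ 2 + (v + u) ^+ 2) / (s *+ 2).
      have -> : 2 + v ^+ 2 + (v + u) ^+ 2 = s ^+ 2 *+ 2 + (v * u *+ 2 + u ^+ 2).
        by rewrite sE; ring.
      by field; rewrite gt_eqF.
    by rewrite divr_ge0// ?mulrn_wge0 ?(ltW s0)// !addr_ge0 ?sqr_ge0.
  rewrite -ler_sqr ?nnegrE ?(ltW (sqabs_gt0 _))// sqabs_sqr.
  rewrite [X in _ <= X]sqrrD sE.
  have -> : s * ((v * u *+ 2 + u ^+ 2) / (s *+ 2)) *+ 2 = v * u *+ 2 + u ^+ 2.
    by field; rewrite gt_eqF.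
  rewrite -subr_ge0.
  have -> : forall z : R, 1 + v ^+ 2 + (v * u *+ 2 + u ^+ 2) + z - (1 + (v + u) ^+ 2) = z by move=> z; ring.
  exact: sqr_ge0.
apply: le_trans h1 _; rewrite -[X in _ <= X]addrA lerD2l mulrDl.
have -> : v * u *+ 2 / (s *+ 2) = v / s * u by field; rewrite gt_eqF.
rewrite lerD2l ler_wpM2l ?sqr_ge0// lef_pV2 ?posrE ?mulrn_wgt0//.
by rewrite lerMn2r s1 orbT.
Qed.

Lemma sqabs_lip v u : sqabs (v + u) <= sqabs v + `|u|.
Proof.
have h0 : 0 <= sqabs v + `|u| by rewrite addr_ge0// ltW// sqabs_gt0.
rewrite -(@ler_sqr _ (sqabs (v + u)) (sqabs v + `|u|)) ?nnegrE//; last first.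
  by rewrite ltW// sqabs_gt0.
rewrite sqabs_sqr [X in _ <= X]sqrrD sqabs_sqr.
rewrite real_normK ?num_real//.
have h : v * u <= sqabs v * `|u|.
  by apply: le_trans (ler_norm _) _; rewrite normrM ler_wpM2r// sqabs_ge.
rewrite sqrrD -subr_ge0.
have -> : 1 + v ^+ 2 + sqabs v * `|u| *+ 2 + u ^+ 2 - (1 + (v ^+ 2 + v * u *+ 2 + u ^+ 2)) =
  (sqabs v * `|u| - v * u) *+ 2 by ring.
by rewrite mulrn_wge0// subr_ge0.
Qed.

Lemma sqabs_expand1 v u : sqabs (v + u) <= sqabs v + v / sqabs v * u + `|u| *+ 2.
Proof.
apply: le_trans (sqabs_lip v u) _; rewrite -addrA lerD2l mulr2n addrA lerDr.
rewrite addrC -lerBlDr sub0r; apply: le_trans (_ : `|v / sqabs v * u| <= _).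
  by rewrite -normrN ler_norm.
by rewrite normrM ler_piMl// sqabs_slope.
Qed.

End HuberBound.

Lemma Int_sqabs {R : realType} {d : measure_display} {Omega : measurableType d}
    (P : probability Omega R) (S : Omega -> R) : P.-integrable setT (EFin \o S) ->
  P.-integrable setT (EFin \o (fun w => sqabs (S w))).
Proof.
move=> IS; apply: (@le_integrable _ _ _ P setT _ _ (EFin \o (fun w => 1 + `|S w|))) => //.
- apply/measurable_EFinP; apply: measurableT_comp (Int_measurable IS).
  exact: continuous_measurable_fun continuous_sqabs.
- move=> w _; rewrite /= lee_fin (ger0_norm (ltW (sqabs_gt0 _))) ger0_norm ?addr_ge0//.
  have := sqabs_lip 0 (S w); rewrite add0r /sqabs expr0n addr0 sqrtr1.
  exact.
- by apply: integrable_add => //; [exact: Int_cst|exact: integrable_norm].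
Qed.

Section StoppedMartingale.
Context {R : realType} {d : measure_display} {Omega : measurableType d}.
Variable P : probability Omega R.

Local Notation Int f := (P.-integrable setT (EFin \o f)).

(** [V] is the martingale to be stopped and [Q] controls its jumps; the stopped
    martingale is bounded except for the jump at the stopping index. *)
Variables (N : nat) (G : nat -> set (set Omega)) (V Q : nat -> Omega -> R).
Hypothesis G_sigma : forall i, (i <= N)%N -> sigma_algebra setT (G i) /\ G i `<=` measurable.
Hypothesis G_incr : forall i j, (i <= j)%N -> (j <= N)%N -> G i `<=` G j.
Hypothesis V0 : forall w, V 0 w = 0.
Hypothesis V_meas : forall i, (i <= N)%N -> measurable_wrt (G i) (V i) /\ Int (V i).
Hypothesis V_mart : forall i A, (i < N)%N -> G i A ->
  \int[P]_w (\1_A w * (V i.+1 w - V i w)) = 0.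
Hypothesis Q_meas : forall i, (i <= N)%N -> measurable_wrt (G i) (Q i) /\ Int (Q i).
Hypothesis Q_ge0 : forall i w, 0 <= Q i w.
Hypothesis VQ : forall i w, (i < N)%N -> `|V i.+1 w - V i w| <= Q i.+1 w + Q i w.
Variables (good : nat -> set Omega) (L : R).
Hypothesis good_meas : forall i, (i <= N)%N -> G i (good i).
Hypothesis L_ge0 : 0 <= L.
Hypothesis good_V : forall i w, good i w -> `|V i w| <= L.
Hypothesis good_Q : forall i w, good i w -> Q i w <= L.

Fixpoint good_upto i : set Omega :=
  if i is j.+1 then good_upto j `&` good i else good 0.

(** [V] stopped at the first index that is not good. *)
Definition stopped i w : R := \sum_(0 <= j < i) \1_(good_upto j) w * (V j.+1 w - V j w).

(** Value of [Q] at the stopping index, when it is positive and at most [i]. *)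
Definition overshoot i w : R :=
  \sum_(0 <= j < i) \1_(good_upto j `\` good j.+1) w * Q j.+1 w.

Let indic1 (A : set Omega) w : A w -> \1_A w = 1 :> R.
Proof. by move=> Aw; rewrite indicE mem_set. Qed.

Let indic0 (A : set Omega) w : ~ A w -> \1_A w = 0 :> R.
Proof. by move=> Aw; rewrite indicE memNset. Qed.

Lemma good_upto_le i j w : (i <= j)%N -> good_upto j w -> good_upto i w.
Proof.
elim: j => [|j IH]; first by rewrite leqn0 => /eqP ->.
by rewrite leq_eqVlt => /predU1P[->//|]; rewrite ltnS => /IH H [/H].
Qed.

Lemma good_upto_good i w : good_upto i w -> good i w.
Proof. by case: i => [//|i] []. Qed.

Lemma good_upto_meas i : (i <= N)%N -> G i (good_upto i).
Proof.
elim: i => [|i IH] iN; first exact: good_meas.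
apply: sigma_setI; first exact: (G_sigma iN).1.
  by apply: (G_incr (leqnSn i)) => //; apply: IH; exact: ltnW.
exact: good_meas.
Qed.

Lemma stopped_before i w : (forall j, (j < i)%N -> good_upto j w) -> stopped i w = V i w.
Proof.
elim: i => [|i IH] H; first by rewrite /stopped big_nil V0.
rewrite /stopped big_nat_recr//= -/(stopped i w) IH; last by move=> j ji; apply: H; exact: leqW.
by rewrite indic1 ?mul1r; [ring|exact: H].
Qed.

Lemma stopped_good i w : good_upto i w -> stopped i w = V i w.
Proof. by move=> Hi; apply: stopped_before => j ji; apply: good_upto_le Hi; exact: ltnW. Qed.

Lemma stopped_after i j w : (i <= j)%N -> ~ good_upto i w -> stopped j w = stopped i w.
Proof.
elim: j => [|j IH]; first by rewrite leqn0 => /eqP ->.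
rewrite leq_eqVlt => /predU1P[->//|]; rewrite ltnS => ij ni.
rewrite /stopped big_nat_recr//= -/(stopped j w) IH// indic0 ?mul0r ?addr0//.
by move=> /(good_upto_le ij).
Qed.

Lemma overshoot_incr i j w : (i <= j)%N -> overshoot i w <= overshoot j w.
Proof.
move=> ij; rewrite /overshoot (big_cat_nat (leq0n i) ij)//= lerDl sumr_ge0// => k _.
by rewrite mulr_ge0// indicE.
Qed.

Lemma stopped_bound i w : (i <= N)%N -> `|stopped i w| <= L *+ 2 + overshoot i w.
Proof.
elim: i => [|i IH] iN; first by rewrite /stopped /overshoot !big_nil normr0 addr0 mulrn_wge0.
have [gi|ni] := pselect (good_upto i w); last first.
  rewrite (stopped_after (leqnSn i) ni).
  by apply: le_trans (IH (ltnW iN)) _; rewrite lerD2l overshoot_incr.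
have Si : stopped i.+1 w = V i.+1 w.
  by apply: stopped_before => j; rewrite ltnS => ji; exact: good_upto_le gi.
have Oi : 0 <= overshoot i w.
  by rewrite /overshoot sumr_ge0// => k _; rewrite mulr_ge0// indicE.
rewrite Si; have [gs|ns] := pselect (good i.+1 w).
  apply: le_trans (good_V gs) _; rewrite mulr2n -addrA lerDl addr_ge0//.
  by apply: le_trans Oi _; exact: overshoot_incr.
rewrite /overshoot big_nat_recr//= -/(overshoot i w) indic1 ?mul1r//.
have -> : V i.+1 w = V i w + (V i.+1 w - V i w) by ring.
apply: le_trans (ler_normD _ _) _.
have h1 := good_V (good_upto_good gi); have h2 := VQ w iN.
have h3 := good_Q (good_upto_good gi).
by rewrite mulr2n; apply: le_trans (lerD h1 h2) _; lra.
Qed.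

Lemma stopped_int i : (i <= N)%N -> measurable_wrt (G i) (stopped i) /\ Int (stopped i).
Proof.
move=> iN; split.
  apply: measurable_wrt_sum => [|j ji]; first exact: (G_sigma iN).1.
  have sG := (G_sigma iN).1.
  have jN : (j < N)%N by apply: leq_trans iN.
  apply: measurable_wrtM => //; first apply: measurable_wrt_indic => //.
    by apply: (G_incr (ltnW ji)) => //; apply: good_upto_meas; exact: ltnW.
  apply: measurable_wrtB => //.
    by apply: measurable_wrt_sub (G_incr ji iN) (V_meas jN).1.
  by apply: measurable_wrt_sub (G_incr (ltnW ji) iN) (V_meas (ltnW jN)).1.
apply: Int_sum => j ji; have jN : (j < N)%N by apply: leq_trans iN.
apply: Int_indic; last by apply: (G_sigma (ltnW jN)).2; apply: good_upto_meas; exact: ltnW.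
by apply: integrable_sub => //; [exact: (V_meas jN).2|exact: (V_meas (ltnW jN)).2].
Qed.

Let over_meas j : (j < N)%N -> G j.+1 (good_upto j `\` good j.+1).
Proof.
move=> jN; apply: sigma_setD; first exact: (G_sigma jN).1.
  by apply: (G_incr (leqnSn j)) => //; apply: good_upto_meas; exact: ltnW.
exact: good_meas.
Qed.

Lemma overshoot_int : Int (overshoot N).
Proof.
apply: Int_sum => j jN; apply: Int_indic; first exact: (Q_meas jN).2.
by apply: (G_sigma jN).2; exact: over_meas.
Qed.

(** Optional stopping for the bounded slope factors. *)
Lemma stopped_orthogonal i j (z : Omega -> R) (C : R) : (i <= j)%N -> (j <= N)%N ->
  measurable_wrt (G i) z -> (forall w, `|z w| <= C) ->
  \int[P]_w (z w * (stopped j w - stopped i w)) = 0.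
Proof.
move=> ij jN mz zC.
have E w : z w * (stopped j w - stopped i w) =
    \sum_(0 <= k < j - i) (z w * \1_(good_upto (k + i)) w) * (V (k + i).+1 w - V (k + i)%N w).
  rewrite /stopped (big_cat_nat (leq0n i) ij)//= addrAC subrr add0r.
  by rewrite -{1}[i]add0n big_addn mulr_sumr; apply: eq_bigr => k _; rewrite mulrA.
under eq_Rintegral do rewrite E.
have mzi k : (k < j - i)%N -> measurable_wrt (G (k + i)%N) (fun w => z w * \1_(good_upto (k + i)) w) /\
   ((k + i < N)%N /\ forall w, `|z w * \1_(good_upto (k + i)) w| <= C).
  move=> kji; have kN : (k + i < N)%N by move: kji jN; lia.
  have sG := (G_sigma (ltnW kN)).1; split.
    apply: measurable_wrtM => //.
      by apply: measurable_wrt_sub (G_incr (leq_addl k i) (ltnW kN)) mz.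
    by apply: measurable_wrt_indic => //; apply: good_upto_meas; exact: ltnW.
  split=> // w; rewrite normrM [X in _ * X]ger0_norm ?indicE//; apply: le_trans (zC w).
  by rewrite ler_piMr// lern1 leq_b1.
have Vi k : (k < N)%N -> Int (fun w => V k.+1 w - V k w).
  by move=> kN; apply: integrable_sub => //; [exact: (V_meas kN).2|exact: (V_meas (ltnW kN)).2].
rewrite Ex_sum => [|k kji].
  rewrite big_nat_cond big1// => k /andP[/andP[_ kji] _].
  have [m1 [kN b1]] := mzi k kji.
  apply: (@Ex_orthogonal _ _ _ P (G (k + i)%N) _ _ C) => //.
  - exact: (G_sigma (ltnW kN)).1.
  - exact: (G_sigma (ltnW kN)).2.
  - exact: Vi.
  - by move=> A GA; exact: V_mart.
have [m1 [kN b1]] := mzi k kji.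
apply: (@Int_mul _ _ _ _ _ _ C) => //; first exact: Vi.
by apply: measurable_wrt_measurable_fun m1; exact: (G_sigma (ltnW kN)).2.
Qed.

(** A coarse grid of indices: a good index at the grid certifies that the
    increment over the grid interval before it is small. *)
Variables (m : nat) (b : nat -> nat) (eta : R).
Hypothesis b_mono : forall k, (b k <= b k.+1)%N.
Hypothesis b0 : b 0 = 0%N.
Hypothesis b_m : b m = N.
Hypothesis eta_ge0 : 0 <= eta.
Hypothesis good_step : forall k w, (k < m)%N -> good (b k.+1) w ->
  `|V (b k.+1) w - V (b k) w| <= eta.

Definition bad : set Omega :=
  [set w | exists2 k, (k < m)%N & eta < `|stopped (b k.+1) w - stopped (b k) w|].

Let b_le k l : (k <= l)%N -> (b k <= b l)%N.
Proof.
elim: l => [|l IH]; first by rewrite leqn0 => /eqP ->.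
by rewrite leq_eqVlt => /predU1P[->//|]; rewrite ltnS => /IH H; exact: leq_trans H (b_mono l).
Qed.

Let b_N k : (k <= m)%N -> (b k <= N)%N.
Proof. by rewrite -b_m; exact: b_le. Qed.

Let remainder k w := sqabs (stopped (b k.+1) w) - sqabs (stopped (b k) w) -
   stopped (b k) w / sqabs (stopped (b k) w) * (stopped (b k.+1) w - stopped (b k) w).

Lemma bad_measurable : measurable bad.
Proof.
have -> : bad = \bigcup_(k in `I_m) [set w | eta < `|stopped (b k.+1) w - stopped (b k) w|].
  by apply/seteqP; split=> [w [k km H]|w [k /= km H]]; exists k.
apply: fin_bigcup_measurable => // k /= km.
have mS l : (l <= m)%N -> measurable_fun setT (stopped (b l)).
  by move=> lm; apply: (Int_measurable (stopped_int (b_N lm)).2).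
have mg : measurable_fun setT (fun w => `|stopped (b k.+1) w - stopped (b k) w|).
  by apply: measurableT_comp => //; apply: measurable_funB; apply: mS => //; exact: ltnW.
have := mg measurableT _ (measurable_itv `]eta, +oo[); rewrite setTI; congr measurable.
by apply/seteqP; split => w; rewrite /= in_itv/= andbT.
Qed.

(** At most one of the increments over the coarse grid can be large, because
    the stopping rule acts right after it. *)
Lemma sum_remainder w : \sum_(0 <= k < m) remainder k w <=
  m%:R * (eta ^+ 2 / 2) + \1_bad w * (L *+ 2 + overshoot N w) *+ 4.
Proof.
have O0 : 0 <= L *+ 2 + overshoot N w.
  rewrite addr_ge0 ?mulrn_wge0//; apply: le_trans (overshoot_incr w (leq0n N)).
  by rewrite /overshoot big_nil.
have small k : (k < m)%N -> `|stopped (b k.+1) w - stopped (b k) w| <= eta ->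
    remainder k w <= eta ^+ 2 / 2.
  move=> km H; rewrite /remainder.
  have := sqabs_expand2 (stopped (b k) w) (stopped (b k.+1) w - stopped (b k) w).
  rewrite addrCA subrr addr0; set u := stopped _ _ - stopped _ _ in H *; set q := _ * u => H1.
  have H2 : u ^+ 2 / 2 <= eta ^+ 2 / 2.
    by rewrite ler_pM2r// -[u ^+ 2]real_normK ?num_real// ler_sqr ?nnegrE.
  by move: H1 H2; set s1 := sqabs _; set s2 := sqabs _; set e1 := _ / 2; set e2 := _ / 2; lra.
have large k : (k < m)%N -> remainder k w <= (L *+ 2 + overshoot N w) *+ 4.
  move=> km; rewrite /remainder.
  have := sqabs_expand1 (stopped (b k) w) (stopped (b k.+1) w - stopped (b k) w).
  rewrite addrCA subrr addr0; set u := stopped _ _ - stopped _ _; set q := _ * u => H1.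
  have H2 : `|u| <= (L *+ 2 + overshoot N w) *+ 2.
    rewrite mulr2n; apply: le_trans (ler_normB _ _) _; apply: lerD.
      apply: le_trans (stopped_bound w (b_N km)) _.
      by rewrite lerD2l overshoot_incr// b_N.
    apply: le_trans (stopped_bound w (b_N (ltnW km))) _.
    by rewrite lerD2l overshoot_incr// b_N// ltnW.
  move: H1 H2; set s1 := sqabs _; set s2 := sqabs _; set e1 := _ + overshoot _ _.
  by move: (`|u|) => z; lra.
have one l : (l <= m)%N ->
    (forall k, (k < l)%N -> `|stopped (b k.+1) w - stopped (b k) w| <= eta) ->
    \sum_(0 <= k < l) remainder k w <= l%:R * (eta ^+ 2 / 2).
  move=> lm H; rewrite mulr_natl -[l in leRHS]subn0 -sumr_const_nat.
  by apply: ler_sum_nat => k /andP[_ kl]; apply: small; [exact: leq_trans lm|exact: H].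
(* Before an increment larger than [eta] all grid points are good, so that all
   previous increments are small; afterwards the martingale is stopped, and the
   remaining increments vanish. *)
have key l : (l <= m)%N -> \sum_(0 <= k < l) remainder k w <=
    l%:R * (eta ^+ 2 / 2) + \1_bad w * (L *+ 2 + overshoot N w) *+ 4.
  elim: l => [|l IH] lm.
    by rewrite big_nil mul0r add0r mulrn_wge0// mulr_ge0// indicE.
  have E : l.+1%:R * (eta ^+ 2 / 2) = l%:R * (eta ^+ 2 / 2) + eta ^+ 2 / 2 :> R.
    by rewrite -[l.+1]addn1 natrD mulrDl mul1r.
  have e0 : 0 <= eta ^+ 2 / 2 by rewrite divr_ge0 ?sqr_ge0.
  rewrite big_nat_recr//=.
  have [sm|bg] := leP `|stopped (b l.+1) w - stopped (b l) w| eta.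
    rewrite E; have h1 := IH (ltnW lm); have h2 := small l lm sm.
    by move: h1 h2; set s1 := \sum_(_ <= _ < _) _; set s2 := _ *+ 4; lra.
  have H k : (k < l)%N -> `|stopped (b k.+1) w - stopped (b k) w| <= eta.
    move=> kl; have gl : good_upto (b l) w.
      apply: contrapT => ng; move: bg; rewrite (stopped_after (b_mono l) ng) subrr normr0.
      by rewrite ltNge eta_ge0.
    have g1 : good_upto (b k.+1) w by apply: good_upto_le gl; exact: b_le.
    have g2 : good_upto (b k) w by apply: good_upto_le g1; exact: b_mono.
    rewrite (stopped_good g1) (stopped_good g2); apply: good_step.
      by apply: leq_trans lm; exact: ltnW.
    exact: good_upto_good.
  have h1 := one l (ltnW lm) H; have h2 := large l lm.
  rewrite indic1 ?mul1r; last by exists l.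
  by rewrite E; move: h1 h2; set s1 := \sum_(_ <= _ < _) _; set s2 := _ *+ 4; lra.
exact: key.
Qed.

(** Telescoping over the coarse grid: the slope terms have zero expectation by
    optional stopping, and the remainders are bounded by [sum_remainder]. *)
Lemma stopped_sqabs_le : \int[P]_w sqabs (stopped N w) <=
  1 + m%:R * (eta ^+ 2 / 2) + (\int[P]_w (\1_bad w * (L *+ 2 + overshoot N w))) *+ 4.
Proof.
have mS k : (k <= m)%N -> measurable_wrt (G (b k)) (stopped (b k)) /\ Int (stopped (b k)).
  by move=> km; apply: stopped_int; exact: b_N.
have IS k : (k <= m)%N -> Int (fun w => sqabs (stopped (b k) w)).
  by move=> km; apply: Int_sqabs; case: (mS k km).
have IB : Int (fun w => \1_bad w * (L *+ 2 + overshoot N w)).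
  apply: Int_indic; last exact: bad_measurable.
  by apply: integrable_add => //; [exact: Int_cst|exact: overshoot_int].
have slope k : (k < m)%N -> Int (fun w => stopped (b k) w / sqabs (stopped (b k) w) *
    (stopped (b k.+1) w - stopped (b k) w)) /\
  \int[P]_w (stopped (b k) w / sqabs (stopped (b k) w) * (stopped (b k.+1) w - stopped (b k) w)) = 0.
  move=> km; have [m1 i1] := mS k (ltnW km); have [m2 i2] := mS k.+1 km.
  have sG := G_sigma (b_N (ltnW km)).
  have mz : measurable_wrt (G (b k)) (fun w => stopped (b k) w / sqabs (stopped (b k) w)).
    by apply: (measurable_wrt_comp sG.1 continuous_sqabs_slope).
  split; last first.
    by apply: (@stopped_orthogonal _ _ _ 1) => //; [exact: b_N|move=> w; exact: sqabs_slope].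
  apply: (@Int_mul _ _ _ _ _ _ 1).
  - exact: integrable_sub.
  - exact: measurable_wrt_measurable_fun sG.2 mz.
  - by move=> w; exact: sqabs_slope.
have IR k : (k < m)%N -> Int (remainder k).
  move=> km; apply: integrable_sub => //; last exact: (slope k km).1.
  by apply: integrable_sub => //; apply: IS => //; exact: ltnW.
have ER k : (k < m)%N -> \int[P]_w remainder k w =
    \int[P]_w sqabs (stopped (b k.+1) w) - \int[P]_w sqabs (stopped (b k) w).
  move=> km; rewrite RintegralB//; [|by apply: integrable_sub => //; apply: IS => //; exact: ltnW|exact: (slope k km).1].
  by rewrite (slope k km).2 subr0 RintegralB//; apply: IS => //; exact: ltnW.
have tele : \sum_(0 <= k < m) \int[P]_w remainder k w = \int[P]_w sqabs (stopped N w) - 1.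
  rewrite (eq_big_nat _ _ (F2 := fun k => \int[P]_w sqabs (stopped (b k.+1) w) - \int[P]_w sqabs (stopped (b k) w))); last first.
    by move=> k /andP[_ km]; exact: ER.
  rewrite telescope_sumr// b_m b0; congr (_ - _).
  rewrite -[RHS](Ex_cst P 1); apply: eq_Rintegral => w _.
  by rewrite /stopped big_nil /sqabs expr0n addr0 sqrtr1.
have : \int[P]_w (\sum_(0 <= k < m) remainder k w) <=
   \int[P]_w (m%:R * (eta ^+ 2 / 2) + \1_bad w * (L *+ 2 + overshoot N w) *+ 4).
  apply: Ex_le; last exact: sum_remainder.
  - by apply: Int_sum.
  - apply: integrable_add => //; first exact: Int_cst.
    under [X in EFin \o X]eq_fun do rewrite -mulr_natl.
    exact: integrable_scale.
rewrite Ex_sum// tele RintegralD//; [|exact: Int_cst|]; last first.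
  under [X in EFin \o X]eq_fun do rewrite -mulr_natl.
  exact: integrable_scale.
rewrite Ex_cst; under [X in _ <= _ + X -> _]eq_Rintegral do rewrite -mulr_natl.
rewrite RintegralZl// mulr_natl.
by set s1 := Rintegral _ _ _; set s2 := Rintegral _ _ _; lra.
Qed.

End StoppedMartingale.

(** * Uniform integrability and limits of events *)

Section UniformIntegrability.
Context {R : realType} {d : measure_display} {Omega : measurableType d}.
Variable P : probability Omega R.

Local Notation Int f := (P.-integrable setT (EFin \o f)).

Lemma integrable_tail (q : Omega -> R) (e : R) : Int q -> (forall w, 0 <= q w) -> 0 < e ->
  exists2 c : R, 0 <= c & \int[P]_w (\1_[set w | c < q w] w * q w) <= e.
Proof.
move=> Iq q0 e0; have mq := Int_measurable Iq.
have mA (c : R) : measurable [set w | c < q w].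
  have := mq measurableT _ (measurable_itv `]c, +oo[); rewrite setTI; congr measurable.
  by apply/seteqP; split => w; rewrite /= in_itv/= andbT.
have [||||_ H] := @Ex_dominated _ _ _ P (fun n w => \1_[set w | n%:R < q w] w * q w) (fun=> 0) q.
- by move=> n; apply: measurable_funM.
- exact: Iq.
- move=> n w; rewrite normrM !ger0_norm// ?indicE// ler_piMl//.
  by rewrite lern1 leq_b1.
- move=> w; apply: cvg_near_cst.
  have [n qn] : exists n : nat, q w < n%:R.
    by exists (Num.bound (q w)); exact: (archi_boundP (q0 w)).
  exists n => // k /= nk; rewrite indicE memNset ?mul0r//= => kq.
  have := lt_trans qn (le_lt_trans (_ : n%:R <= k%:R) kq).
  by rewrite ltxx ler_nat => /(_ nk).
rewrite Ex_cst in H; have [n Hn] := (cvg_seq_eps _ _).1 H _ e0.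
exists n%:R => //; have := Hn n (leqnn _); rewrite sub0r normrN => h.
by apply: ltW; apply: le_lt_trans h; exact: ler_norm.
Qed.

(** The value of [Q] selected by the disjoint events [E j] is at most [lam] on
    part of [B].  On the events where it exceeds [lam], the submartingale property
    bounds its expectation by that of [QT]; their union has probability at most
    [E QT / lam] by Markov's inequality, so that the integrability of [QT] makes
    this contribution small, uniformly in the array. *)
Lemma stopped_value_ui (QT : Omega -> R) (e : R) : Int QT -> (forall w, 0 <= QT w) -> 0 < e ->
  exists2 lam : R, 0 < lam & forall N (G : nat -> set (set Omega)) (Q : nat -> Omega -> R)
    (E : nat -> set Omega) (B : set Omega),
  (forall j, (j < N)%N -> sigma_algebra setT (G j) /\ G j `<=` measurable) ->
  (forall j, (j < N)%N -> measurable_wrt (G j) (Q j) /\ Int (Q j)) ->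
  (forall j w, 0 <= Q j w) ->
  (forall j A, (j < N)%N -> G j A -> \int[P]_w (\1_A w * Q j w) <= \int[P]_w (\1_A w * QT w)) ->
  (forall j, (j < N)%N -> G j (E j)) ->
  (forall w, \sum_(0 <= j < N) \1_(E j) w <= 1 :> R) ->
  measurable B ->
  \int[P]_w (\1_B w * \sum_(0 <= j < N) \1_(E j) w * Q j w) <= e + lam * fine (P B).
Proof.
move=> IQT QT0 e0; have e20 : 0 < e / 2 by rewrite divr_gt0.
have [c c0 Hc] := integrable_tail IQT QT0 e20.
have EQ0 : 0 <= \int[P]_w QT w by apply: Rintegral_ge0.
(* The part of [QT] below [c] contributes at most [c * (E QT / lam)], which is
   at most [e / 2]. *)
pose lam := c * \int[P]_w QT w / (e / 2) + 1.
have lam0 : 0 < lam by rewrite ltr_wpDl// divr_ge0 ?mulr_ge0// ltW.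
exists lam => // N G Q E B HG HQ Q0 Qsub GE E1 mB.
pose A j := E j `&` [set w | lam < Q j w].
have GA j : (j < N)%N -> G j (A j).
  move=> jN; apply: sigma_setI; [exact: (HG j jN).1|exact: GE|].
  by apply: measurable_wrt_gt; [exact: (HQ j jN).1].
have mA j : (j < N)%N -> measurable (A j) by move=> jN; apply: (HG j jN).2; exact: GA.
have i01 (D : set Omega) w : 0 <= (\1_D w : R) <= 1 by rewrite indicE; case: (w \in D); rewrite /= ?lexx ?ler01.
have IA j : (j < N)%N -> Int (fun w => \1_(A j) w * Q j w).
  by move=> jN; apply: Int_indic; [exact: (HQ j jN).2|exact: mA].
have IAT j : (j < N)%N -> Int (fun w => \1_(A j) w * QT w).
  by move=> jN; apply: Int_indic => //; exact: mA.
have I1 (D : set Omega) : measurable D -> Int (\1_D : Omega -> R).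
  move=> mD; apply: (@Int_bounded _ _ _ _ _ 1) => // w.
  by have /andP[h1 h2] := i01 D w; rewrite ger0_norm.
pose h w : R := \sum_(0 <= j < N) \1_(A j) w.
have h1 w : 0 <= h w <= 1.
  apply/andP; split; first by apply: sumr_ge0 => j _; case/andP: (i01 (A j) w).
  apply: le_trans (E1 w); apply: ler_sum_nat => j _; rewrite !indicE ler_nat.
  have [Aw|nA] := pselect (A j w); last by rewrite memNset.
  by rewrite !mem_set//; case: Aw.
have mh : measurable_fun setT h.
  apply: (@Int_measurable _ _ _ P); apply: Int_sum => j jN; apply: I1; exact: mA.
have Ih : Int h by apply: Int_sum => j jN; apply: I1; exact: mA.
have IhT : Int (fun w => h w * QT w).
  apply: (@Int_mul _ _ _ _ _ _ 1) => // w.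
  by have /andP[a1 a2] := h1 w; rewrite ger0_norm.
have hT : \sum_(0 <= j < N) \int[P]_w (\1_(A j) w * QT w) = \int[P]_w (h w * QT w).
  rewrite -Ex_sum//; apply: eq_Rintegral => w _; rewrite /h mulr_suml//.
have ET : \int[P]_w (h w * QT w) <= \int[P]_w QT w.
  apply: Ex_le => // w; rewrite ler_piMl//.
  by case/andP: (h1 w).
have hle : lam * \int[P]_w h w <= \int[P]_w QT w.
  apply: le_trans ET; rewrite -RintegralZl// -hT.
  apply: le_trans (_ : \sum_(0 <= j < N) \int[P]_w (\1_(A j) w * Q j w) <= _).
    rewrite -Ex_sum//; apply: Ex_le.
    - exact: integrable_scale.
    - exact: Int_sum.
    move=> w; rewrite /h mulr_sumr; apply: ler_sum_nat => j _.
    rewrite mulrC indicE; have [Aw|nA] := pselect (A j w); last by rewrite memNset// !mul0r.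
    by rewrite mem_set// !mul1r; case: Aw => _ /ltW.
  by apply: ler_sum_nat => j /andP[_ jN]; apply: Qsub => //; exact: GA.
have hT2 : \int[P]_w (h w * QT w) <= e / 2 + c * \int[P]_w h w.
  have mC : measurable [set w | c < QT w].
    have := Int_measurable IQT measurableT (measurable_itv `]c, +oo[); rewrite setTI; congr measurable.
    by apply/seteqP; split => w; rewrite /= in_itv/= andbT.
  apply: (@le_trans _ _ (\int[P]_w (\1_[set w | c < QT w] w * QT w + c * h w))).
    apply: Ex_le => //.
      by apply: integrable_add => //; [exact: Int_indic|exact: integrable_scale].
    move=> w; have /andP[a1 a2] := h1 w; rewrite indicE.
    have [Aw|/negP nA] := pselect (c < QT w).
      rewrite mem_set// mul1r; apply: (@le_trans _ _ (QT w)); first by rewrite ler_piMl.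
      by rewrite lerDl mulr_ge0.
    rewrite memNset; last by apply/negP.
    by rewrite mul0r add0r mulrC ler_wpM2r// leNgt.
  rewrite RintegralD//; [|exact: Int_indic|exact: integrable_scale].
  by rewrite RintegralZl//; apply: lerD.
apply: (@le_trans _ _ (\int[P]_w (lam * \1_B w + \sum_(0 <= j < N) \1_(A j) w * Q j w))).
  apply: Ex_le.
  - apply: Int_indic => //; apply: Int_sum => j jN; apply: Int_indic.
      exact: (HQ j jN).2.
    by apply: (HG j jN).2; exact: GE.
  - apply: integrable_add => //; last exact: Int_sum.
    by apply: integrable_scale => //; exact: I1.
  - move=> w; have /andP[b1 b2] := i01 B w.
    apply: (@le_trans _ _ (\sum_(0 <= j < N) (\1_(E j) w * (lam * \1_B w) + \1_(A j) w * Q j w))).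
      rewrite mulr_sumr; apply: ler_sum_nat => j _.
      rewrite /A [\1_(_ `&` _) w]indicE [\1_(E j) w]indicE.
      have [Ew|nE] := pselect (E j w); last first.
        by rewrite !memNset// ?mul0r ?mulr0 ?addr0// => -[].
      rewrite (mem_set Ew) mul1r [true%:R * _]mul1r.
      have [ql|lq] := leP (Q j w) lam.
        rewrite memNset ?mul0r ?addr0; last by move=> [_ /=]; rewrite ltNge ql.
        by rewrite mulrC ler_wpM2r.
      rewrite mem_set ?mul1r; last by split.
      apply: (@le_trans _ _ (Q j w)); first by rewrite ler_piMl.
      by rewrite lerDr mulr_ge0// ltW.
    rewrite big_split/= lerD2r -mulr_suml ler_piMl// mulr_ge0// ltW//.
rewrite RintegralD//; [|by apply: integrable_scale => //; exact: I1|exact: Int_sum].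
rewrite RintegralZl//; [|exact: I1]; rewrite Ex_indic// addrC lerD2r.
rewrite Ex_sum//; apply: le_trans (_ : \sum_(0 <= j < N) \int[P]_w (\1_(A j) w * QT w) <= _).
  by apply: ler_sum_nat => j /andP[_ jN]; apply: Qsub => //; exact: GA.
rewrite hT; apply: le_trans hT2 _; rewrite [leRHS](splitr e) lerD2l.
have Eh0 : 0 <= \int[P]_w h w by apply: Rintegral_ge0 => w _; case/andP: (h1 w).
rewrite -(ler_pM2l lam0); apply: le_trans (_ : c * \int[P]_w QT w <= _).
  by rewrite mulrCA ler_wpM2l.
by rewrite /lam mulrDl divfK ?gt_eqF// mul1r lerDl ltW.
Qed.

End UniformIntegrability.

Section LimitsOfEvents.
Context {R : realType} {d : measure_display} {Omega : measurableType d}.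
Variable P : probability Omega R.

Lemma tail_events_small (B : nat -> set Omega) (e : R) : 0 < e ->
  (forall n, measurable (B n)) ->
  exists N, (P (\bigcup_(n in [set n | (N <= n)%N]) B n) <=
     P (\bigcap_N \bigcup_(n in [set n | (N <= n)%N]) B n) + e%:E)%E.
Proof.
move=> e0 mB; pose T N := \bigcup_(n in [set n | (N <= n)%N]) B n.
have mT N : measurable (T N) by apply: bigcup_measurable.
have mI : measurable (\bigcap_N T N) by apply: bigcap_measurableType.
have H : P \o T @ \oo --> P (\bigcap_N T N).
  apply: nonincreasing_cvg_mu => //.
    by apply: le_lt_trans (probability_le1 P (mT 0%N)) _; rewrite ltry.
  move=> n k nk; apply/subsetPset; apply: bigcup_subset => i /=; exact: leq_trans.
have fin A : measurable A -> P A \is a fin_num by move=> mA; exact: fin_num_measure.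
have H' : (fun n => fine (P (T n))) @ \oo --> fine (P (\bigcap_N T N)).
  by apply: fine_cvg; rewrite fineK ?fin.
have [N HN] := (cvg_seq_eps _ _).1 H' _ e0.
exists N; have := HN N (leqnn N); rewrite ltr_distl => /andP[+ _].
rewrite ltrBlDr -lte_fin EFinD !fineK ?fin//; exact: ltW.
Qed.

(** Almost sure convergence in [n], then in [m], gives convergence in probability
    in the same order; the rank in [m] comes first and is uniform in [w] after
    removal of a small event. *)
Lemma iterated_events_small (B : nat -> nat -> set Omega) (Om : set Omega) (e : R) : 0 < e ->
  (forall m n, measurable (B m n)) ->
  P.-negligible (~` Om) ->
  (forall w, Om w -> exists M, forall m, (M <= m)%N ->
     exists N, forall n, (N <= n)%N -> ~ B m n w) ->
  exists M, forall m, (M <= m)%N -> exists N, forall n, (N <= n)%N -> (P (B m n) <= e%:E)%E.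
Proof.
move=> e0 mB nOm HB.
have e20 : 0 < e / 2 by rewrite divr_gt0.
pose Lm m := \bigcap_N \bigcup_(n in [set n | (N <= n)%N]) B m n.
have mL m : measurable (Lm m).
  by apply: bigcap_measurableType => N _; exact: bigcup_measurable.
have [M HM] := tail_events_small e20 mL.
have nul : P (\bigcap_N \bigcup_(m in [set m | (N <= m)%N]) Lm m) = 0.
  have mS : measurable (\bigcap_N \bigcup_(m in [set m | (N <= m)%N]) Lm m).
    by apply: bigcap_measurableType => N _; exact: bigcup_measurable.
  apply/(negligibleP _ mS); apply: negligibleS nOm => w Hw Ow.
  have [M' HM'] := HB w Ow; have [m /= Mm] := Hw M' I.
  by have [N HN] := HM' m Mm => /(_ N I)[n /= Nn]; exact: HN.
rewrite nul add0e in HM.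
exists M => m Mm; have [N HN] := tail_events_small e20 (mB m).
exists N => n Nn.
apply: le_trans (_ : _ <= P (\bigcup_(n in [set n | (N <= n)%N]) B m n))%E _.
  apply: le_measure; rewrite ?inE//; first exact: bigcup_measurable.
  by move=> w Bw; exists n.
apply: le_trans HN _; rewrite [X in (_ <= X%:E)%E]splitr EFinD; apply: leeD => //.
apply: le_trans HM; apply: le_measure; rewrite ?inE//; last first.
  by move=> w Lw; exists m.
- by apply: bigcup_measurable.
- exact: mL.
Qed.

Lemma negligible_small (E : set Omega) :
  (forall e : R, 0 < e -> exists A, [/\ measurable A, E `<=` A & (P A <= e%:E)%E]) ->
  P.-negligible E.
Proof.
move=> H; have /choice[A HA] : forall n : nat, exists A, [/\ measurable A, E `<=` A & (P A <= (n.+1%:R^-1)%:E)%E].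
  by move=> n; apply: H; rewrite invr_gt0.
exists (\bigcap_n A n); split.
- by apply: bigcap_measurableType => n _; case: (HA n).
- apply/eqP; rewrite eq_le measure_ge0 andbT.
  apply/lee_addgt0Pr => e e0; rewrite add0e.
  have [N HN] := (cvg_seq_eps _ _).1 (@cvg_invS R) _ e0.
  have [mA _ PA] := HA N.
  apply: (@le_trans _ _ (P (A N))).
    apply: le_measure; rewrite ?inE//; last by move=> w; apply.
    by apply: bigcap_measurableType => n _; case: (HA n).
  apply: le_trans PA _; rewrite lee_fin ltW//.
  by have := HN N (leqnn N); rewrite sub0r normrN; apply: le_lt_trans; exact: ler_norm.
- by move=> w Ew n _; case: (HA n) => _ + _; apply.
Qed.

Lemma liminf_events_small (A : nat -> set Omega) (e : R) N0 :
  (forall n, measurable (A n)) -> (forall n, (N0 <= n)%N -> (P (A n) <= e%:E)%E) ->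
  (P (\bigcup_N \bigcap_(n in [set n | (N <= n)%N]) A n) <= e%:E)%E.
Proof.
move=> mA HA; pose S N := \bigcap_(n in [set n | (N <= n)%N]) A n.
have mS N : measurable (S N) by apply: bigcap_measurableType => n _.
have : P \o S @ \oo --> P (\bigcup_N S N).
  apply: nondecreasing_cvg_mu => //; first exact: bigcup_measurable.
  move=> n k nk; apply/subsetPset => w Sw i /= ki; apply: Sw; exact: leq_trans ki.
move=> /(cvg_lim _) <-//; apply: lime_le.
  apply: ereal_nondecreasing_is_cvgn => n k nk; apply: le_measure; rewrite ?inE//.
  by move=> w Sw i /= ki; apply: Sw; exact: leq_trans ki.
near=> n; have Nn : (N0 <= n)%N by near: n; exists N0.
apply: le_trans (HA n Nn); apply: le_measure; rewrite ?inE//.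
by move=> w; apply => /=.
Unshelve. all: by end_near. Qed.

Lemma markov_sqabs (S : Omega -> R) (rho c : R) : P.-integrable setT (EFin \o S) ->
  0 < rho -> \int[P]_w sqabs (S w) <= 1 + c * rho ->
  measurable [set w | 1 + rho < sqabs (S w)] /\ (P [set w | (1 + rho < sqabs (S w))%R] <= c%:E)%E.
Proof.
move=> IS rho0 HS.
have mq : measurable_fun setT (fun w => sqabs (S w)).
  by apply: measurableT_comp (Int_measurable IS); exact: continuous_measurable_fun continuous_sqabs.
have mA : measurable [set w | 1 + rho < sqabs (S w)].
  have := mq measurableT _ (measurable_itv `](1 + rho), +oo[); rewrite setTI; congr measurable.
  by apply/seteqP; split => w; rewrite /= in_itv/= andbT.
split=> //; rewrite -[leLHS]fineK ?fin_num_measure// lee_fin -Ex_indic//.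
have Iq := Int_sqabs IS.
rewrite -(ler_pM2r rho0) mulrC -(lerD2l 1); apply: le_trans HS.
have I1 : P.-integrable setT (EFin \o (\1_[set w | 1 + rho < sqabs (S w)] : Omega -> R)).
  apply: (@Int_bounded _ _ _ _ _ 1) => // w.
  by rewrite indicE; case: (_ \in _); rewrite ?normr0 ?normr1.
rewrite -RintegralZl// -[X in X + _ <= _](Ex_cst P) -RintegralD//; last 2 first.
- exact: Int_cst.
- exact: integrable_scale.
apply: Ex_le => //.
  by apply: integrable_add => //; [exact: Int_cst|exact: integrable_scale].
move=> w; rewrite indicE.
have [h|h] := pselect (1 + rho < sqabs (S w)).
  by rewrite mem_set// mulr1 ltW.
by rewrite memNset// mulr0 addr0 sqabs_ge1.
Qed.

End LimitsOfEvents.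

(** * Arrays of stopped martingales *)

Section StoppedArray.
Context {R : realType} {d : measure_display} {Omega : measurableType d}.
Variable P : probability Omega R.

Local Notation Int f := (P.-integrable setT (EFin \o f)).

(** The index [n] is that of the partition and [m] that of the coarse grid, which
    stays fixed while [n] grows. *)
Variables (N : nat -> nat) (G : nat -> nat -> set (set Omega)).
Variables (V Q : nat -> nat -> Omega -> R) (QT : Omega -> R).
Hypothesis G_sigma : forall n i, (i <= N n)%N -> sigma_algebra setT (G n i) /\ G n i `<=` measurable.
Hypothesis G_incr : forall n i j, (i <= j)%N -> (j <= N n)%N -> G n i `<=` G n j.
Hypothesis V0 : forall n w, V n 0 w = 0.
Hypothesis V_meas : forall n i, (i <= N n)%N -> measurable_wrt (G n i) (V n i) /\ Int (V n i).
Hypothesis V_mart : forall n i A, (i < N n)%N -> G n i A ->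
  \int[P]_w (\1_A w * (V n i.+1 w - V n i w)) = 0.
Hypothesis Q_meas : forall n i, (i <= N n)%N -> measurable_wrt (G n i) (Q n i) /\ Int (Q n i).
Hypothesis Q_ge0 : forall n i w, 0 <= Q n i w.
Hypothesis VQ : forall n i w, (i < N n)%N -> `|V n i.+1 w - V n i w| <= Q n i.+1 w + Q n i w.
Hypothesis QT_int : Int QT.
Hypothesis QT_ge0 : forall w, 0 <= QT w.
Hypothesis Q_sub : forall n i A, (i <= N n)%N -> G n i A ->
  \int[P]_w (\1_A w * Q n i w) <= \int[P]_w (\1_A w * QT w).
Variables (good : nat -> nat -> nat -> set Omega) (L c : R) (b : nat -> nat -> nat -> nat).
Hypothesis good_meas : forall m n i, (i <= N n)%N -> G n i (good m n i).
Hypothesis L_ge0 : 0 <= L.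
Hypothesis good_V : forall m n i w, good m n i w -> `|V n i w| <= L.
Hypothesis good_Q : forall m n i w, good m n i w -> Q n i w <= L.
Hypothesis b_mono : forall m n k, (b m n k <= b m n k.+1)%N.
Hypothesis b0 : forall m n, b m n 0 = 0%N.
Hypothesis b_m : forall m n, b m n m.+1 = N n.
Hypothesis c_ge0 : 0 <= c.
Hypothesis good_step : forall m n k w, (k < m.+1)%N -> good m n (b m n k.+1) w ->
  `|V n (b m n k.+1) w - V n (b m n k) w| <= c / m.+1%:R.

Let bad m n := bad (V n) (good m n) m.+1 (b m n) (c / m.+1%:R).

Lemma stopping_indicators_le1 (g : nat -> set Omega) i w :
  \sum_(0 <= j < i) \1_(good_upto g j `\` g j.+1) w <= 1 :> R.
Proof.
have H : \sum_(0 <= j < i) \1_(good_upto g j `\` g j.+1) w + \1_(good_upto g i) w <= 1 :> R.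
  elim: i => [|i IH]; first by rewrite big_nil add0r indicE lern1 leq_b1.
  rewrite big_nat_recr//=; apply: le_trans IH; rewrite -addrA lerD2l !indicE.
  have [gi|ngi] := pselect (good_upto g i w); last first.
    by rewrite !memNset ?addr0// => -[].
  rewrite (mem_set gi); have [gi1|ngi1] := pselect (g i.+1 w).
    by rewrite memNset ?add0r ?lern1 ?leq_b1// => -[].
  by rewrite [w \in _ `&` _]memNset ?addr0 ?lern1 ?leq_b1// => -[].
by apply: le_trans H; rewrite lerDl.
Qed.

(** Off the bad events the increments over the coarse grid are at most
    [c / m.+1], so their squares add up to at most [c ^+ 2 / m.+1]; the bad events
    are negligible in the limit by uniform integrability.  Hence the stopped
    martingales tend to 0 in probability, first in [n] and then in [m]. *)
Lemma stopped_limit_negligible (Om E : set Omega) (kappa : R) : 0 < kappa ->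
  P.-negligible (~` Om) ->
  (forall w, Om w -> exists M, forall m, (M <= m)%N ->
     exists n0, forall n, (n0 <= n)%N -> ~ bad m n w) ->
  (forall w, E w -> forall m, exists n0, forall n, (n0 <= n)%N ->
     kappa <= `|stopped (V n) (good m n) (N n) w|) ->
  P.-negligible E.
Proof.
move=> k0 nOm HOm HE.
have eta0 m : 0 <= c / m.+1%:R by rewrite divr_ge0.
have mbad m n : measurable (bad m n).
  exact: (bad_measurable (@G_sigma n) (@G_incr n) (@V_meas n) (@good_meas m n) _ (@b_mono m n) (b_m m n)).
(* Large values of the stopped martingale make [sqabs] exceed its minimum 1 by
   more than [rho]. *)
pose rho := (sqabs kappa - 1) / 2.
have rho0 : 0 < rho.
  rewrite divr_gt0// subr_gt0 -(ltr_pXn2r (n := 2))// ?nnegrE ?ltW ?sqabs_gt0//.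
  by rewrite sqabs_sqr expr1n ltrDl exprn_gt0.
have rhok : 1 + rho < sqabs kappa by move: rho0; rewrite /rho; lra.
apply: negligible_small => e e0.
have er0 : 0 < e * rho by rewrite mulr_gt0.
have e1 : 0 < e * rho / 16 by rewrite divr_gt0.
have [lam lam0 Hlam] := stopped_value_ui QT_int QT_ge0 e1.
have Ll0 : 0 < L *+ 2 + lam by rewrite ltr_wpDl// mulrn_wge0.
have e2 : 0 < e * rho / 16 / (L *+ 2 + lam) by rewrite divr_gt0.
have [M HM] := iterated_events_small e2 mbad nOm HOm.
have cM : (fun m => (c ^+ 2 / 2) * m.+1%:R^-1) @ \oo --> (c ^+ 2 / 2) * 0.
  by apply: cvgMr; exact: cvg_invS.
have er2 : 0 < e * rho / 2 by rewrite divr_gt0.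
have [M' HM'] := (cvg_seq_eps _ _).1 cM _ er2.
pose m := maxn M M'; have [n0 Hn0] := HM m (leq_maxl _ _).
have mterm : m.+1%:R * ((c / m.+1%:R) ^+ 2 / 2) <= e * rho / 2.
  have := HM' m (leq_maxr _ _); rewrite mulr0 sub0r normrN => /ltW /(le_trans (ler_norm _)).
  apply: le_trans; rewrite le_eqVlt; apply/orP; left; apply/eqP.
  have : m.+1%:R != 0 :> R by [].
  by move: (m.+1%:R : R) => z z0; field.
pose S n := stopped (V n) (good m n) (N n).
have IS n : Int (S n).
  exact: (stopped_int (@G_sigma n) (@G_incr n) (@V_meas n) (@good_meas m n) (leqnn _)).2.
have Sle n : (n0 <= n)%N -> \int[P]_w sqabs (S n w) <= 1 + e * rho.
  move=> n0n.
  apply: le_trans.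
    apply: (stopped_sqabs_le (@G_sigma n) (@G_incr n) (V0 n) (@V_meas n) (@V_mart n)
      (@Q_meas n) (@Q_ge0 n) (@VQ n) (@good_meas m n) L_ge0 (@good_V m n) (@good_Q m n)
      (@b_mono m n) (b0 m n) (b_m m n) (eta0 m) (@good_step m n)).
  have Iov : Int (overshoot (Q n) (good m n) (N n)).
    exact: (overshoot_int (@G_sigma n) (@G_incr n) (@Q_meas n) (@good_meas m n)).
  have I1 : Int (\1_(bad m n) : Omega -> R).
    by apply: (@Int_bounded _ _ _ _ _ 1) => // w; rewrite indicE ger0_norm// lern1 leq_b1.
  have ov : \int[P]_w (\1_(bad m n) w * overshoot (Q n) (good m n) (N n) w) <=
      e * rho / 16 + lam * fine (P (bad m n)).
    apply: (Hlam (N n) (fun j => G n j.+1) (fun j => Q n j.+1)) => //.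
    - by move=> j jN; exact: G_sigma.
    - by move=> j jN; exact: Q_meas.
    - by move=> j A jN; exact: Q_sub.
    - move=> j jN; apply: sigma_setD; first exact: (G_sigma jN).1.
        apply: (G_incr (leqnSn j) jN).
        exact: (good_upto_meas (@G_sigma n) (@G_incr n) (@good_meas m n) (ltnW jN)).
      exact: good_meas.
    - by move=> w; exact: stopping_indicators_le1.
  have Pb : fine (P (bad m n)) <= e * rho / 16 / (L *+ 2 + lam).
    by rewrite -lee_fin fineK ?fin_num_measure//; exact: Hn0.
  have bi : \int[P]_w (\1_(bad m n) w * (L *+ 2 + overshoot (Q n) (good m n) (N n) w)) <=
      e * rho / 8.
    under eq_Rintegral do rewrite mulrDr mulrC.
    rewrite RintegralD//; [|exact: integrable_scale|exact: Int_indic].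
    rewrite RintegralZl// Ex_indic//.
    rewrite [leLHS](_ : _ = fine (P (bad m n)) * (L *+ 2) +
      \int[P]_w (\1_(bad m n) w * overshoot (Q n) (good m n) (N n) w)); last first.
      by rewrite mulrC.
    have := ov; move: Pb; rewrite ler_pdivlMr//.
    by move: (fine _) (\int[_]_(_ in _) _) => z1 z2; rewrite mulrDr (mulrC z1 lam); lra.
  rewrite -/(bad m n); move: bi mterm; move: (\int[_]_(_ in _) _) (_.+1%:R * _) => z1 z2 h1 h2; rewrite -[z1 *+ 4]mulr_natr; lra.
pose A n := [set w | 1 + rho < sqabs (S (n + n0)%N w)].
have HA n : measurable (A n) /\ (P (A n) <= e%:E)%E.
  by apply: markov_sqabs => //; apply: Sle; exact: leq_addl.
exists (\bigcup_N \bigcap_(n in [set n | (N <= n)%N]) A n); split.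
- by apply: bigcup_measurable => k _; apply: bigcap_measurableType => n _; exact: (HA n).1.
- move=> w /HE /(_ m)[n1 Hn1]; exists n1 => // n /= n1n; rewrite /A/=.
  apply: lt_le_trans rhok _; have := Hn1 (n + n0)%N (leq_trans n1n (leq_addr _ _)).
  rewrite -/(S _) => kS; rewrite /sqabs ler_sqrt ?addr_ge0 ?sqr_ge0// lerD2l.
  by rewrite -[leRHS]ger0_norm ?sqr_ge0// normrX ler_pXn2r ?nnegrE// ltW.
- by apply: (@liminf_events_small _ _ _ _ _ _ 0%N) => [n|n _]; case: (HA n).
Qed.

End StoppedArray.

Section LocalMeasurability.
Context {R : realType} {d : measure_display} {Omega : measurableType d}.
Variable G : set (set Omega).
Hypothesis sG : sigma_algebra setT G.

Lemma measurable_wrtI (h : Omega -> R) : (forall c : R, G [set w | c < h w]) -> measurable_wrt G h.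
Proof.
move=> H; apply/measurable_wrtP => //; apply: (measurability _ (RGenOInfty.measurableE R)).
move=> _ [_ [c ->] <-]; apply/(sigma_measurable _ sG); rewrite setTI.
rewrite (_ : _ @^-1` _ = [set w | c < h w]); first exact: H.
by apply/seteqP; split => w; rewrite /= in_itv/= andbT.
Qed.

Lemma sigma_bigcup (J : countType) (A : J -> set Omega) :
  (forall i, G (A i)) -> G (\bigcup_i A i).
Proof.
move=> H; rewrite -[X in G X]setCK setC_bigcup -setTD.
apply: sigma_setD => //; first exact: sigma_setT.
by apply: sigma_bigcap => // i; rewrite -setTD; apply: sigma_setD => //; exact: sigma_setT.
Qed.

(** On [S], the superlevel sets of [g] are countable unions of rational boxes in
    the coordinates. *)
Lemma measurable_wrt_local n (X : nat -> Omega -> R) (S : set Omega) (g : Omega -> R) :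
  (forall j, (j <= n)%N -> measurable_wrt G (X j)) -> G S ->
  (forall w0 e, S w0 -> 0 < e -> exists2 eta : R, 0 < eta &
     forall w, S w -> (forall j, (j <= n)%N -> `|X j w - X j w0| < eta) -> `|g w - g w0| < e) ->
  measurable_wrt G (fun w => \1_S w * g w).
Proof.
move=> mX GS Hg; apply: measurable_wrtI => c.
pose box (q : seq rat * rat) : set Omega :=
  \bigcap_j [set w | (j <= n)%N -> `|X j w - ratr (nth 0 q.1 j)| < (ratr q.2 : R)].
have Gbox q : G (box q).
  apply: sigma_bigcap => // j; have [jn|nj] := leqP j n; last first.
    by rewrite (_ : [set _ | _] = setT); [exact: sigma_setT|apply/seteqP; split].
  have : measurable_wrt G (fun w => - `|X j w - ratr (nth 0 q.1 j)| + ratr q.2).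
    apply: measurable_wrtD => //; last exact: measurable_wrt_cst.
    apply: (measurable_wrt_comp sG (g := fun z => - `|z|)); last first.
      by apply: measurable_wrtB; [|exact: mX|exact: measurable_wrt_cst].
    by move=> z; apply: cvgN; exact: norm_continuous.
  move=> /(measurable_wrt_gt 0); congr G; apply/seteqP; split => w /=.
    by rewrite addrC subr_gt0.
  by move=> /(_ isT); move: `|_| => z h; lra.
have G0 : G set0 by rewrite -(setDv setT); apply: sigma_setD => //; exact: sigma_setT.
pose D q := if `[< S `&` box q `<=` [set w | c < g w] >] then S `&` box q else set0.
have GD : G (\bigcup_q D q).
  by apply: sigma_bigcup => q; rewrite /D; case: ifP => // _; exact: sigma_setI.
have SE : S `&` [set w | c < g w] = \bigcup_q D q.
  apply/seteqP; split=> [w0 [Sw0 /= cg]|w [q _]]; last first.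
    by rewrite /D; case: asboolP => // H Hw; split; [case: Hw|exact: H].
  have e0 : 0 < g w0 - c by rewrite subr_gt0.
  have [eta eta0 Heta] := Hg w0 _ Sw0 e0.
  have e20 : 0 < eta / 2 by rewrite divr_gt0.
  have [r + ] := @rat_in_itvoo R _ _ e20; rewrite in_itv/= => /andP[r0 re].
  have /choice[qc Hqc] : forall j, exists qc : rat, `|X j w0 - ratr qc| < (ratr r : R).
    move=> j; have rr : X j w0 - ratr r < X j w0 + ratr r by lra.
    have [qc] := rat_in_itvoo rr; rewrite in_itv/= => /andP[h1 h2]; exists qc; rewrite ltr_norml; lra.
  exists (mkseq qc n.+1, r) => //; rewrite /D.
  have bw : box (mkseq qc n.+1, r) w0.
    by move=> j _ /= jn; rewrite nth_mkseq.
  rewrite asboolT; first by split.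
  move=> w [Sw bw'] /=; have : `|g w - g w0| < g w0 - c.
    apply: Heta => // j jn; have := bw' j I jn; rewrite /= nth_mkseq// => h1.
    have h2 := Hqc j; rewrite (_ : X j w - X j w0 = (X j w - ratr (qc j)) - (X j w0 - ratr (qc j))); last by ring.
    by apply: le_lt_trans (ler_normB _ _) _; apply: lt_trans (ltrD h1 h2) _; lra.
  by rewrite ltr_norml; lra.
have [c0|c0] := leP 0 c.
  rewrite (_ : [set w | _] = S `&` [set w | c < g w]); first by rewrite SE.
  apply/seteqP; split => w /=; rewrite indicE.
    have [Sw|nS] := pselect (S w); first by rewrite mem_set// mul1r.
    by rewrite memNset// mul0r ltNge c0.
  by move=> [Sw cg]; rewrite mem_set// mul1r.
rewrite (_ : [set w | _] = setT `\` (S `\` (\bigcup_q D q))).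
  apply: sigma_setD => //; [exact: sigma_setT|exact: sigma_setD].
rewrite -SE; apply/seteqP; split => w /=; rewrite indicE.
  move=> H; split=> // -[Sw]; apply; split=> //.
  by move: H; rewrite mem_set// mul1r.
move=> [_ H]; have [Sw|nS] := pselect (S w); last by rewrite memNset// mul0r.
rewrite mem_set// mul1r; apply: contrapT => ncg; apply: H; split=> // -[_].
exact: ncg.
Qed.

End LocalMeasurability.

(** * Paths that stay in a segment up to a grid time *)

Section Agreement.
Context {R : realType} (T : R) (p : partition_seq T).
Implicit Types (x y : R -> R).

Lemma kpath_agree x y s n i c : (forall u, 0 <= u <= s -> x u = y u) ->
  (i <= psize p n)%N -> ptime p n i <= s ->
  kpath p x n (ptime p n i) c = kpath p y n (ptime p n i) c.
Proof.
move=> xy ni is_; apply/funext => u; rewrite /kpath; case: ltP => // ui.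
have iT : ptime p n i <= T by case/andP: (ptime_itv ni).
have uT : u < T by exact: lt_le_trans iT.
rewrite /step_path !indicE memNset; last by move=> /= uE; move: uT; rewrite uE ltxx.
rewrite !mulr0 !addr0; apply: eq_bigr => j _; rewrite !indicE.
have [uj|nuj] := pselect (`[ptime p n j, ptime p n j.+1[%classic u); last by rewrite memNset// !mulr0.
congr (_ * _); apply: xy; have /andP[-> _] := ptime_itv (ltn_ord j); rewrite /=.
apply: le_trans is_; apply: ptime_mono => //; move: uj; rewrite /= in_itv/= => /andP[ju _].
have := le_lt_trans ju ui; rewrite ptime_ltE ?(ltnW (ltn_ord j))//.
Qed.

Lemma qv_sum_agree x y s r n : (forall u, 0 <= u <= s -> x u = y u) -> r <= s ->
  qv_sum p x r n = qv_sum p y r n.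
Proof.
move=> xy rs; rewrite /qv_sum; apply: eq_bigr => j jr.
have [/andP[h1 _] /andP[h2 _]] := (ptime_itv (ltnW (ltn_ord j)), ptime_itv (ltn_ord j)).
have js : ptime p n j.+1 <= s by exact: le_trans rs.
rewrite !xy ?h1 ?h2 ?js//=; apply: le_trans js; apply/ltW; exact: ptime_lt.
Qed.

Lemma ratr_le1 (q : rat) : q <= 1 -> ratr q <= 1 :> R.
Proof. by move=> q1; rewrite -(rmorph1 (@ratr R)) ler_rat. Qed.

Lemma lidx0 n : lidx p n 0 = 0%N.
Proof.
apply/eqP; rewrite -leqn0 leqNgt; apply/negP => l0.
have n0 : (0 < psize p n)%N by apply: leq_trans l0 (lidx_le _ _ _).
have := ptime_lt n0; rewrite ptime_first ltNge => /negP; apply.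
by rewrite lidxP.
Qed.

Variables (U : set R) (F : R -> (R -> R) -> R) (sigma : R -> R).
Hypothesis (U_open : open U) (nF : non_anticipative U T F).

Lemma ito_drift_agree x y s r : s <= T -> cadlag U s x -> cadlag U s y ->
  (forall u, 0 <= u <= s -> x u = y u) -> r <= s ->
  ito_drift F sigma x r = ito_drift F sigma y r.
Proof.
move=> sT cx cy xy rs.
have sub u z : u <= s -> cadlag U s z -> cadlag U u z.
  move=> us [h1 h2 h3]; split=> v /andP[v0 vu].
  - by apply: h1; rewrite v0 (le_trans vu).
  - by apply: h2; rewrite v0 (lt_le_trans vu).
  - by apply: h3; rewrite v0 (le_trans vu).
have nvF : non_anticipative_before T U F by move=> u z z' /andP[u0 uT]; apply: nF; rewrite u0 ltW.
have nvvF := non_anticipative_vderiv U_open (non_anticipative_vderiv U_open nvF).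
rewrite /ito_drift; congr (_ + _ * _); apply: eq_Rintegral => u; rewrite inE/= in_itv/=.
  move=> /andP[u0 ur]; have us : u <= s by rewrite ltW// (lt_le_trans ur).
  apply: (non_anticipative_hderiv nF); rewrite ?u0 ?(lt_le_trans ur) ?(le_trans rs)//; try exact: sub.
  by move=> v /andP[v0 vu]; apply: xy; rewrite v0 (le_trans vu).
move=> /andP[u0 ur]; have us : u <= s by rewrite ltW// (lt_le_trans ur).
have xyu : x u = y u by apply: xy; rewrite (ltW u0).
rewrite xyu; apply: (f_equal (fun v => v * _)).
apply: nvvF; rewrite ?(ltW u0) ?(lt_le_trans ur) ?(le_trans rs)//; try exact: sub.
by move=> v /andP[v0 vu]; apply: xy; rewrite v0 (le_trans vu).
Qed.

Lemma ito_drift0 x : ito_drift F sigma x 0 = 0.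
Proof. by rewrite /ito_drift !set_itv_ge ?bnd_simp// !Rintegral_set0 mulr0 addr0. Qed.

(** For the path of a martingale [X] whose composition with [F] is a martingale,
    this is a discrete martingale in [j]; along a fixed path it tends to the
    drift as the partition is refined. *)
Definition compensated x n j : R :=
  F (ptime p n j) x - F 0 x - \sum_(0 <= i < j)
    vderiv F (ptime p n i) (kpath p x n (ptime p n i) (x (ptime p n i))) *
    (x (ptime p n i.+1) - x (ptime p n i)).

End Agreement.

Section LocalizedPath.
Context {R : realType} (T : R) (U : set R) (F : R -> (R -> R) -> R).
Notation mu := (@lebesgue_measure R).
Hypotheses (U_open : open U) (F_C12b : C12b U T F).
Variables (al be : R).
Hypothesis KU : `[al, be] `<=` U.
Variables (p : partition_seq T) (x : R -> R).
Hypotheses (x_cont : {within `[0, T], continuous x}) (T_gt0 : 0 < T).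
Variables (t : R) (sigma : R -> R).
Hypotheses (t_gt0 : 0 < t) (t_le : t <= T).
Hypothesis sigma_cont : continuous sigma.
Variables C G : R.
Hypothesis F_bound : bounded_derivatives T F al be C.
Hypothesis sigma_bound : forall v, al <= v <= be -> sigma v ^+ 2 <= G.
Hypothesis qv_cvg : forall q : rat, 0 <= q <= 1 ->
  qv_sum p x (ratr q * t) @ \oo -->
  \int[mu]_(u in `[0, ratr q * t]) (sigma (x u) ^+ 2).

Let drift := ito_drift F sigma x.
Let V n j := compensated p F x n j.

Let nF : non_anticipative U T F. Proof. by case: F_C12b => -[[]]. Qed.

Section StoppedPath.
Variables (q0 : rat).
Hypothesis q01 : 0 < q0 <= 1.
Let s := ratr q0 * t.
Hypothesis x_K : forall u, 0 <= u <= s -> al <= x u <= be.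
(** Stopping the path keeps it in the segment up to [T], without changing the
    functional and its derivatives before [s]. *)
Let z := stop s x.

Let s_gt0 : 0 < s.
Proof. by rewrite mulr_gt0// ltr0q; case/andP: q01. Qed.

Let s_le : s <= t.
Proof. by rewrite ler_piMl ?(ltW t_gt0)//; apply: ratr_le1; case/andP: q01. Qed.

Let sT : s <= T. Proof. exact: le_trans s_le t_le. Qed.

Let zx u : 0 <= u <= s -> x u = z u.
Proof. by move=> /andP[_ us]; rewrite /z /stop min_l. Qed.

Let z_K u : 0 <= u <= T -> al <= z u <= be.
Proof.
move=> /andP[u0 _]; rewrite /z /stop; apply: x_K.
by rewrite le_min u0 (ltW s_gt0)/= ge_min lexx orbT.
Qed.

Let z_cont : {within `[0, T], continuous z}.
Proof.
apply: eps_cont_itv => u e /andP[u0 uT] e0.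
have mT v : 0 <= v -> 0 <= Num.min v s <= T.
  by move=> v0; rewrite le_min v0 (ltW s_gt0)/= ge_min sT orbT.
have [eta eta0 H] := cont_itv_eps x_cont (mT u u0) e0.
exists eta => // v /andP[v0 vT] uv; rewrite /z /stop; apply: H; first exact: mT.
apply: le_lt_trans uv; case: (leP u s); case: (leP v s) => h1 h2 //; last first.
- by rewrite subrr normr0.
- have v_u : v <= u by exact: le_trans h1 (ltW h2).
  rewrite (@ger0_norm _ (s - v)) ?subr_ge0// (@ger0_norm _ (u - v)) ?subr_ge0//.
  by rewrite lerD2r ltW.
- have u_v : u <= v by exact: le_trans h2 (ltW h1).
  rewrite (@ler0_norm _ (u - s)) ?subr_le0// (@ler0_norm _ (u - v)) ?subr_le0//.
  by rewrite !opprB lerD2r ltW.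
Qed.

Let cadlag_x A r : (forall u, 0 <= u <= s -> A (x u)) -> r <= s -> cadlag A r x.
Proof.
move=> H rs; apply: (@cont_cadlag _ _ s) => //.
by apply: continuous_subspaceW x_cont; apply: subset_itvl; rewrite bnd_simp.
Qed.

Let x_U u : 0 <= u <= s -> U (x u).
Proof. by move=> /x_K h; apply: KU; rewrite /= in_itv. Qed.

Let cadlag_z r : r <= s -> cadlag U r z.
Proof.
move=> rs; apply: cadlag_sub KU _; apply: (cont_cadlag z_cont); last exact: le_trans sT.
by move=> u /z_K h; rewrite /= in_itv.
Qed.

Let F_zx r : 0 <= r <= s -> F r x = F r z.
Proof.
move=> /andP[r0 rs]; apply: nF; rewrite ?r0 ?(le_trans rs)//.
- exact: cadlag_x.
- exact: cadlag_z.
- by move=> u /andP[u0 ur]; apply: zx; rewrite u0 (le_trans ur).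
Qed.

Let drift_zx r : r <= s -> drift r = ito_drift F sigma z r.
Proof. by apply: ito_drift_agree; [exact: U_open|exact: nF|exact: sT|exact: cadlag_x|exact: cadlag_z|exact: zx]. Qed.

Let z_qv (q : rat) : 0 <= q <= 1 ->
  qv_sum p z (ratr q * s) @ \oo --> \int[mu]_(u in `[0, ratr q * s]) (sigma (z u) ^+ 2).
Proof.
move=> /andP[h1 h2]; have /andP[h3 h4] := q01.
have qs : ratr q * s <= s by rewrite ler_piMl ?(ltW s_gt0)//; exact: ratr_le1.
have qE : ratr (q * q0) * t = ratr q * s by rewrite rmorphM/= -mulrA.
rewrite (_ : (qv_sum p z (ratr q * s)) = qv_sum p x (ratr (q * q0) * t)); last first.
  by apply/funext => n; rewrite qE -(@qv_sum_agree _ _ p _ _ _ _ n zx qs).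
rewrite (_ : \int[mu]_(_ in _) _ = \int[mu]_(u in `[0, ratr (q * q0) * t]) (sigma (x u) ^+ 2)).
  by apply: qv_cvg; rewrite mulr_ge0 ?(ltW h3)//= mulr_ile1// ltW.
rewrite qE; apply: eq_Rintegral => u; rewrite inE/= in_itv/= => /andP[u0 us].
by rewrite zx// u0 (le_trans us).
Qed.

Let lidx_s n j : (j <= lidx p n s)%N -> ptime p n j <= s.
Proof.
move=> js; apply: le_trans (ptime_lidx p n (ltW s_gt0)).
by apply: ptime_mono => //; exact: lidx_le.
Qed.

Let V_zx n j : (j <= lidx p n s)%N -> V n j = compensated p F z n j.
Proof.
move=> js; have jn : (j <= psize p n)%N by exact: leq_trans js (lidx_le _ _ _).
have t0 i : (i <= j)%N -> 0 <= ptime p n i <= s.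
  move=> ij; have /andP[-> _] := ptime_itv (leq_trans ij jn).
  by rewrite lidx_s// (leq_trans ij).
rewrite /V /compensated (F_zx (t0 j (leqnn j))) (F_zx (r := 0)) ?lexx ?(ltW s_gt0)//.
congr (_ - _); apply: eq_big_nat => i /andP[_ ij].
rewrite -!zx ?t0// ?(ltnW ij)//; congr (_ * _).
by rewrite (kpath_agree _ zx)// ?(leq_trans (ltnW ij))//; case/andP: (t0 i (ltnW ij)).
Qed.

Lemma stopped_compensated_bound : exists N, forall n j, (N <= n)%N -> (j <= lidx p n s)%N ->
  `|V n j| <= C *+ 2 + C * T + C * (G * T + 1).
Proof.
have zG u : 0 <= u <= s -> sigma (z u) ^+ 2 <= G.
  by move=> /andP[u0 us]; apply/sigma_bound/z_K; rewrite u0 (le_trans us).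
have [N HN] := compensated_functional_bound F_C12b KU z_K z_cont T_gt0 s_gt0 sT sigma_cont
  F_bound z_qv zG.
by exists N => n j Nn js; rewrite V_zx//; exact: HN.
Qed.

Lemma stopped_drift_lipschitz r r' : 0 <= r -> r <= r' -> r' <= s ->
  `|drift r' - drift r| <= (C + C * G) * (r' - r).
Proof.
move=> r0 rr' r's; rewrite !drift_zx//; last exact: le_trans r's.
have zG u : 0 <= u <= s -> sigma (z u) ^+ 2 <= G.
  by move=> /andP[u0 us]; apply/sigma_bound/z_K; rewrite u0 (le_trans us).
exact: (ito_drift_lipschitz F_C12b KU p z_K z_cont T_gt0 s_gt0 sT sigma_cont F_bound zG).
Qed.

Lemma stopped_compensated_cvg : (fun n => V n (lidx p n s)) @ \oo --> drift s.
Proof.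
have H := nonanticipating_sum_cvg F_C12b KU z_K z_cont T_gt0 s_gt0 sT sigma_cont F_bound z_qv.
have HF : (fun n => F (ptime p n (lidx p n s)) z) @ \oo --> F s z.
  apply/cvg_seq_eps => e e0; have [[_ _ [lF _ _]] _] := F_C12b.
  have cz : cadlag U s z by exact: cadlag_z.
  have Is : `[0, T]%classic s by rewrite /= in_itv/= (ltW s_gt0).
  have [eta eta0 Heta] := lF s z e Is cz e0.
  have e20 : 0 < eta / 2 by rewrite divr_gt0.
  have [d d0 Hd] := unif_cont_itv z_cont e20.
  have m0 : 0 < Num.min d (eta / 2) by rewrite lt_min d0.
  have [N HN] := mesh_small p m0.
  exists N => n Nn; have sI : 0 <= s <= T by rewrite ltW.
  have := lidx_near sI m0 (HN n Nn); rewrite lt_min => /andP[nd ne].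
  have ls := ptime_lidx p n (ltW s_gt0).
  have /andP[l0 lT] := ptime_itv (lidx_le p n s).
  have -> : ptime p n (lidx p n s) = s - (s - ptime p n (lidx p n s)) by rewrite subKr.
  apply: Heta; rewrite ?subKr; first by rewrite subr_ge0 ls gerBl.
    exact: cadlag_z.
  apply: (@dinfty_lt _ _ _ _ _ (eta / 2)) => //; last by move: ne; lra.
  move=> u /andP[u0 us]; have uT : u <= T by exact: le_trans sT.
  case: (leP u (ptime p n (lidx p n s))) => h; first by rewrite subrr normr0 ltW.
  apply/ltW/Hd; rewrite ?u0 ?l0// gtr0_norm ?subr_gt0//.
  by apply: le_lt_trans nd; rewrite lerB.
rewrite (_ : (fun n => _) = (fun n => F (ptime p n (lidx p n s)) z - F 0 z -
  \sum_(0 <= i < lidx p n s) vderiv F (ptime p n i) (kpath p z n (ptime p n i) (z (ptime p n i))) *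
    (z (ptime p n i.+1) - z (ptime p n i)))); last first.
  by apply/funext => n; rewrite V_zx.
rewrite drift_zx// [X in _ --> X](_ : _ = F s z - F 0 z - (F s z - F 0 z - ito_drift F sigma z s)); last by ring.
by apply: cvgB => //; apply: cvgB => //; exact: cvg_cst.
Qed.

End StoppedPath.

Hypotheses (C_ge0 : 0 <= C) (G_ge0 : 0 <= G).

Let h m : R := t / m.+1%:R.
Let s m k : R := k%:R * h m.

Let h_gt0 m : 0 < h m. Proof. by rewrite divr_gt0. Qed.

Let gridE m k : s m k = ratr (k%:R / m.+1%:R) * t.
Proof. by rewrite rmorphM/= fmorphV/= !rmorph_nat /s /h mulrCA mulrC. Qed.

Let s_ge0 m k : 0 <= s m k. Proof. by rewrite mulr_ge0// ltW. Qed.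

Let s_le m k : (k <= m.+1)%N -> s m k <= t.
Proof.
move=> km; rewrite /s /h mulrCA ler_piMr ?(ltW t_gt0)//.
by rewrite ler_pdivrMr// mul1r ler_nat.
Qed.

Let s_mono m k l : (k <= l)%N -> s m k <= s m l.
Proof. by move=> kl; rewrite ler_wpM2r ?ler_nat// ltW. Qed.

Let V_0 n : V n 0 = 0.
Proof. by rewrite /V /compensated ptime_first big_nil subr0 subrr. Qed.

Let grid_rat m k : (0 < k)%N -> (k <= m.+1)%N -> 0 < (k%:R / m.+1%:R : rat) <= 1.
Proof. by move=> k0 km; rewrite divr_gt0 ?ltr0n//= ler_pdivrMr ?ltr0n// mul1r ler_nat. Qed.

(** Rational multiples of [t] suffice for the grid times, which keeps the almost
    sure convergence of the quadratic variation to countably many times. *)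
Lemma grid_compensated m : exists N, forall n k, (N <= n)%N -> (k <= m.+1)%N ->
  (forall u, 0 <= u <= s m k -> al <= x u <= be) ->
  `|V n (lidx p n (s m k)) - drift (s m k)| <= h m / 2 /\
  forall j, (j <= lidx p n (s m k))%N -> `|V n j| <= C *+ 2 + C * T + C * (G * T + 1).
Proof.
have L0 : 0 <= C *+ 2 + C * T + C * (G * T + 1).
  by rewrite !addr_ge0 ?mulrn_wge0 ?mulr_ge0 ?addr_ge0 ?mulr_ge0// ltW.
have h20 : 0 < h m / 2 by rewrite divr_gt0.
have /choice[N HN] : forall k, exists N, forall n, (N <= n)%N -> (k <= m.+1)%N ->
    (forall u, 0 <= u <= s m k -> al <= x u <= be) ->
    `|V n (lidx p n (s m k)) - drift (s m k)| <= h m / 2 /\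
    forall j, (j <= lidx p n (s m k))%N -> `|V n j| <= C *+ 2 + C * T + C * (G * T + 1).
  move=> k; have [kK|nkK] := pselect ((k <= m.+1)%N /\ forall u, 0 <= u <= s m k -> al <= x u <= be);
    last by exists 0%N => n _ km kK; exfalso; exact: nkK.
  case: kK => km kK; case: (posnP k) => [k0|k0].
    exists 0%N => n _ _ _; rewrite /s k0 mul0r lidx0 V_0 /drift ito_drift0 subrr normr0.
    by split; [exact: ltW|move=> j; rewrite leqn0 => /eqP ->; rewrite V_0 normr0].
  have r01 := grid_rat k0 km; rewrite gridE in kK.
  have [N1 HN1] := (cvg_seq_eps _ _).1 (stopped_compensated_cvg r01 kK) _ h20.
  have [N2 HN2] := stopped_compensated_bound r01 kK.
  exists (maxn N1 N2) => n; rewrite geq_max => /andP[n1 n2] _ _; rewrite gridE; split.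
    by rewrite distrC ltW// HN1.
  by move=> j; exact: HN2.
exists (\max_(k < m.+2) N k)%N => n k Nn km; apply: HN => //.
exact: leq_trans (leq_bigmax (Ordinal (km : (k < m.+2)%N))) Nn.
Qed.

Lemma grid_increment m : exists N, forall n k, (N <= n)%N -> (k < m.+1)%N ->
  (forall u, 0 <= u <= s m k.+1 -> al <= x u <= be) ->
  `|V n (lidx p n (s m k.+1)) - V n (lidx p n (s m k))| <= (C + C * G + 1) * h m.
Proof.
have [N HN] := grid_compensated m; exists N => n k Nn km kK.
have kK' u : 0 <= u <= s m k -> al <= x u <= be.
  by move=> /andP[u0 uk]; apply: kK; rewrite u0 (le_trans uk)// s_mono.
have [H1 _] := HN n k.+1 Nn km kK; have [H2 _] := HN n k Nn (ltnW km) kK'.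
have r01 := grid_rat (ltn0Sn k) km.
have kK2 := kK; rewrite gridE in kK2.
have H3 := stopped_drift_lipschitz r01 kK2 (s_ge0 m k) (s_mono m (leqnSn k)).
rewrite gridE in H3; have {}H3 := H3 (lexx _); rewrite -gridE in H3.
have E : s m k.+1 - s m k = h m by rewrite /s -natr1 mulrDl mul1r addrC addKr.
rewrite E in H3; move: H1 H2 H3.
rewrite !ler_norml => /andP[? ?] /andP[? ?] /andP[? ?]; apply/andP; split; lra.
Qed.

(** Over a grid step and a partition interval a continuous path moves by less than
    the distance between the ends of the two segments, so that an exit from the
    larger one is announced by the value at an earlier grid point outside the
    smaller one. *)
Lemma grid_escape (a a' : R) : al < a -> a' < be ->
  exists M, forall m, (M <= m)%N -> exists N, forall n k u, (N <= n)%N -> (k < m.+1)%N ->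
    0 <= u <= s m k.+1 -> ~ (al <= x u <= be) ->
    exists2 l, (l <= k)%N & ~ (a <= x (ptime p n (lidx p n (s m l))) <= a').
Proof.
move=> ala a'be.
have de0 : 0 < Num.min (a - al) (be - a') by rewrite lt_min !subr_gt0 ala.
have [d d0 Hd] := unif_cont_itv x_cont de0.
have d20 : 0 < d / 2 by rewrite divr_gt0.
have [M HM] := block_small t_gt0 d20.
exists M => m /HM hm; have [N HN] := mesh_small p d20.
exists N => n k u Nn km /andP[u0 uk] nK.
have [l lk /andP[lu ul]] : exists2 l, (l <= k)%N & s m l <= u <= s m l.+1.
  elim: k uk {km} => [|k IH] uk; first by exists 0%N => //; rewrite uk /s mul0r u0.
  have [uk'|ku] := leP u (s m k.+1); last by exists k.+1 => //; rewrite uk ltW.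
  by have [l lk H] := IH uk'; exists l => //; exact: leqW.
exists l => // aK; apply: nK.
have lm : (l.+1 <= m.+1)%N by exact: leq_ltn_trans lk km.
have sT : 0 <= s m l <= T by rewrite s_ge0 (le_trans (s_le (ltnW lm))).
have near := lidx_near sT d20 (HN n Nn).
have ls := ptime_lidx p n (s_ge0 m l).
have uT : u <= T by apply: le_trans ul (le_trans (s_le lm) t_le).
have E : s m l.+1 - s m l = h m by rewrite /s -natr1 mulrDl mul1r addrC addKr.
have := Hd u (ptime p n (lidx p n (s m l))) _ (ptime_itv (lidx_le p n _)).
rewrite u0 uT => /(_ isT); rewrite ger0_norm; last by rewrite subr_ge0 (le_trans ls).
have -> : u - ptime p n (lidx p n (s m l)) < d.
  move: near ul E hm; rewrite -/(h m); lra.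
move=> /(_ isT); rewrite lt_min !ltr_norml => /andP[/andP[? ?] /andP[? ?]].
by move: aK => /andP[? ?]; apply/andP; split; lra.
Qed.

End LocalizedPath.

(** * Vanishing of the drift along martingale paths *)

Lemma ae_forall_countable (R : realType) (d : measure_display) (Omega : measurableType d)
    (P : probability Omega R) (J : countType) (B : J -> Omega -> Prop) :
  (forall i, {ae P, forall w, B i w}) -> {ae P, forall w, forall i, B i w}.
Proof.
move=> H; have : forall n, {ae P, forall w, forall i, unpickle n = Some i -> B i w}.
  move=> n; case E : (unpickle n) => [i|]; last by apply: aeW => w i.
  by apply: filterS (H i) => w Bw j [<-].
move=> /ae_foralln; apply: filterS => w Hw i; exact: (Hw (pickle i) i (pickleK i)).
Qed.

Section ConditionalExpectation.
Context {R : realType} {d : measure_display} {Omega : measurableType d}.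
Variable P : probability Omega R.
Variable G : set (set Omega).
Hypotheses (sG : sigma_algebra setT G) (Gm : G `<=` measurable).

Local Notation Int f := (P.-integrable setT (EFin \o f)).

Lemma cond_exp_indic (h h' : Omega -> R) A : is_cond_exp P G h h' -> G A ->
  \int[P]_w (\1_A w * h' w) = \int[P]_w (\1_A w * h w).
Proof. by move=> [_ _ H] GA; rewrite -!Ex_restrict /Rintegral H. Qed.

Lemma cond_exp_increment (h h' : Omega -> R) A : is_cond_exp P G h h' -> Int h -> G A ->
  \int[P]_w (\1_A w * (h w - h' w)) = 0.
Proof.
move=> H Ih GA; have [_ Ih' _] := H; have mA := Gm GA.
rewrite (_ : (fun w => _) = (fun w => \1_A w * h w - \1_A w * h' w)); last first.
  by apply/funext => w; rewrite mulrBr.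
by rewrite RintegralB//; try exact: Int_indic; rewrite (cond_exp_indic H GA) subrr.
Qed.

(** Conditional Jensen inequality for the absolute value, splitting according
    to the sign of the conditional expectation. *)
Lemma cond_exp_norm_le (h h' : Omega -> R) A : is_cond_exp P G h h' -> Int h -> G A ->
  \int[P]_w (\1_A w * `|h' w|) <= \int[P]_w (\1_A w * `|h w|).
Proof.
move=> H Ih GA; have [mh' Ih' _] := H.
pose B := [set w | 0 < h' w]; have GB : G B by exact: measurable_wrt_gt.
have GAB : G (A `&` B) by exact: sigma_setI.
have GAD : G (A `\` B) by exact: sigma_setD.
have E : \int[P]_w (\1_A w * `|h' w|) =
    \int[P]_w (\1_(A `&` B) w * h w - \1_(A `\` B) w * h w).
  rewrite RintegralB//; try by apply: Int_indic => //; exact: Gm.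
  rewrite -!(cond_exp_indic H)// -RintegralB//; try by apply: Int_indic => //; exact: Gm.
  apply: eq_Rintegral => w _; rewrite !indicE.
  have [Aw|nA] := pselect (A w); last by rewrite !memNset ?mul0r ?subr0// => -[].
  rewrite (mem_set Aw); have [Bw|nB] := pselect (B w).
    by rewrite mem_set ?memNset ?mul0r ?subr0 ?gtr0_norm// => -[].
  rewrite memNset ?mem_set ?mul0r ?sub0r ?mul1r//; last by move=> [].
  by rewrite ler0_norm// leNgt; apply/negP.
rewrite E; apply: Ex_le.
- by apply: integrable_sub => //; apply: Int_indic => //; exact: Gm.
- by apply: Int_indic; [exact: integrable_norm|exact: Gm].
move=> w; rewrite !indicE.
have [Aw|nA] := pselect (A w); last first.
  by rewrite !memNset ?mul0r ?subr0// => -[].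
rewrite (mem_set Aw) mul1r; have [Bw|nB] := pselect (B w).
  by rewrite mem_set ?memNset ?mul0r ?subr0 ?mul1r ?ler_norm// => -[].
rewrite memNset ?mem_set ?mul0r ?sub0r ?mul1r//; last by move=> [].
by rewrite -normrN ler_norm.
Qed.

End ConditionalExpectation.

Section PathRange.
Context {R : realType}.

Lemma path_range (x : R -> R) (s : R) : 0 <= s -> {within `[0, s], continuous x} ->
  exists mn mx, [/\ mn <= mx, forall u, 0 <= u <= s -> mn <= x u <= mx &
    forall v, mn <= v <= mx -> exists2 u, 0 <= u <= s & x u = v].
Proof.
move=> s0 cx; have [c1 c1s H1] := EVT_min s0 cx; have [c2 c2s H2] := EVT_max s0 cx.
move: c1s c2s; rewrite !in_itv/= => /andP[c10 c1s] /andP[c20 c2s].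
exists (x c1), (x c2); split.
- by apply: H2; rewrite in_itv/= c10.
- by move=> u us; rewrite H1 ?H2 ?in_itv.
have sub l r : 0 <= l -> r <= s -> {within `[l, r], continuous x}.
  by move=> l0 rs; apply: continuous_subspaceW cx; apply: subset_itv; rewrite bnd_simp.
move=> v /andP[v1 v2]; have [c12|c21] := leP c1 c2.
  have [|u] := IVT c12 (sub _ _ c10 c2s) (v := v).
    by rewrite ge_min le_max v1 v2 orbT.
  rewrite in_itv/= => /andP[u1 u2] E; exists u => //.
  by rewrite (le_trans c10)//= (le_trans u2).
have [|u] := IVT (ltW c21) (sub _ _ c20 c1s) (v := v).
  by rewrite ge_min le_max v1 v2 orbT.
rewrite in_itv/= => /andP[u1 u2] E; exists u => //.
by rewrite (le_trans c20)//= (le_trans u2).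
Qed.

Lemma sqr_bounded_on_segment (g : R -> R) (al be : R) : continuous g ->
  exists2 G : R, 0 <= G & forall v, al <= v <= be -> g v ^+ 2 <= G.
Proof.
move=> cg; have [ab|ba] := leP al be; last first.
  exists 0 => // v /andP[h1 h2]; have := le_lt_trans (le_trans h1 h2) ba.
  by rewrite ltxx.
have cs : {within `[al, be], continuous (fun v : R => g v ^+ 2)}.
  by apply: continuous_subspaceT => v; apply: cvgM; exact: cg.
have [v0 _ Hv0] := EVT_max ab cs; exists (g v0 ^+ 2); first exact: sqr_ge0.
by move=> v Hv; apply: Hv0; rewrite in_itv.
Qed.

Lemma segment_enlarge (U : set R) (mn mx : R) : open U -> mn <= mx -> `[mn, mx] `<=` U ->
  exists al a a' be : rat, [/\ ratr al < (ratr a : R), ratr a <= mn, mx <= ratr a',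
    ratr a' < (ratr be : R) & `[ratr al, ratr be] `<=` U].
Proof.
move=> oU mnx KU.
have Umn : U mn by apply: KU; rewrite /= in_itv/= lexx.
have Umx : U mx by apply: KU; rewrite /= in_itv/= lexx andbT.
have [d1 d10 H1] := open_shift oU Umn; have [d2 d20 H2] := open_shift oU Umx.
have i1 : mn - d1 < mn - d1 / 2 by lra.
have i2 : mn - d1 / 2 < mn by lra.
have i3 : mx < mx + d2 / 2 by lra.
have i4 : mx + d2 / 2 < mx + d2 by lra.
have [al] := rat_in_itvoo i1; have [a] := rat_in_itvoo i2.
have [a'] := rat_in_itvoo i3; have [be] := rat_in_itvoo i4.
rewrite !in_itv/= => /andP[b1 b2] /andP[a'1 a'2] /andP[a1 a2] /andP[al1 al2].
exists al, a, a', be; split; [lra|lra|lra|lra|].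
move=> v; rewrite /= in_itv/= => /andP[v1 v2].
have [vm|mv] := ltP v mn.
  by rewrite (_ : v = mn + (v - mn)); [apply: H1; rewrite ltr_norml; lra|ring].
have [mv'|vm] := ltP mx v.
  by rewrite (_ : v = mx + (v - mx)); [apply: H2; rewrite ltr_norml; lra|ring].
by apply: KU; rewrite /= in_itv/= mv.
Qed.

End PathRange.

Section MartingaleFunctional.
Context {R : realType} (T : R) (U : set R) (F : R -> (R -> R) -> R).
Notation mu := (@lebesgue_measure R).
Hypotheses (T_gt0 : 0 < T) (U_open : open U) (F_C12b : C12b U T F).
Variables (p : partition_seq T) (sigma : R -> R).
Hypothesis sigma_cont : continuous sigma.
Context {d : measure_display} {Omega : measurableType d}.
Variables (P : probability Omega R) (Ft : R -> set (set Omega)).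
Hypothesis Ft_usual : usual_conditions P T Ft.
Variables (X Y : R -> Omega -> R).
Hypothesis X_cont : forall w, {within `[0, T], continuous (X ^~ w)}.
Hypotheses (X_mart : martingale P T Ft X) (Y_mart : martingale P T Ft Y).
Hypothesis Y_F : forall s, 0 <= s <= T -> {ae P, forall w, Y s w = F s (X ^~ w)}.
Variable t : R.
Hypotheses (t_gt0 : 0 < t) (t_le : t <= T).

Local Notation Int f := (P.-integrable setT (EFin \o f)).

Let Ft_sigma s : 0 <= s <= T -> sigma_algebra setT (Ft s) /\ Ft s `<=` measurable.
Proof. by case: Ft_usual => _ + _ _ _; apply. Qed.

Let Ft_incr r s : 0 <= r -> r <= s -> s <= T -> Ft r `<=` Ft s.
Proof. by case: Ft_usual => _ _ + _ _; apply. Qed.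

Section Localized.
Variables (al be a a' C G : R).
Hypothesis KU : `[al, be] `<=` U.
Hypotheses (al_a : al < a) (a'_be : a' < be).
Hypothesis F_bound : bounded_derivatives T F al be C.
Hypothesis sigma_bound : forall v, al <= v <= be -> sigma v ^+ 2 <= G.
Hypotheses (C_ge0 : 0 <= C) (G_ge0 : 0 <= G).

Let N n := lidx p n t.
Let tm n i := ptime p n i.
Let Gf n i := Ft (tm n i).

Let tm_itv n i : (i <= N n)%N -> 0 <= tm n i <= T.
Proof. by move=> iN; apply: ptime_itv; exact: leq_trans iN (lidx_le _ _ _). Qed.

Let tm_lt n i : (i < N n)%N -> 0 <= tm n i < T.
Proof.
move=> iN; have /andP[h1 _] := tm_itv (ltnW iN); rewrite /tm in h1 *; rewrite h1/=.
have ni : (i < psize p n)%N by exact: leq_trans iN (lidx_le _ _ _).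
by apply: lt_le_trans (ptime_lt ni) _; case/andP: (ptime_itv ni).
Qed.

Let G_sigma n i : (i <= N n)%N -> sigma_algebra setT (Gf n i) /\ Gf n i `<=` measurable.
Proof. by move=> /tm_itv; exact: Ft_sigma. Qed.

Let tm_mono n i j : (i <= j)%N -> (j <= N n)%N -> tm n i <= tm n j.
Proof. by move=> ij jN; apply: ptime_mono => //; exact: leq_trans jN (lidx_le _ _ _). Qed.

Let G_incr n i j : (i <= j)%N -> (j <= N n)%N -> Gf n i `<=` Gf n j.
Proof.
move=> ij jN; have /andP[i0 _] := tm_itv (leq_trans ij jN); have /andP[_ jT] := tm_itv jN.
by apply: Ft_incr => //; exact: tm_mono.
Qed.

Let X_meas n i j : (i <= j)%N -> (j <= N n)%N -> measurable_wrt (Gf n j) (X (tm n i)).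
Proof.
move=> ij jN; apply: measurable_wrt_sub (G_incr ij jN) _.
by case: (X_mart.1 _ (tm_itv (leq_trans ij jN))).
Qed.

Let Y_meas n i j : (i <= j)%N -> (j <= N n)%N -> measurable_wrt (Gf n j) (Y (tm n i)).
Proof.
move=> ij jN; apply: measurable_wrt_sub (G_incr ij jN) _.
by case: (Y_mart.1 _ (tm_itv (leq_trans ij jN))).
Qed.

Let X_int n i : (i <= N n)%N -> Int (X (tm n i)).
Proof. by move=> /tm_itv /(X_mart.1)[]. Qed.

Let Y_int n i : (i <= N n)%N -> Int (Y (tm n i)).
Proof. by move=> /tm_itv /(Y_mart.1)[]. Qed.

Let inside n i : set Omega := [set w | forall j, (j <= i)%N -> al <= X (tm n j) w <= be].

Let inside_meas n i : (i <= N n)%N -> Gf n i (inside n i).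
Proof.
move=> iN; have sG := (G_sigma iN).1.
rewrite (_ : inside n i = \bigcap_j [set w | (j <= i)%N -> al <= X (tm n j) w <= be]); last first.
  by apply/seteqP; split=> [w H j _|w H j]; [exact: H|exact: H].
apply: sigma_bigcap => // j; have [ji|ij] := leqP j i; last first.
  by rewrite (_ : [set _ | _] = setT); [exact: sigma_setT|apply/seteqP; split].
have := measurable_wrt_itv (G := Gf n i) al be (X_meas ji iN).
by congr (Gf n i); apply/seteqP; split=> w /= H => [_|]; [|exact: H].
Qed.

Let xi n i w : R := vderiv F (tm n i) (kpath p (X ^~ w) n (tm n i) (X (tm n i) w)).

Let kpath_itv n i w : (i <= N n)%N -> inside n i w ->
  cadlag `[al, be] (tm n i) (kpath p (X ^~ w) n (tm n i) (X (tm n i) w)).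
Proof.
move=> iN Hw; have ip : (i <= psize p n)%N by exact: leq_trans iN (lidx_le _ _ _).
have tI := tm_itv iN.
apply: cadlag_kpath => //; first by case/andP: tI.
  by rewrite /= in_itv/=; exact: Hw.
move=> j jp ji; rewrite /= in_itv/=; apply: Hw.
by move: ji; rewrite /tm ptime_ltE// ltnW.
Qed.

Let xi_bound n i w : (i < N n)%N -> `|\1_(inside n i) w * xi n i w| <= C.
Proof.
move=> iN; rewrite indicE; have [Hw|nH] := pselect (inside n i w); last first.
  by rewrite memNset// mul0r normr0.
rewrite mem_set// mul1r; have [_ _ H _] := F_bound; apply: H; first exact: tm_lt.
by apply: kpath_itv => //; exact: ltnW.
Qed.

Let xi_meas n i : (i < N n)%N -> measurable_wrt (Gf n i) (fun w => \1_(inside n i) w * xi n i w).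
Proof.
move=> iN; have iN' := ltnW iN; have [[_ _ [_ lv _]] _] := F_C12b.
apply: (@measurable_wrt_local _ _ _ _ (G_sigma iN').1 i (fun j => X (tm n j))).
- by move=> j ji; exact: X_meas.
- exact: inside_meas.
move=> w0 e Hw0 e0.
have /andP[t0 tT] := tm_lt iN.
have It : `[0, T[%classic (tm n i) by rewrite /= in_itv/= t0.
have cw0 : cadlag U (tm n i) (kpath p (X ^~ w0) n (tm n i) (X (tm n i) w0)).
  by apply: cadlag_sub KU _; exact: kpath_itv.
have [eta eta0 Heta] := lv _ _ e It cw0 e0.
have e20 : 0 < eta / 2 by rewrite divr_gt0.
exists (eta / 2) => // w Hw HX; rewrite distrC.
have := Heta 0 (kpath p (X ^~ w) n (tm n i) (X (tm n i) w)); rewrite subr0; apply.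
- by rewrite lexx.
- by apply: cadlag_sub KU _; exact: kpath_itv.
apply: (@dinfty_lt _ _ _ _ _ (eta / 2)) => //; last by rewrite subrr; lra.
move=> u /andP[u0 ut]; rewrite min_l//.
have ip : (i <= psize p n)%N by exact: leq_trans iN' (lidx_le _ _ _).
rewrite /kpath; case: ltP => [ui|iu]; last by rewrite distrC ltW// HX.
have uT : u < T by exact: lt_trans tT.
have [j jn juj] := ptime_block p n u0 uT.
rewrite !(step_pathE _ jn juj) distrC ltW// HX//.
case/andP: juj => ju _; have := le_lt_trans ju ui; rewrite ptime_ltE// ltnW//.
Qed.

(** The cut-off makes the integrand bounded; it is invisible until the path
    leaves [[al, be]], where the stopping rule acts. *)
Let V n i w : R := Y (tm n i) w - Y 0 w -
  \sum_(0 <= j < i) \1_(inside n j) w * xi n j w * (X (tm n j.+1) w - X (tm n j) w).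
Let Q n i w : R := `|Y (tm n i) w| + C * `|X (tm n i) w|.
Let QT w : R := `|Y T w| + C * `|X T w|.

Let V0 n w : V n 0 w = 0.
Proof. by rewrite /V /tm ptime_first big_nil subr0 subrr. Qed.

Let xidX_int n j : (j < N n)%N ->
  Int (fun w => \1_(inside n j) w * xi n j w * (X (tm n j.+1) w - X (tm n j) w)).
Proof.
move=> jN; apply: (@Int_mul _ _ _ P (fun w => X (tm n j.+1) w - X (tm n j) w)
   (fun w => \1_(inside n j) w * xi n j w) C).
- by apply: integrable_sub => //; apply: X_int => //; exact: ltnW.
- apply: measurable_wrt_measurable_fun (xi_meas jN); exact: (G_sigma (ltnW jN)).2.
- by move=> w; exact: xi_bound.
Qed.

Let V_meas n i : (i <= N n)%N -> measurable_wrt (Gf n i) (V n i) /\ Int (V n i).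
Proof.
move=> iN; have sG := (G_sigma iN).1.
have E0 : Y 0 = Y (tm n 0) by rewrite /tm ptime_first.
split.
  apply: measurable_wrtB => //.
    by apply: measurable_wrtB => //; rewrite ?E0; exact: Y_meas.
  apply: measurable_wrt_sum => // j ji; have jN := leq_trans ji iN.
  apply: measurable_wrtM => //.
    by apply: measurable_wrt_sub (xi_meas jN); apply: G_incr => //; exact: ltnW.
  by apply: measurable_wrtB => //; apply: X_meas => //; exact: ltnW.
apply: integrable_sub => //; last first.
  by apply: Int_sum => j ji; apply: xidX_int; exact: leq_trans iN.
by apply: integrable_sub => //; rewrite ?E0; apply: Y_int.
Qed.

Let V_step n i w : V n i.+1 w - V n i w = (Y (tm n i.+1) w - Y (tm n i) w) -
  \1_(inside n i) w * xi n i w * (X (tm n i.+1) w - X (tm n i) w).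
Proof. by rewrite /V big_nat_recr//=; ring. Qed.

Let cond_tm M n i : martingale P T Ft M -> (i < N n)%N ->
  is_cond_exp P (Gf n i) (M (tm n i.+1)) (M (tm n i)).
Proof.
move=> HM iN; have /andP[i0 _] := tm_itv (ltnW iN); have /andP[_ iT] := tm_itv iN.
by apply: HM.2 => //; exact: tm_mono.
Qed.

Let V_mart n i A : (i < N n)%N -> Gf n i A ->
  \int[P]_w (\1_A w * (V n i.+1 w - V n i w)) = 0.
Proof.
move=> iN GA; have iN' := ltnW iN; have [sG mG] := G_sigma iN'.
have mA := mG _ GA.
have IY : Int (fun w => Y (tm n i.+1) w - Y (tm n i) w).
  by apply: integrable_sub => //; exact: Y_int.
have IX : Int (fun w => X (tm n i.+1) w - X (tm n i) w).
  by apply: integrable_sub => //; exact: X_int.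
pose z w : R := \1_A w * (\1_(inside n i) w * xi n i w).
rewrite (_ : (fun w => _) = (fun w => \1_A w * (Y (tm n i.+1) w - Y (tm n i) w) -
    z w * (X (tm n i.+1) w - X (tm n i) w))); last first.
  by apply/funext => w; rewrite V_step /z; ring.
have mz : measurable_wrt (Gf n i) z.
  by apply: measurable_wrtM; [|exact: measurable_wrt_indic|exact: xi_meas].
have zC w : `|z w| <= C.
  rewrite normrM; apply: le_trans (xi_bound w iN).
  by rewrite ler_piMl// indicE ger0_norm// lern1 leq_b1.
rewrite RintegralB//; last 2 first.
- exact: Int_indic.
- by apply: (@Int_mul _ _ _ _ _ _ C) => //; exact: measurable_wrt_measurable_fun mz.
rewrite (cond_exp_increment mG (cond_tm Y_mart iN))//; last exact: Y_int.
rewrite (Ex_orthogonal sG mG IX _ mz zC) ?subr0// => B GB.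
by apply: (cond_exp_increment mG (cond_tm X_mart iN)) => //; exact: X_int.
Qed.

Let norm_comp_meas n i (h : Omega -> R) : (i <= N n)%N -> measurable_wrt (Gf n i) h ->
  measurable_wrt (Gf n i) (fun w => `|h w|).
Proof.
move=> iN mh; apply: (measurable_wrt_comp (G_sigma iN).1 (g := fun v => `|v|)) mh.
by move=> v; exact: norm_continuous.
Qed.

Let Q_meas n i : (i <= N n)%N -> measurable_wrt (Gf n i) (Q n i) /\ Int (Q n i).
Proof.
move=> iN; have sG := (G_sigma iN).1; split.
  apply: measurable_wrtD => //; first by apply: norm_comp_meas => //; exact: Y_meas.
  apply: measurable_wrtM => //; first exact: measurable_wrt_cst.
  by apply: norm_comp_meas => //; exact: X_meas.
apply: integrable_add => //; first exact: integrable_norm (Y_int iN).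
by apply: integrable_scale => //; exact: integrable_norm (X_int iN).
Qed.

Let Q_ge0 n i w : 0 <= Q n i w.
Proof. by rewrite addr_ge0// mulr_ge0. Qed.

Let VQ n i w : (i < N n)%N -> `|V n i.+1 w - V n i w| <= Q n i.+1 w + Q n i w.
Proof.
move=> iN; rewrite V_step; apply: le_trans (ler_normB _ _) _.
rewrite normrM /Q addrACA; apply: lerD; first exact: ler_normB.
rewrite -mulrDr; apply: ler_pM => //; first exact: xi_bound.
exact: ler_normB.
Qed.

Let T_itv : 0 <= T <= T. Proof. by rewrite lexx ltW. Qed.

Let QT_int : Int QT.
Proof.
apply: integrable_add => //; first exact: integrable_norm (Y_mart.1 _ T_itv).2.
by apply: integrable_scale => //; exact: integrable_norm (X_mart.1 _ T_itv).2.
Qed.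

Let QT_ge0 w : 0 <= QT w.
Proof. by rewrite addr_ge0// mulr_ge0. Qed.

Let Q_sub n i A : (i <= N n)%N -> Gf n i A ->
  \int[P]_w (\1_A w * Q n i w) <= \int[P]_w (\1_A w * QT w).
Proof.
move=> iN GA; have [sG mG] := G_sigma iN; have mA := mG _ GA.
have /andP[i0 iT] := tm_itv iN.
have H M : martingale P T Ft M -> \int[P]_w (\1_A w * `|M (tm n i) w|) <= \int[P]_w (\1_A w * `|M T w|).
  move=> HM; apply: (cond_exp_norm_le sG mG) => //; first exact: HM.2.
  exact: (HM.1 _ T_itv).2.
have IM M s : martingale P T Ft M -> 0 <= s <= T -> Int (fun w => \1_A w * `|M s w|).
  by move=> HM sT; apply: Int_indic => //; exact: integrable_norm (HM.1 _ sT).2.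
have E s : 0 <= s <= T -> \int[P]_w (\1_A w * (`|Y s w| + C * `|X s w|)) =
    \int[P]_w (\1_A w * `|Y s w|) + C * \int[P]_w (\1_A w * `|X s w|).
  move=> sT; rewrite -RintegralZl//; last exact: IM.
  rewrite -RintegralD//; [|exact: IM|by apply: integrable_scale => //; exact: IM].
  by apply: eq_Rintegral => w _; ring.
rewrite /Q /QT !E//; last exact: tm_itv.
by apply: lerD; [exact: H|rewrite ler_wpM2l// H].
Qed.

Let b m n k := lidx p n (k%:R * (t / m.+1%:R)).
(** The bound of [compensated_functional_bound] on [V], plus the bound on [Q]
    while the path stays in [[al, be]]. *)
Let L : R := C *+ 2 + C * T + C * (G * T + 1) + (C + C * (`|al| + `|be|)).
(** The Lipschitz constant of the drift, with 1 added for the distance between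
    [V] and the drift at the two ends of a grid interval. *)
Let c : R := (C + C * G + 1) * t.

Let b_mono m n k : (b m n k <= b m n k.+1)%N.
Proof. by apply: lidx_mono; rewrite ler_wpM2r ?ler_nat// divr_ge0// ltW. Qed.

Let b0 m n : b m n 0 = 0%N.
Proof. by rewrite /b mul0r lidx0. Qed.

Let b_m m n : b m n m.+1 = N n.
Proof. by rewrite /b mulrCA divff// mulr1. Qed.

Let b_le m n k l : (k <= l)%N -> (b m n k <= b m n l)%N.
Proof.
elim: l => [|l IH]; first by rewrite leqn0 => /eqP ->.
by rewrite leq_eqVlt => /predU1P[->//|]; rewrite ltnS => /IH h; exact: leq_trans h (b_mono m n l).
Qed.

Let c_ge0 : 0 <= c.
Proof. by rewrite mulr_ge0 ?addr_ge0 ?mulr_ge0// ltW. Qed.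

Let L_ge0 : 0 <= L.
Proof. by rewrite !addr_ge0 ?mulrn_wge0 ?mulr_ge0 ?addr_ge0 ?mulr_ge0// ltW. Qed.

(** Indices at which the stopping rule lets the martingale continue: the path
    is in [[al, be]] and, at the grid points, in the smaller interval
    [[a, a']]; nothing has become too large, and the increment over the last
    grid interval has the size predicted for a path that stays inside. *)
Let good m n i : set Omega := [set w |
  [/\ al <= X (tm n i) w <= be, `|V n i w| <= L, Q n i w <= L,
      forall k, b m n k = i -> a <= X (tm n i) w <= a' &
      forall k, (k < m.+1)%N -> b m n k.+1 = i ->
        `|V n (b m n k.+1) w - V n (b m n k) w| <= c / m.+1%:R]].

Let sigma_imply (S : set (set Omega)) (B : Prop) (A : set Omega) : sigma_algebra setT S ->
  (B -> S A) -> S [set w | B -> A w].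
Proof.
move=> sS H; have [HB|nB] := pselect B.
  rewrite (_ : [set w | B -> A w] = A); first exact: H.
  by apply/seteqP; split=> w h; [exact: h|move=> _].
rewrite (_ : [set w | B -> A w] = setT); first exact: sigma_setT.
by apply/seteqP; split=> w _ // HB; exfalso; exact: nB.
Qed.

Let good_meas m n i : (i <= N n)%N -> Gf n i (good m n i).
Proof.
move=> iN; have sG := (G_sigma iN).1.
pose S1 := [set w | al <= X (tm n i) w <= be] `&` [set w | `|V n i w| <= L] `&` [set w | Q n i w <= L].
pose S2 := \bigcap_k [set w | b m n k = i -> a <= X (tm n i) w <= a'].
pose S3 := \bigcap_k [set w | ((k < m.+1)%N /\ b m n k.+1 = i) ->
        `|V n (b m n k.+1) w - V n (b m n k) w| <= c / m.+1%:R].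
rewrite (_ : good m n i = S1 `&` S2 `&` S3); last first.
  apply/seteqP; split=> w.
    move=> [h1 h2 h3 h4 h5]; do ![split => //]; first by move=> k _; exact: h4.
    by move=> k _ [km bi]; exact: h5.
  move=> [[[[h1 h2] h3] h4] h5]; split=> //; first by move=> k; exact: h4.
  by move=> k km bi; exact: h5.
apply: sigma_setI => //; first apply: sigma_setI => //.
- apply: sigma_setI => //; first apply: sigma_setI => //.
  + by apply: measurable_wrt_itv; exact: X_meas.
  + by apply: measurable_wrt_le; apply: norm_comp_meas => //; case: (V_meas iN).
  + by apply: measurable_wrt_le; case: (Q_meas iN).
- apply: sigma_bigcap => // k; apply: sigma_imply => // _.
  by apply: measurable_wrt_itv; exact: X_meas.
- apply: sigma_bigcap => // k; apply: sigma_imply => // -[km bi].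
  apply: measurable_wrt_le; apply: norm_comp_meas => //; apply: measurable_wrtB => //.
    by rewrite bi; case: (V_meas iN).
  have bk : (b m n k <= i)%N by rewrite -bi.
  by apply: measurable_wrt_sub (V_meas (leq_trans bk iN)).1; exact: G_incr.
Qed.

Let Om : set Omega := [set w |
  (forall n i, (i <= psize p n)%N -> Y (tm n i) w = F (tm n i) (X ^~ w)) /\
  (forall q : rat, 0 <= q <= 1 -> qv_sum p (X ^~ w) (ratr q * t) @ \oo -->
     \int[mu]_(u in `[0, ratr q * t]) (sigma (X u w) ^+ 2))].

Let V_compensated n j w : Om w -> (j <= N n)%N ->
  (forall i, (i < j)%N -> al <= X (tm n i) w <= be) -> V n j w = compensated p F (X ^~ w) n j.
Proof.
move=> [HY _] jN HX; rewrite /V /compensated HY; last exact: leq_trans jN (lidx_le _ _ _).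
have -> : Y 0 w = F 0 (X ^~ w) by have := HY n 0%N (leq0n _); rewrite /tm ptime_first.
congr (_ - _); apply: eq_big_nat => i /andP[_ ij]; rewrite indicE mem_set ?mul1r//.
by move=> l li; apply: HX; exact: leq_ltn_trans ij.
Qed.

Let inside_until m w k := forall u, 0 <= u <= k%:R * (t / m.+1%:R) -> al <= X u w <= be.

Let tm_b m n k j : (k <= m.+1)%N -> (j <= b m n k)%N -> 0 <= tm n j <= k%:R * (t / m.+1%:R).
Proof.
move=> km jb; have jN : (j <= N n)%N by rewrite -(b_m m) (leq_trans jb)// b_le.
have /andP[-> _] := tm_itv jN; rewrite /=.
have s0 : 0 <= k%:R * (t / m.+1%:R) by rewrite mulr_ge0// divr_ge0// ltW.
by apply: le_trans (ptime_lidx p n s0); apply: ptime_mono => //; exact: lidx_le.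
Qed.

Let base_good m w : Om w -> exists n0, forall n k, (n0 <= n)%N -> (k <= m.+1)%N ->
  inside_until m w k -> forall j, (j <= b m n k)%N ->
  [/\ al <= X (tm n j) w <= be, `|V n j w| <= L & Q n j w <= L].
Proof.
move=> Ow; have [HY Hqv] := Ow.
have [n0 Hn0] := grid_compensated U_open F_C12b KU (@X_cont w) T_gt0 t_gt0 t_le sigma_cont
  F_bound sigma_bound Hqv C_ge0 G_ge0 m.
exists n0 => n k n0n km wk j jb.
have jN : (j <= N n)%N by rewrite -(b_m m) (leq_trans jb)// b_le.
have XK i : (i <= j)%N -> al <= X (tm n i) w <= be.
  by move=> ij; apply: wk; exact: tm_b (leq_trans ij jb).
have [_ HV] := Hn0 n k n0n km wk.
split; first exact: XK.
  rewrite V_compensated//; last by move=> i /ltnW; exact: XK.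
  apply: le_trans (HV j jb) _; rewrite lerDl.
  by rewrite addr_ge0// mulr_ge0// addr_ge0.
apply: (@le_trans _ _ (C + C * (`|al| + `|be|))); last first.
  by rewrite lerDr !addr_ge0 ?mulrn_wge0 ?mulr_ge0 ?addr_ge0 ?mulr_ge0// ltW.
apply: lerD.
  rewrite HY; last exact: leq_trans jN (lidx_le _ _ _).
  have [HF _ _ _] := F_bound; apply: HF; first exact: tm_itv.
  apply: (@cont_cadlag _ _ (tm n j)) => //.
    apply: continuous_subspaceW (@X_cont w); apply: subset_itvl; rewrite bnd_simp.
    by case/andP: (tm_itv jN).
  move=> u /andP[u0 uj]; rewrite /= in_itv/=; apply: wk; rewrite u0 (le_trans uj)//.
  by case/andP: (tm_b km jb).
apply: ler_wpM2l => //; have /andP[h1 h2] := XK j (leqnn j).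
have := ler_norm al; have := ler_norm be; have := ler_norm (- al); have := ler_norm (- be).
by rewrite !normrN ler_norml => *; apply/andP; split; lra.
Qed.

Let good_upto_all (g : nat -> set Omega) j w : (forall i, (i <= j)%N -> g i w) -> good_upto g j w.
Proof.
elim: j => [|j IH] H /=; first exact: H.
by split; [apply: IH => i ij; apply: H; exact: leqW|exact: H].
Qed.

(** An increment over a grid interval is small if the path stays in [[al, be]] up
    to the end of the interval, since [V] is then close to the drift; otherwise
    the path has been stopped at an earlier grid point. *)
Let not_bad w : Om w -> exists M, forall m, (M <= m)%N -> exists n0, forall n, (n0 <= n)%N ->
  ~ bad (V n) (good m n) m.+1 (b m n) (c / m.+1%:R) w.
Proof.
move=> Ow; have [HY Hqv] := Ow.
have [M HM] := grid_escape p (@X_cont w) t_gt0 t_le al_a a'_be.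
exists M => m /HM[n1 Hn1].
have [n2 Hn2] := base_good m Ow.
have [n3 Hn3] := grid_increment U_open F_C12b KU (@X_cont w) T_gt0 t_gt0 t_le sigma_cont
  F_bound sigma_bound Hqv C_ge0 G_ge0 m.
exists (maxn n1 (maxn n2 n3)) => n; rewrite !geq_max => /and3P[nn1 nn2 nn3] [k km].
apply/negP; rewrite -leNgt.
have [gk|ngk] := pselect (good_upto (good m n) (b m n k) w); last first.
  by rewrite (stopped_after _ (b_mono m n k) ngk) subrr normr0 divr_ge0.
have kb : (b m n k.+1 <= N n)%N by rewrite -(b_m m) b_le.
have [wK|nK] := pselect (inside_until m w k.+1); last first.
  have [u [uk nu]] : exists u, 0 <= u <= k.+1%:R * (t / m.+1%:R) /\ ~ (al <= X u w <= be).
    by apply: contrapT => H; apply: nK => u uk; apply: contrapT => nu; apply: H; exists u.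
  have [l lk nl] := Hn1 n k u nn1 km uk nu.
  exfalso; apply: nl.
  by have [_ _ _ + _] := good_upto_good (good_upto_le (b_le m n lk) gk); apply.
have XK j : (j <= b m n k.+1)%N -> al <= X (tm n j) w <= be.
  by move=> jb; case: (Hn2 n k.+1 nn2 km wK j jb).
have gj j : (j < b m n k.+1)%N -> good_upto (good m n) j w.
  move=> jb; have [jk|kj] := leqP j (b m n k); first exact: good_upto_le gk.
  apply: good_upto_all => i ij; have [ik|ki] := leqP i (b m n k).
    exact: good_upto_good (good_upto_le ik gk).
  have ib : (i < b m n k.+1)%N by exact: leq_ltn_trans jb.
  have nb l : b m n l <> i.
    move=> bi; have [lk|kl] := leqP l k.
      by have := b_le m n lk; rewrite bi leqNgt ki.
    by have := b_le m n kl; rewrite bi leqNgt ib.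
  have [g1 g2 g3] := Hn2 n k.+1 nn2 km wK i (ltnW ib).
  by split=> // l => [/nb//|_ /nb].
rewrite (stopped_before (V0 n) gj) (stopped_good (V0 n) gk).
have VC i : (i <= b m n k.+1)%N -> V n i w = compensated p F (X ^~ w) n i.
  move=> ib; apply: V_compensated => //; first exact: leq_trans kb.
  by move=> l li; apply: XK; exact: leq_trans (ltnW li) ib.
rewrite !VC//.
by apply: le_trans (Hn3 n k nn3 km wK) _; rewrite /c mulrA.
Qed.

(** On paths with values in [[a, a']] the martingale is eventually not stopped, and
    its terminal values tend to the drift. *)
Lemma drift_negligible_localized : P.-negligible (~` Om) ->
  P.-negligible [set w | (forall u, 0 <= u <= t -> a <= X u w <= a') /\
                         ito_drift F sigma (X ^~ w) t <> 0].
Proof.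
move=> nOm.
pose E j := [set w | [/\ Om w, forall u, 0 <= u <= t -> a <= X u w <= a' &
                      j.+1%:R^-1 < `|ito_drift F sigma (X ^~ w) t|]].
have nE j : P.-negligible (E j).
  have k0 : 0 < (j.+1%:R^-1 : R) by rewrite invr_gt0.
  apply: (stopped_limit_negligible G_sigma G_incr V0 V_meas V_mart Q_meas Q_ge0 VQ QT_int QT_ge0
    Q_sub good_meas L_ge0 _ _ b_mono b0 b_m c_ge0 _ k0 nOm not_bad).
  - by move=> m n i w [].
  - by move=> m n i w [].
  - by move=> m n k w km [_ _ _ _ H]; exact: H.
  move=> w [Ow aX dX] m; have [HY Hqv] := Ow.
  have wK u : 0 <= u <= t -> al <= X u w <= be.
    by move=> /aX /andP[h1 h2]; rewrite (le_trans (ltW al_a) h1) (le_trans h2 (ltW a'_be)).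
  have st : m.+1%:R * (t / m.+1%:R) = t by rewrite mulrCA divff// mulr1.
  have [n2 Hn2] := base_good m Ow.
  have [n3 Hn3] := grid_increment U_open F_C12b KU (@X_cont w) T_gt0 t_gt0 t_le sigma_cont
    F_bound sigma_bound Hqv C_ge0 G_ge0 m.
  have q1 : 0 < (1 : rat) <= 1 by rewrite ltr01 lexx.
  have wK1 u : 0 <= u <= ratr 1 * t -> al <= X u w <= be by rewrite rmorph1 mul1r; exact: wK.
  have H1 := stopped_compensated_cvg U_open F_C12b KU (@X_cont w) T_gt0 t_gt0 t_le sigma_cont
    F_bound Hqv q1 wK1.
  rewrite rmorph1 mul1r in H1.
  have d0 : 0 < `|ito_drift F sigma (X ^~ w) t| - j.+1%:R^-1 by rewrite subr_gt0.
  have [n4 Hn4] := (cvg_seq_eps _ _).1 H1 _ d0.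
  exists (maxn n2 (maxn n3 n4)) => n; rewrite !geq_max => /and3P[nn2 nn3 nn4].
  have wm : inside_until m w m.+1 by move=> u; rewrite st; exact: wK.
  have bg i : (i <= N n)%N -> [/\ al <= X (tm n i) w <= be, `|V n i w| <= L & Q n i w <= L].
    by move=> iN; apply: (Hn2 n m.+1) => //; rewrite b_m.
  have ti i : (i <= N n)%N -> 0 <= tm n i <= t.
    by move=> iN; rewrite -[X in _ <= _ <= X]st; apply: tm_b => //; rewrite b_m.
  have VC i : (i <= N n)%N -> V n i w = compensated p F (X ^~ w) n i.
    move=> iN; apply: V_compensated => // l li.
    by have [] := bg l (leq_trans (ltnW li) iN).
  have gN : good_upto (good m n) (N n) w.
    apply: good_upto_all => i iN; have [g1 g2 g3] := bg i iN; split=> // k.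
      by move=> _; apply: aX; exact: ti.
    move=> km bk; have bkN : (b m n k.+1 <= N n)%N by rewrite bk.
    rewrite !VC//; last exact: leq_trans (b_mono m n k) bkN.
    rewrite /c -mulrA; apply: Hn3 => // u /andP[u0 uk]; apply: wK; rewrite u0/=.
    apply: le_trans uk _; rewrite mulrCA ler_piMr ?(ltW t_gt0)// ler_pdivrMr// mul1r ler_nat//.
  rewrite (stopped_good (V0 n) gN) VC//.
  have := Hn4 n nn4; rewrite -/(N n) => /(le_lt_trans (lerB_dist _ _)).
  by rewrite ltrD2l ltrN2 => /ltW.
apply: (@negligibleS _ _ _ P (~` Om `|` \bigcup_j E j)); last first.
  by apply: negligibleU => //; exact: negligible_bigcup.
move=> w [aX dX]; have [Ow|nO] := pselect (Om w); [right|by left].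
have n0 : 0 < `|ito_drift F sigma (X ^~ w) t| by rewrite normr_gt0; apply/eqP.
have [j Hj] := (cvg_seq_eps _ _).1 (@cvg_invS R) _ n0.
exists j => //; split=> //.
by have := Hj j (leqnn j); rewrite sub0r normrN ger0_norm ?invr_ge0.
Qed.

End Localized.

Hypothesis X_U : {ae P, forall w, forall u, 0 <= u <= T -> U (X u w)}.
Hypothesis X_qv : {ae P, forall w, forall q : rat, 0 <= q <= 1 ->
  qv_sum p (X ^~ w) (ratr q * t) @ \oo -->
  \int[mu]_(u in `[0, ratr q * t]) (sigma (X u w) ^+ 2)}.

Let Y_F_partition : {ae P, forall w, forall n i, (i <= psize p n)%N ->
  Y (ptime p n i) w = F (ptime p n i) (X ^~ w)}.
Proof.
apply: ae_forall_countable => n; apply: ae_forall_countable => i.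
have [ip|pi] := leqP i (psize p n); last by apply: aeW.
by apply: filterS (Y_F (ptime_itv ip)).
Qed.

(** The compensated functional is in the limit both a martingale and, being the
    drift, Lipschitz in time; such a martingale is constant.  Countably many
    rational segments cover all paths. *)
Lemma ito_drift_ae0 : {ae P, forall w, ito_drift F sigma (X ^~ w) t = 0}.
Proof.
have Q : {ae P, forall w, forall q : (rat * rat) * (rat * rat),
    [/\ `[ratr q.1.1, ratr q.2.2] `<=` U, ratr q.1.1 < (ratr q.1.2 : R) &
     ratr q.2.1 < (ratr q.2.2 : R)] ->
    (forall u, 0 <= u <= t -> ratr q.1.2 <= X u w <= ratr q.2.1) ->
    ito_drift F sigma (X ^~ w) t = 0}.
  apply: ae_forall_countable => -[[al a] [a' be]] /=.
  have [[KU al_a a'_be]|H] := pselect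
     [/\ `[ratr al, ratr be] `<=` U, ratr al < (ratr a : R) & ratr a' < (ratr be : R)];
    last by apply: aeW => w.
  have [C C0 F_bound] := C12b_bound F_C12b KU.
  have [G G0 HG] := sqr_bounded_on_segment (ratr al) (ratr be) sigma_cont.
  have nOm : P.-negligible (~` [set w |
      (forall n i, (i <= psize p n)%N -> Y (ptime p n i) w = F (ptime p n i) (X ^~ w)) /\
      (forall q : rat, 0 <= q <= 1 -> qv_sum p (X ^~ w) (ratr q * t) @ \oo -->
         \int[mu]_(u in `[0, ratr q * t]) (sigma (X u w) ^+ 2))]).
    have : {ae P, forall w, (forall n i, (i <= psize p n)%N -> Y (ptime p n i) w = F (ptime p n i) (X ^~ w)) /\
      (forall q : rat, 0 <= q <= 1 -> qv_sum p (X ^~ w) (ratr q * t) @ \oo -->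
         \int[mu]_(u in `[0, ratr q * t]) (sigma (X u w) ^+ 2))}.
      by apply: filterS2 Y_F_partition X_qv => w h1 h2; split.
    exact.
  have := drift_negligible_localized KU al_a a'_be F_bound HG (ltW C0) G0 nOm.
  apply: negligibleS => w /= Hw; apply: contrapT => H; apply: Hw => _ aX.
  by apply: contrapT => dX; apply: H.
apply: filterS2 Q X_U => w Qw Uw.
have cx : {within `[0, t], continuous (X ^~ w)}.
  by apply: continuous_subspaceW (@X_cont w); apply: subset_itvl; rewrite bnd_simp.
have [mn [mx [mnx Hx Hr]]] := path_range (ltW t_gt0) cx.
have KU : `[mn, mx] `<=` U.
  move=> v; rewrite /= in_itv/= => /Hr[u /andP[u0 ut] <-].
  by apply: Uw; rewrite u0 (le_trans ut).
have [al [a [a' [be [h1 h2 h3 h4 h5]]]]] := segment_enlarge U_open mnx KU.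
apply: (Qw ((al, a), (a', be))); first by split.
by move=> u /Hx /andP[hu1 hu2]; rewrite /= (le_trans h2)//= (le_trans hu2).
Qed.

End MartingaleFunctional.

(** * Transfer to all paths through the support *)

Section DriftContinuity.
Context {R : realType} (T : R) (U : set R) (F : R -> (R -> R) -> R).
Notation mu := (@lebesgue_measure R).
Hypotheses (T_gt0 : 0 < T) (F_C12b : C12b U T F).
Variables (al be : R).
Hypothesis KU : `[al, be] `<=` U.
Variables (p : partition_seq T) (t : R) (sigma : R -> R).
Hypotheses (t_gt0 : 0 < t) (t_le : t <= T).
Hypothesis sigma_cont : continuous sigma.

(** Continuity of the drift for the supremum norm.  For the second vertical
    derivative it is left-continuity, used without time delay. *)
Lemma ito_drift_cvg (xs : nat -> R -> R) (z : R -> R) :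
  (forall n, {within `[0, T], continuous (xs n)}) -> {within `[0, T], continuous z} ->
  (forall n u, 0 <= u <= T -> al <= xs n u <= be) -> (forall u, 0 <= u <= T -> al <= z u <= be) ->
  (forall e, 0 < e -> exists N, forall n, (N <= n)%N -> forall u, 0 <= u <= T -> `|z u - xs n u| <= e) ->
  (fun n => ito_drift F sigma (xs n) t) @ \oo --> ito_drift F sigma z t.
Proof.
move=> cxs cz xsK zK close.
have [C C0 F_bound] := C12b_bound F_C12b KU; have [_ bH _ bV] := F_bound.
have [[_ cH [_ _ lV]] _] := F_C12b.
have uT u : 0 <= u < t -> 0 <= u < T by move=> /andP[-> ut]; exact: lt_le_trans t_le.
have cadK u x : 0 <= u < t -> {within `[0, T], continuous x} ->
    (forall u, 0 <= u <= T -> al <= x u <= be) -> cadlag `[al, be] u x.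
  by move=> /uT /andP[_ /ltW uT'] cx xK; exact: cadlagK_x xK cx _ uT'.
have cadU u x : 0 <= u < t -> {within `[0, T], continuous x} ->
    (forall u, 0 <= u <= T -> al <= x u <= be) -> cadlag U u x.
  by move=> ut cx xK; apply: cadlag_sub KU _; exact: cadK.
have [G G0 HG] := sqr_bounded_on_segment al be sigma_cont.
have mD x : {within `[0, T], continuous x} -> (forall u, 0 <= u <= T -> al <= x u <= be) ->
    measurable_fun `[0, t[ (fun u => hderiv F u x) /\
    measurable_fun `]0, t[ (fun u => vderiv (vderiv F) u x * sigma (x u) ^+ 2).
  move=> cx xK.
  exact: (drift_integrands_measurable F_C12b KU p xK cx T_gt0 t_gt0 t_le sigma_cont F_bound).
have H1 : (fun n => \int[mu]_(u in `[0, t[) hderiv F u (xs n)) @ \oo -->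
    \int[mu]_(u in `[0, t[) hderiv F u z.
  have [|||||_ _ //] := @bounded_convergence _ _ R mu `[0, t[ (fun n u => hderiv F u (xs n))
    (fun u => hderiv F u z) C.
  - by [].
  - exact: lebesgue_itvco_lty.
  - by move=> n; have [] := mD _ (@cxs n) (@xsK n).
  - move=> n u; rewrite /= in_itv/= => ut; apply: bH; [exact: uT|exact: (cadK _ _ ut (@cxs n) (@xsK n))].
  move=> u; rewrite /= in_itv/= => ut; apply/cvg_seq_eps => e e0.
  have Iu : `[0, T[%classic u by rewrite /= in_itv/= uT.
  have [eta eta0 Heta] := cH u z e Iu (cadU _ _ ut cz zK) e0.
  have e20 : 0 < eta / 2 by rewrite divr_gt0.
  have [N HN] := close _ e20; exists N => n Nn; apply: Heta; first exact: (cadU _ _ ut (@cxs n) (@xsK n)).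
  apply: (@le_lt_trans _ _ (eta / 2)%:E); last by rewrite lte_fin; lra.
  apply: sup_dist_le => r /andP[r0 ru]; apply: HN; rewrite // r0/=.
  by have /andP[_ /ltW] := uT _ ut; apply: le_trans.
have H2 : (fun n => \int[mu]_(u in `]0, t[) (vderiv (vderiv F) u (xs n) * sigma (xs n u) ^+ 2)) @ \oo -->
    \int[mu]_(u in `]0, t[) (vderiv (vderiv F) u z * sigma (z u) ^+ 2).
  have sub u : 0 < u < t -> 0 <= u < t by move=> /andP[/ltW -> ->].
  have [|||||_ _ //] := @bounded_convergence _ _ R mu `]0, t[
    (fun n u => vderiv (vderiv F) u (xs n) * sigma (xs n u) ^+ 2)
    (fun u => vderiv (vderiv F) u z * sigma (z u) ^+ 2) (C * G).
  - by [].
  - exact: lebesgue_itvoo_lty.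
  - by move=> n; have [] := mD _ (@cxs n) (@xsK n).
  - move=> n u; rewrite /= in_itv/= => /sub ut; rewrite normrM; apply: ler_pM => //.
      by apply: bV; [exact: uT|exact: (cadK _ _ ut (@cxs n) (@xsK n))].
    rewrite ger0_norm ?sqr_ge0//; apply/HG/xsK.
    by have /andP[-> /ltW] := uT _ ut.
  move=> u; rewrite /= in_itv/= => /sub ut.
  have uT' : 0 <= u <= T by have /andP[-> /ltW] := uT _ ut.
  apply: cvgM.
    apply/cvg_seq_eps => e e0.
    have Iu : `[0, T[%classic u by rewrite /= in_itv/= uT.
    have [eta eta0 Heta] := lV u z e Iu (cadU _ _ ut cz zK) e0.
    have e20 : 0 < eta / 2 by rewrite divr_gt0.
    have [N HN] := close _ e20; exists N => n Nn.
    have := Heta 0 (xs n); rewrite subr0; apply.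
    - by rewrite lexx; case/andP: ut.
    - exact: (cadU _ _ ut (@cxs n) (@xsK n)).
    apply: (@dinfty_lt _ _ _ _ _ (eta / 2)) => //; last by rewrite subrr; lra.
    move=> r /andP[r0 ru]; rewrite min_l//; apply: HN; rewrite // r0/=.
    by case/andP: uT' => _; apply: le_trans.
  have xu : (fun n => xs n u) @ \oo --> z u.
    apply/cvg_seq_eps => e e0; have e20 : 0 < e / 2 by rewrite divr_gt0.
    have [N HN] := close _ e20; exists N => n Nn.
    by apply: le_lt_trans (HN n Nn u uT') _; lra.
  have su : (fun n => sigma (xs n u)) @ \oo --> sigma (z u).
    by apply: (continuous_cvg _ _ xu); exact: sigma_cont.
  exact: cvgM.
rewrite /ito_drift; apply: cvgD => //; exact: cvgMr.
Qed.

End DriftContinuity.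

Section Models.
Context {R : realType} (T : R) (U : set R) (p : partition_seq T) (s0 : R) (sigma f : R -> R).
Notation mu := (@lebesgue_measure R).
Context {d : measure_display} {Omega : measurableType d}.
Variables (P : probability Omega R) (X : R -> Omega -> R) (Ft : R -> set (set Omega)).
Hypothesis X_model : model_class U p s0 sigma f P X Ft.

Lemma model_values : {ae P, forall w, forall u, 0 <= u <= T -> U (X u w)}.
Proof. by case: X_model => _ _ h _; apply: filterS h => w []. Qed.

Lemma model_qv t : 0 < t -> t <= T -> {ae P, forall w, forall q : rat, 0 <= q <= 1 ->
  qv_sum p (X ^~ w) (ratr q * t) @ \oo -->
  \int[mu]_(u in `[0, ratr q * t]) (sigma (X u w) ^+ 2)}.
Proof.
move=> t0 tT; have [[_ _ [cX _] _] qX _ _] := X_model.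
have H : {ae P, forall w, forall q : rat, 0 <= q <= 1 -> cvg (qv_sum p (X ^~ w) (ratr q * t) @ \oo)}.
  apply: ae_forall_countable => q.
  have [q01|nq] := pselect (0 <= q <= 1); last by apply: aeW => w.
  have s01 : 0 <= ratr q * t <= T.
    case/andP: q01 => q0 q1; rewrite mulr_ge0 ?ler0q ?(ltW t0)//=.
    by apply: le_trans tT; rewrite ler_piMl ?(ltW t0)// ratr_le1.
  by apply: filterS (cX _ s01).
apply: filterS2 H qX => w Hw qw q q01; rewrite -qw; first exact: Hw.
case/andP: q01 => q0 q1; rewrite mulr_ge0 ?ler0q ?(ltW t0)//=.
by apply: le_trans tT; rewrite ler_piMl ?(ltW t0)// ratr_le1.
Qed.

(** Otherwise a ball around a path of the support would be a subset of a negligible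
    event, hence, by completeness, a measurable event of probability 0. *)
Lemma support_approx (z : R -> R) (B : Omega -> Prop) (e : R) : C_start U T s0 z ->
  {ae P, forall w, B w} -> 0 < e ->
  exists2 w, B w & forall u, 0 <= u <= T -> `|z u - X u w| < e.
Proof.
have [[[cP _ _ _ _] _ _ _] _ _ <-] := X_model; move=> [_ /(_ e) Hz] HB e0.
apply: contrapT => H; have := Hz e0; rewrite lt_neqAle => /andP[/eqP + _]; apply.
have nE : P.-negligible [set w | (sup_dist T (X ^~ w) z < e%:E)%E].
  apply: negligibleS HB => w /= wz Bw; apply: H; exists w => // u uT.
  by rewrite distrC; apply: sup_dist_lt wz _ uT.
by apply/esym/(negligibleP _ (cP _ nE)).
Qed.

End Models.

Section PathwiseFormula.
Context {R : realType} (T : R) (U : set R) (F : R -> (R -> R) -> R).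
Notation mu := (@lebesgue_measure R).
Hypotheses (T_gt0 : 0 < T) (F_C12b : C12b U T F).
Variables (p : partition_seq T) (sigma : R -> R).
Hypothesis sigma_cont : continuous sigma.

Lemma follmer_formula (z : R -> R) (t : R) : 0 < t -> t <= T ->
  {within `[0, T], continuous z} -> (forall u, 0 <= u <= T -> U (z u)) ->
  (forall q : rat, 0 <= q <= 1 -> qv_sum p z (ratr q * t) @ \oo -->
     \int[mu]_(u in `[0, ratr q * t]) (sigma (z u) ^+ 2)) ->
  cvg (follmer_sum p (vderiv F) z t @ \oo) /\
  F t z = F 0 z + follmer_integral p (vderiv F) z t + ito_drift F sigma z t.
Proof.
move=> t0 tT cz zU Hqv.
have [mn [mx [mnx Hx Hr]]] := path_range (ltW T_gt0) cz.
have KU : `[mn, mx] `<=` U.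
  by move=> v; rewrite /= in_itv/= => /Hr[u uT <-]; exact: zU.
have [C C0 F_bound] := C12b_bound F_C12b KU.
have H := follmer_sum_cvg F_C12b KU Hx cz T_gt0 t0 tT sigma_cont F_bound Hqv.
split; first by apply/cvg_ex; eexists; exact: H.
by rewrite /follmer_integral (cvg_lim _ H)//; ring.
Qed.

Lemma follmer_sum0 (z : R -> R) n : follmer_sum p (vderiv F) z 0 n = 0.
Proof.
rewrite /follmer_sum big1// => i; rewrite leNgt => /negP[].
by rewrite -(ptime_first p n); apply: ptime_smono.
Qed.

End PathwiseFormula.

Section SupportTransfer.
Context {R : realType} (T : R) (U : set R) (F : R -> (R -> R) -> R).
Hypotheses (T_gt0 : 0 < T) (U_open : open U) (F_C12b : C12b U T F).
Variables (p : partition_seq T) (s0 : R) (sigma f : R -> R).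
Hypothesis sigma_cont : continuous sigma.
Context {d : measure_display} {Omega : measurableType d}.
Variables (P : probability Omega R) (X : R -> Omega -> R) (Ft : R -> set (set Omega)).
Hypothesis X_model : model_class U p s0 sigma f P X Ft.

(** Paths of [X] with zero drift approximate [z] uniformly, and more closely than
    the distance from the range of [z] to the ends of a larger segment inside [U],
    on which the drift is continuous. *)
Lemma ito_drift_support (t : R) (z : R -> R) : 0 < t -> t <= T ->
  {ae P, forall w, ito_drift F sigma (X ^~ w) t = 0} -> C_start U T s0 z ->
  ito_drift F sigma z t = 0.
Proof.
move=> t0 tT HX Hz; have [[cz zU] _] := Hz.
have [mn [mx [mnx Hx Hr]]] := path_range (ltW T_gt0) cz.
have KU : `[mn, mx] `<=` U.
  by move=> v; rewrite /= in_itv/= => /Hr[u uT <-]; exact: zU.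
have [al [a [a' [be [h1 h2 h3 h4 h5]]]]] := segment_enlarge U_open mnx KU.
have e0 n : 0 < Num.min (Num.min (ratr a - ratr al) (ratr be - ratr a')) (n.+1%:R^-1 : R).
  by rewrite !lt_min !subr_gt0 h1 h4 invr_gt0 ltr0n.
have /choice[w Hw] : forall n : nat, exists w, ito_drift F sigma (X ^~ w) t = 0 /\
    forall u, 0 <= u <= T -> `|z u - X u w| <
      Num.min (Num.min (ratr a - ratr al) (ratr be - ratr a')) (n.+1%:R^-1).
  by move=> n; have [w Hw1 Hw2] := support_approx X_model Hz HX (e0 n); exists w.
have [_ _ _ cX] := X_model.
have [[_ _ _ cont] _ _ _] := X_model.
have : (fun n => ito_drift F sigma (X ^~ (w n)) t) @ \oo --> ito_drift F sigma z t.
  apply: (ito_drift_cvg T_gt0 F_C12b h5 p t0 tT sigma_cont).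
  - by move=> n; exact: (cont (w n)).2.
  - exact: cz.
  - move=> n u uT; have := (Hw n).2 u uT; rewrite !lt_min !ltr_norml.
    have /andP[z1 z2] := Hx u uT.
    move=> /andP[/andP[/andP[b1 b2] /andP[b3 b4]] _]; apply/andP; split; lra.
  - by move=> u /Hx /andP[z1 z2]; apply/andP; split; lra.
  - move=> e /((cvg_seq_eps _ _).1 (@cvg_invS R) _)[N HN]; exists N => n Nn u uT.
    have := (Hw n).2 u uT; rewrite lt_min => /andP[_ /ltW h]; apply: le_trans h _.
    by have := HN n Nn; rewrite sub0r normrN ger0_norm ?invr_ge0// => /ltW.
rewrite (_ : (fun n => _) = (fun=> 0)); last by apply/funext => n; exact: (Hw n).1.
by move=> /(cvg_lim (@Rhausdorff R)) <-; rewrite lim_cst.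
Qed.

End SupportTransfer.

Lemma cond_exp_martingale (R : realType) (T : R) (d : measure_display)
    (Omega : measurableType d) (P : probability Omega R) (Ft : R -> set (set Omega))
    (H : Omega -> R) (Y : R -> Omega -> R) : usual_conditions P T Ft ->
  (forall t, 0 <= t <= T -> is_cond_exp P (Ft t) H (Y t)) -> martingale P T Ft Y.
Proof.
move=> [_ _ inc _ _] HY; split.
  by move=> t /HY[].
move=> s t s0 st tT.
have [ms Is Es] := HY s (introT andP (conj s0 (le_trans st tT))).
have [mt It Et] := HY t (introT andP (conj (le_trans s0 st) tT)).
by split=> // A GA; rewrite Es// Et//; exact: (inc s t).
Qed.

Theorem theorem3p1 (R : realType)
  (T : R) (T_gt0 : 0 < T) (U : set R) (U_open : open U) (s0 : R) (Us0 : U s0)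
  (p : partition_seq T)
  (sigma : R -> R) (sigma_adm : admissible_vol sigma)
  (f : R -> R) (f_flow : vol_flow sigma s0 f)
  (dW : measure_display) (OmegaW : measurableType dW)
  (PW : probability OmegaW R) (W : R -> OmegaW -> R)
  (W_wiener : wiener_space PW T W)
  (M_mart : exp_martingale_assumption PW T W sigma f)
  (d : measure_display) (Omega : measurableType d) (P : probability Omega R)
  (X : R -> Omega -> R)
  (X_model : model_class U p s0 sigma f P X (generated_filtration P X T))
  (X_mart : martingale P T (generated_filtration P X T) X)
  (H : Omega -> R) (H_int : P.-integrable setT (EFin \o H))
  (H_meas : measurable_wrt (generated_filtration P X T T) H)
  (Y : R -> Omega -> R)
  (Y_cond : forall t, 0 <= t <= T ->
     is_cond_exp P (generated_filtration P X T t) H (Y t))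
  (F : R -> (R -> R) -> R) (F_C12b : C12b U T F)
  (Y_F : forall t, 0 <= t <= T -> {ae P, forall w, Y t w = F t (X ^~ w)})
  (d' : measure_display) (Omega' : measurableType d')
  (P' : probability Omega' R) (Z : R -> Omega' -> R)
  (Z_model : model_class U p s0 sigma f P' Z (generated_filtration P' Z T))
  (t : R) (t_itv : 0 <= t <= T) :
  {ae P', forall w,
     cvg (follmer_sum p (vderiv F) (Z ^~ w) t @ \oo) /\
     F t (Z ^~ w) = F 0 (Z ^~ w) + follmer_integral p (vderiv F) (Z ^~ w) t}.
Proof.
have sigma_cont : continuous sigma.
  by move=> v; apply/differentiable_continuous/derivable1_diffP; case: sigma_adm.
have [[X_usual _ _ X0] _ _ _] := X_model.
have [[_ _ _ Z0] _ Z_flow _] := Z_model.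
have Z_start : {ae P', forall w, C_start U T s0 (Z ^~ w)}.
  apply: filterS (model_values Z_model) => w Zw; have [Zw0 cZ] := Z0 w.
  by split.
case/andP: t_itv => t_ge0 t_le.
have [t0|t_le0] := ltP 0 t; last first.
  have -> : t = 0 by apply/eqP; rewrite eq_le t_le0.
  apply: aeW => w; rewrite /follmer_integral.
  have -> : follmer_sum p (vderiv F) (Z ^~ w) 0 = fun=> 0.
    by apply/funext => n; exact: follmer_sum0.
  by split; [exact: is_cvg_cst|rewrite (lim_cst (@Rhausdorff R)) addr0].
have Y_mart : martingale P T (generated_filtration P X T) Y.
  exact: cond_exp_martingale X_usual Y_cond.
have cX w : {within `[0, T], continuous (X ^~ w)} by case: (X0 w).
have drift0 : {ae P, forall w, ito_drift F sigma (X ^~ w) t = 0}.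
  exact: (ito_drift_ae0 T_gt0 U_open F_C12b sigma_cont X_usual cX X_mart Y_mart Y_F t0 t_le
    (model_values X_model) (model_qv X_model t0 t_le)).
apply: filterS2 Z_start (model_qv Z_model t0 t_le) => w Zw Zqv.
have [[cZ ZU] _] := Zw.
have [cv E] := follmer_formula T_gt0 F_C12b sigma_cont t0 t_le cZ ZU Zqv.
split=> //; rewrite E.
by rewrite (ito_drift_support T_gt0 U_open F_C12b sigma_cont X_model t0 t_le drift0 Zw) addr0.
Qed.
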